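(* Consider the Markov decision process described in the context: state space $\mathcal{X}$, action spaces $A(\mathbf{x}) = \{\mathbf{y}\in\mathcal{X} : \mathbf{y}\subset\mathbf{x}\}$ for $\mathbf{x}\in\mathcal{X}$, reward function $r(\mathbf{x},\mathbf{a}) = R\sum_{(x,m)\in\mathbf{x}\setminus\mathbf{a}} m$ with $R>0$, and birth-death-growth dynamics based on independent deaths with probability $p_d\in(0,1)$, a Poisson birth process on $W$ with intensity $\beta>0$ marked independently according to a probability measure $\nu$ on $[0,K]$, $K>0$, and the logistic growth function with parameter $\lambda>0$. Let $0\le\alpha<1$. Then, for every $\mathbf{x}\in\mathcal{X}$, the optimal $\alpha$-discounted total expected reward is $$ v^*_\alpha(\mathbf{x}) = R\,\beta\,|W| \sum_{k=1}^\infty \alpha^k \int_0^K s(m)\, d\nu(m) + R\sum_{(x,m)\in\mathbf{x}} s(m), $$ where $|W|$ is the area of $W$ and $$ s(m) = \sup_{n\in\mathbb{N}_0}\left\{ \frac{K\alpha^n(1-p_d)^n}{1+\left(\frac{K}{m}-1\right)e^{-\lambda n}} \right\},\qquad m\in[0,K] $$ (the fraction being read as $0$ when $m=0$). Furthermore, the optimal $\alpha$-discounted total expected reward is attained by a French thinning that removes all points with a mark that is at least $$ d^*_\alpha = \sup_{n\in\mathbb{N}_0}\left\{ \frac{K}{1-e^{-n\lambda}}\left(\alpha^n(1-p_d)^n - e^{-n\lambda}\right)\right\}, $$ where the term with $n=0$ is read as $0$. That is, the stationary deterministic Markov policy $\phi$ with $\phi_i(\mathbf{x}) = \{(x,m)\in\mathbf{x}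 : m<d^*_\alpha\}$ for all $i\in\mathbb{N}_0$ satisfies $v^\phi_\alpha(\mathbf{x}) = v^*_\alpha(\mathbf{x})$ for all $\mathbf{x}\in\mathcal{X}$.
   Context: Notation: $\mathbb{N}_0=\{0,1,2,\dots\}$; $0^0=1$. $W\subset\mathbb{R}^2$ is compact with area $|W|$, and $K>0$. The state space $\mathcal{X}$ is the set of finite simple marked point patterns $\mathbf{x}$ on $W$ with marks in $[0,K]$, i.e. finite sets of pairs $(x,m)$ with $x\in W$, $m\in[0,K]$ and distinct locations; it is equipped with the Borel $\sigma$-algebra of the weak topology (and is Polish). In state $\mathbf{x}$ an action is a subset $\mathbf{a}\subset\mathbf{x}$ of retained points; all subsets are allowed. Logistic growth: for $n\in\mathbb{N}_0$ and $m_0\in(0,K]$, $g^{(n)}(m_0) = K/\left(1+\left(\frac{K}{m_0}-1\right)e^{-\lambda n}\right)$ with $\lambda>0$, and $g^{(n)}(0)=0$ by convention. Dynamics: when action $\mathbf{a}$ is taken in state $\mathbf{x}$, the next state is obtained as follows. (1) Delete $\mathbf{x}\setminus\mathbf{a}$. (2) Independently of other points, each $(x,m)\in\mathbf{a}$ dies (is removed) with probability $p_d\in(0,1)$ and otherwise becomes $(x,g^{(1)}(m))$. (3) Add a (homogeneous) Poisson process on $W$ with intensity $\beta>0$, independent of the rest, whose points are marked independently according to a probability measure $\nu$ on $[0,K]$. Policies: write $(X_i,Y_i)_{i\ge0}$ for the successive states and actions. A (randomised, history dependent) policy $\phi=(\phi_i)_{i\ge0}$ is a sequence of conditional probability kernels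 $\phi_i(\cdot\mid X_0,Y_0,\dots,X_{i-1},Y_{i-1},X_i)$ generating $Y_i$, with $\phi_i(A(\mathbf{x}_i)\mid\mathbf{x}_0,\mathbf{a}_0,\dots,\mathbf{x}_i)=1$. A policy is deterministic Markov if $Y_i=\phi_i(X_i)$ is a function of $X_i$, and stationary if $\phi_i$ does not depend on $i$. For a policy $\phi$, $$v^\phi_\alpha(\mathbf{x}) = \mathbb{E}^\phi\left[\sum_{i=0}^\infty \alpha^i\, R\sum_{(x,m)\in X_i\setminus Y_i} m \,\Big|\, X_0=\mathbf{x}\right],$$ and $v^*_\alpha(\mathbf{x})=\sup_\phi v^\phi_\alpha(\mathbf{x})$, the supremum being over all policies, including randomised ones. *)

(* Defs.v *)
(* MathComp-Analysis *)
From HB Require Import structures.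
From mathcomp Require Import all_boot all_order all_algebra.
From mathcomp Require Import finmap.
From mathcomp Require Import all_classical all_reals all_analysis.

Set Implicit Arguments.
Unset Strict Implicit.
Unset Printing Implicit Defensive.

Import Order.TTheory GRing.Theory Num.Theory.
Import numFieldNormedType.Exports.

Local Open Scope classical_set_scope.
Local Open Scope ring_scope.
Local Open Scope ereal_scope.

(* A marked point is ((x1, x2), m): a location in the plane and a mark. *)
Notation mpoint R := (R * R * R)%type.

Section pattern.
Context {R : realType}.
Variables (W : set (R * R)) (K : R).

Definition simple_marked (x : {fset mpoint R}) : Prop :=
  [/\ forall z, z \in x -> W z.1,
      forall z, z \in x -> (0 <= z.2 <= K)%R &
      forall z z', z \in x -> z' \in x -> z.1 = z'.1 -> z = z'].

Record pattern := Pattern {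
  pts : {fset mpoint R} ;
  ptsP : `[< simple_marked pts >] }.

HB.instance Definition _ := [isSub for pts].
HB.instance Definition _ := [Choice of pattern by <:].

Lemma simple_marked0 : simple_marked fset0.
Proof. by split=> z; rewrite inE. Qed.

Definition pattern0 : pattern := Pattern (introT (asboolP _) simple_marked0).

HB.instance Definition _ := isPointed.Build pattern pattern0.

(* The pattern with set of points [x]; the empty pattern when [x] is not the
   set of points of a simple marked pattern. *)
Definition to_pattern (x : {fset mpoint R}) : pattern := insubd pattern0 x.

Definition test_fun : Type :=
  {f : mpoint R -> R | {within W `*` `[0%R, K], continuous f}}.

Definition pattern_eval (x : pattern) : {ptws test_fun -> R} :=
  fun f => (\sum_(z <- pts x) sval f z)%R.

(* The weak topology: the coarsest one for which all the maps
   x |-> \sum_(z in x) f z are continuous, for f continuous on the compact set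
   W * [0, K] (hence bounded). *)
HB.instance Definition _ :=
  Topological.copy pattern (initial_topology pattern_eval).

HB.instance Definition _ :=
  Measurable.copy pattern (g_sigma_algebraType (@open pattern)).

End pattern.

Definition area {R : realType} :
    set (measurableTypeR R * measurableTypeR R) -> \bar R :=
  @lebesgue_measure R \x @lebesgue_measure R.

HB.instance Definition _ (R : realType) := Measure.on (@area R).

Section dynamics.
Context {R : realType}.
Variables (W : set (R * R)) (K pd beta lambda : R).
Variable nu : probability (measurableTypeR R) R.

Definition growth (n : nat) (m : R) : R :=
  if m == 0%R then 0%R
  else (K / (1 + (K / m - 1) * expR (- (lambda * n%:R))))%R.

Definition grow (b : {fset mpoint R}) : {fset mpoint R} :=
  [fset (z.1, growth 1 z.2) | z in b]%fset.

(* Law of the grown survivors of the retained points [a]: the set of survivors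
   is [b] with probability pd ^ (#|a| - #|b|) * (1 - pd) ^ #|b|. *)
Definition survivors_law (a : pattern W K) (U : set (pattern W K)) : \bar R :=
  \sum_(b <- fpowerset (pts a))
    (pd ^+ #|` (pts a `\` b)%fset | * (1 - pd) ^+ #|` b |)%:E *
    \d_(to_pattern W K (grow b)) U.

(* The integral of [f [:: z_1; ..; z_n]] over (W * [0, K]) ^ n with respect to
   the n-th power of area (x) nu. *)
Fixpoint points_integral (n : nat) (f : seq (mpoint R) -> \bar R) : \bar R :=
  if n is n'.+1 then
    \int[area]_(x in W) \int[nu]_(m in `[0%R, K])
      points_integral n' (fun s => f ((x, m) :: s))
  else f [::].

(* Law of the Poisson process on W with intensity beta and independent marks of
   law nu: the number of points has the Poisson law of parameter beta * |W| and,
   given that there are n points, these are independent, with uniform locations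
   on W and marks of law nu. The factors |W| ^ n of the Poisson probabilities
   and |W|^-1 of the n uniform densities cancel out, so that |W| = 0 needs no
   special treatment. Almost surely the n locations are distinct, hence the
   default case of [to_pattern] is immaterial. *)
Definition birth_law (U : set (pattern W K)) : \bar R :=
  \sum_(0 <= n <oo)
    (expR (- (beta * fine (area W))) * (beta ^+ n / n`!%:R))%:E *
    points_integral n
      (fun s => \d_(to_pattern W K [fset z in s]%fset) U).

(* Law of the next state given that the points of [a] were retained; it depends
   on the current state only through the action [a], which is a subset of it.
   Almost surely newborn points do not share a location with survivors. *)
Definition next_law (a : pattern W K) (U : set (pattern W K)) : \bar R :=
  \int[survivors_law a]_b \int[birth_law]_z
    \d_(to_pattern W K (pts b `|` pts z)%fset) U.

End dynamics.

Section process.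
Context {R : realType}.
Variables (W : set (R * R)) (K pd beta lambda : R).
Variable nu : probability (measurableTypeR R) R.
Variables (c alpha : R).

Local Notation X := (pattern W K).

(* [((x_0, a_0), .., (x_(i-1), a_(i-1))), x_i] *)
Definition history (i : nat) : Type := (i.-tuple (X * X) * X)%type.

HB.instance Definition _ i := Measurable.on (history i).

Definition actions (x : X) : set X := [set a | (pts a `<=` pts x)%fset].

Record policy := Policy {
  decision : forall i : nat, R.-pker (history i) ~> X ;
  decision_actions : forall i (h : history i),
    decision i h (actions h.2) = 1 }.

Definition deterministic_markov (phi : policy) (f : nat -> X -> X) : Prop :=
  forall i (h : history i) (U : set X), measurable U ->
    decision phi i h U = \d_(f i h.2) U.

Definition stationary_deterministic (phi : policy) (f : X -> X) : Prop :=
  deterministic_markov phi (fun=> f).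

(* Trajectories of states and actions, with the product sigma-algebra. *)
Definition trajectory : Type := g_sigma_algebraType
  (\bigcup_i preimage_set_system setT (fun w : nat -> X * X => w i) measurable).

HB.instance Definition _ := Measurable.on trajectory.
HB.instance Definition _ := Pointed.on trajectory.

Definition state (i : nat) (w : trajectory) : X := (w i).1.
Definition action (i : nat) (w : trajectory) : X := (w i).2.
Definition past (i : nat) (w : trajectory) : history i :=
  ([tuple w j | j < i], state i w).

(* [P] is the law of the states and actions under the policy [phi] when
   X_0 = x: [decision phi i] is the conditional law of Y_i given
   (X_0, Y_0, .., X_i), and [next_law Y_i] is that of X_(i+1) given
   (X_0, Y_0, .., X_i, Y_i). *)
Definition trajectory_law (phi : policy) (x : X)
    (P : probability trajectory R) : Prop :=
  [/\ forall B : set X, measurable B -> P (state 0 @^-1` B) = \d_x B,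
      forall i (D : set (history i)) (B : set X),
        measurable D -> measurable B ->
        P [set w | D (past i w) /\ B (action i w)] =
        \int[P]_(w in past i @^-1` D) decision phi i (past i w) B
    & forall i (D : set (history i * X)) (B : set X),
        measurable D -> measurable B ->
        P [set w | D (past i w, action i w) /\ B (state i.+1 w)] =
        \int[P]_(w in [set w | D (past i w, action i w)])
          next_law pd beta lambda nu (action i w) B].

(* The law of the process exists (Ionescu-Tulcea theorem) and is unique, so
   that [get] selects it. *)
Definition path_law (phi : policy) (x : X) : probability trajectory R :=
  get (trajectory_law phi x).

Definition reward (x a : X) : R :=
  (c * \sum_(z <- (pts x `\` pts a)%fset) z.2)%R.

Definition value (phi : policy) (x : X) : \bar R :=
  \int[path_law phi x]_w
    \sum_(0 <= i <oo) (alpha ^+ i * reward (state i w) (action i w))%:E.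

Definition optimal_value (x : X) : \bar R :=
  ereal_sup [set value phi x | phi in [set: policy]].

Definition french_thinning (d : R) (x : X) : X :=
  to_pattern W K [fset z in pts x | (z.2 < d)%R]%fset.

End process.

Section constants.
Context {R : realType}.
Variables (K pd lambda alpha : R).

Definition best_mark (m : R) : R :=
  if m == 0%R then 0%R else
  sup [set (K * alpha ^+ n * (1 - pd) ^+ n /
            (1 + (K / m - 1) * expR (- (lambda * n%:R))))%R
      | n in [set: nat]].

(* For n = 0 the term is (K / 0) * 0 = 0. *)
Definition threshold : R :=
  sup [set (K / (1 - expR (- (n%:R * lambda))) *
            (alpha ^+ n * (1 - pd) ^+ n - expR (- (n%:R * lambda))))%R
      | n in [set: nat]].

End constants.

(* Main.v *)
(* Let q = alpha (1 - pd) and let g be one step of growth. The function s solves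
   s(m) = max (m, q s(g(m))), and the maximum is m exactly when m >= d. By
   Campbell's formula the expectation of s summed over the next state is
   (1 - pd) times the sum of s(g(m)) over the retained points, plus
   beta |W| \int s dnu. Hence V(x) = C + c \sum_x s, where C is the discounted
   value of all future births, satisfies r(x, a) + alpha E[V(X_1) | a] <= V(x)
   for every action a, with equality for the French thinning. Iterating, the
   value of any policy is at most V(x); for the French thinning the remainder
   alpha^n E V(X_n) tends to 0 because E #X_n stays bounded, so V is attained.

   On the measure-theoretic side, the Borel sets of the pattern space are
   generated by the events that a rational box contains a point, which gives a
   measurable enumeration of the points of a pattern and reduces measurability
   questions to finite sequences. The law of the process under the French
   thinning is provided by the Ionescu-Tulcea theorem for a Markov kernel. For
   a policy without trajectory law, path_law is the Dirac mass at the
   trajectory of empty patterns, and the value is 0. *)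

Require Import Defs.
From HB Require Import structures.
From mathcomp Require Import all_boot all_order all_algebra.
From mathcomp Require Import finmap.
From mathcomp Require Import all_classical all_reals all_analysis.
From mathcomp Require Import measurable_realfun giry ring.

Set Implicit Arguments.
Unset Strict Implicit.
Unset Printing Implicit Defensive.

Import Order.TTheory GRing.Theory Num.Theory.
Import numFieldNormedType.Exports.

Local Open Scope classical_set_scope.
Local Open Scope ring_scope.
Local Open Scope ereal_scope.

(** The upper bound is drawn from the clauses of [trajectory_law] for whatever measure satisfies
    them. Existence is proved for the French thinning, whose actions are functions of the states, so
    that building the Markov chain of states is enough. The laws in the statement are bare set
    functions; each is matched with a genuine measure or kernel having the same values on measurable
    sets, and integrals see nothing else. The weak topology comes from uncountably many test
    functions, while measurability and almost sure statements call for countable families; a pattern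
    is determined by the rational boxes that it hits, and these are countable. Sums over a union of
    patterns add up only when no locations coincide: otherwise points merge or [to_pattern] falls
    back on the empty pattern. Expectations are therefore computed on sequences of points, where
    coincidences form a null set. The constant C solves C = alpha (C + c beta |W| \int s dnu). *)

Lemma measurable_preimage d1 d2 (S1 : measurableType d1) (S2 : measurableType d2)
  (f : S1 -> S2) A : measurable_fun setT f -> measurable A -> measurable (f @^-1` A).
Proof. by move=> mf mA; rewrite -[X in measurable X]setTI; exact: mf. Qed.

(** * Integrals against measurable kernels *)

Section giry_param.
Context d1 d2 (S : measurableType d1) (T : measurableType d2) (R : realType).

Lemma giry_int_retprod (s : S) (m : giry T R) (F : S * T -> \bar R) :
  measurable_fun setT F -> (forall p, 0 <= F p) ->
  giry_int (giry_prod (giry_ret s, m)) F = giry_int m (fun y => F (s, y)).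
Proof.
move=> mF F0; rewrite giry_int_prod2//.
by apply: eq_integral => y _; rewrite giry_int_ret//; exact: measurable_fun_pair1.
Qed.

Lemma measurable_retprod (k : S -> giry T R) : measurable_fun setT k ->
  measurable_fun setT (fun s => giry_prod (giry_ret s, k s)).
Proof.
move=> mk; apply: (measurableT_comp (@measurable_giry_prod _ _ _ _ R)).
by apply: measurable_fun_pair => //; exact: measurable_giry_ret.
Qed.

(** The law of the pair (s, Y), with Y of law [k s], absorbs the parameter of the integrand: the
    integral becomes that of one fixed function against a kernel depending measurably on [s]. *)
Lemma measurable_giry_int_param (k : S -> giry T R) (F : S * T -> \bar R) :
  measurable_fun setT k -> measurable_fun setT F -> (forall p, 0 <= F p) ->
  measurable_fun setT (fun s => giry_int (k s) (fun y => F (s, y))).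
Proof.
move=> mk mF F0.
rewrite (_ : (fun s => _) = (fun s => giry_int (giry_prod (giry_ret s, k s)) F)).
  exact: (measurableT_comp (measurable_giry_int mF F0) (measurable_retprod mk)).
by apply/funext => s; rewrite giry_int_retprod.
Qed.

End giry_param.

(** * The Ionescu-Tulcea theorem for Markov kernels *)

Section paths.
Context d (T : measurableType d).

Definition paths : Type := g_sigma_algebraType
  (\bigcup_i preimage_set_system setT (fun w : nat -> T => w i) measurable).

HB.instance Definition _ := Measurable.on paths.
HB.instance Definition _ := Pointed.on paths.

Lemma measurable_coord (i : nat) : measurable_fun setT (fun w : paths => w i).
Proof.
move=> _ B mB; apply: sub_sigma_algebra; exists i => //.
by exists B.
Qed.

Lemma measurable_pathsP d' (S : measurableType d') (F : S -> paths) :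
  (forall i, measurable_fun setT (fun s => F s i)) -> measurable_fun setT F.
Proof.
move=> mF; apply: (@measurability _ _ S paths setT F _ erefl).
move=> _ [_ [i _ [B mB <-]] <-]; rewrite !setTI.
by rewrite -[X in measurable X]setTI; apply: mF.
Qed.

(** A path up to time n is encoded as an infinite path that stays constant from n on, so that all
    finite-dimensional laws live on the single space [paths]. *)
Definition freeze (n : nat) (w : paths) : paths := fun i => w (minn i n).

Lemma measurable_freeze n : measurable_fun setT (freeze n).
Proof. by apply: measurable_pathsP => i; exact: measurable_coord. Qed.

Lemma freeze_freeze m n w : freeze m (freeze n w) = freeze (minn m n) w.
Proof. by apply/funext => i; rewrite /freeze minnA. Qed.

(** The new state fills all times after n, so that the result is frozen at time n + 1. *)
Definition step (n : nat) (p : paths * T) : paths :=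
  fun i => if (i <= n)%N then p.1 i else p.2.

Lemma measurable_step n : measurable_fun setT (step n).
Proof.
apply: measurable_pathsP => i; rewrite /step; case: (i <= n)%N; last exact: measurable_snd.
exact: (measurableT_comp (@measurable_coord i)).
Qed.

Lemma freeze_step n m (w : paths) y : (n <= m)%N -> freeze n (step m (w, y)) = freeze n w.
Proof.
move=> nm; apply/funext => i; rewrite /freeze /step.
by rewrite (leq_trans (geq_minr _ _) nm).
Qed.

Lemma freeze_stepS n (w : paths) y : freeze n.+1 (step n (w, y)) = step n (w, y).
Proof.
apply/funext => i; rewrite /freeze /step /=.
by case: (leqP i n.+1) => // ni; rewrite ltnn leqNgt ltnW.
Qed.

(** Invariance under [freeze n] says that membership depends on the coordinates up to n only. *)
Definition cylinder (n : nat) (C : set paths) := freeze n @^-1` C = C.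

Lemma cylinderP n C w w' : cylinder n C ->
  (forall i, (i <= n)%N -> w i = w' i) -> C w -> C w'.
Proof.
move=> Cn ww' Cw; rewrite -Cn /= (_ : freeze n w' = freeze n w).
  by move: Cw; rewrite -{1}Cn.
by apply/funext => i; rewrite /freeze ww'// geq_minr.
Qed.

Lemma cylinder_le n m C : (n <= m)%N -> cylinder n C -> cylinder m C.
Proof.
move=> nm Cn; rewrite /cylinder -{1}Cn.
by rewrite -[RHS]Cn; apply/seteqP; split => w /=; rewrite freeze_freeze (minn_idPl nm).
Qed.

Lemma cylinder_freeze n (C : set paths) w : cylinder n C ->
  (freeze n w \in C) = (w \in C).
Proof. by move=> Cn; rewrite -[in RHS]Cn; apply/idP/idP; rewrite !inE. Qed.

Lemma cylinder_step n m (C : set paths) w y : (n <= m)%N -> cylinder n C ->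
  (step m (w, y) \in C) = (w \in C).
Proof.
by move=> nm Cn; apply/idP/idP; rewrite !inE -Cn /= freeze_step.
Qed.

Lemma cylinder0 n : cylinder n set0. Proof. by rewrite /cylinder preimage_set0. Qed.

Lemma cylinderU n C C' : cylinder n C -> cylinder n C' -> cylinder n (C `|` C').
Proof. by rewrite /cylinder preimage_setU => -> ->. Qed.

Lemma cylinderC n C : cylinder n C -> cylinder n (~` C).
Proof. by move=> Cn; rewrite /cylinder -preimage_setC Cn. Qed.

Definition cylinders : set (set paths) :=
  [set C | measurable C /\ exists n, cylinder n C].

Lemma cylinders0 : cylinders set0.
Proof. by split => //; exists 0%N; exact: cylinder0. Qed.

Lemma cylindersU : setU_closed cylinders.
Proof.
move=> A B [mA [n An]] [mB [m Bm]]; split; first exact: measurableU.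
exists (maxn n m); apply: cylinderU.
  exact: cylinder_le (leq_maxl _ _) An.
exact: cylinder_le (leq_maxr _ _) Bm.
Qed.

Lemma cylindersC : setC_closed cylinders.
Proof.
move=> A [mA [n An]]; split; first exact: measurableC.
by exists n; exact: cylinderC.
Qed.

(** An alias of [paths] that carries the algebra of cylinders, on which the content to be extended
    is defined. *)
Definition cyl_paths : Type := paths.
HB.instance Definition _ := Pointed.on cyl_paths.
Definition cyl_display : measure_display. Proof. by constructor. Qed.
HB.instance Definition _ := @isAlgebraOfSets.Build cyl_display cyl_paths cylinders
  cylinders0 cylindersU cylindersC.

Lemma paths_sub_cylinders (A : set paths) : measurable A -> <<s cylinders >> A.
Proof.
apply: smallest_sub; first exact: smallest_sigma_algebra.
move=> _ [i _ [B mB <-]]; rewrite setTI; apply: sub_sigma_algebra; split.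
  by rewrite -[X in measurable X]setTI; exact: measurable_coord.
by exists i; apply/seteqP; split => w; rewrite /= /freeze minnn.
Qed.

End paths.

Section ionescu_tulcea.
Context d (T : measurableType d) (R : realType).
Variables (Q : T -> giry T R) (mQ : measurable_fun setT Q).
Hypothesis Q1 : forall x, Q x setT = 1.
Variable x0 : T.

Local Notation paths := (paths T).

Let mQn (n : nat) : measurable_fun setT (fun w : paths => Q (w n)).
Proof. exact: (measurableT_comp mQ (@measurable_coord _ T n)). Qed.

Definition step_kernel n (w : paths) : giry paths R :=
  giry_map (@measurable_step _ T n) (giry_prod (giry_ret w, Q (w n))).

Lemma measurable_step_kernel n : measurable_fun setT (step_kernel n).
Proof.
exact: (measurableT_comp (measurable_giry_map (@measurable_step _ T n))
  (measurable_retprod (mQn n))).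
Qed.

Lemma int_step_kernel (n : nat) (w : paths) (g : paths -> \bar R) :
  measurable_fun [set: paths] g -> (forall w, 0 <= g w) ->
  \int[step_kernel n w]_v g v = \int[Q (w n)]_y g (step n (w, y)).
Proof.
move=> mg g0; rewrite -[LHS]/(giry_int _ _) giry_int_map//.
rewrite giry_int_retprod//; last by move=> ?; exact: g0.
exact: (measurableT_comp mg (@measurable_step _ T n)).
Qed.

Fixpoint frozen_law (n : nat) : giry paths R :=
  if n is m.+1 then giry_bind (frozen_law m) (measurable_step_kernel m)
  else giry_ret ((fun=> x0) : paths).

Lemma int_frozen_lawS n (g : paths -> \bar R) :
  measurable_fun [set: paths] g -> (forall w, 0 <= g w) ->
  \int[frozen_law n.+1]_w g w =
  \int[frozen_law n]_w \int[Q (w n)]_y g (step n (w, y)).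
Proof.
move=> mg g0; rewrite -[LHS]/(giry_int _ _) /= giry_int_bind//.
by apply: eq_integral => w _; exact: int_step_kernel.
Qed.

Lemma frozen_lawS n (A : set paths) : measurable A ->
  frozen_law n.+1 A =
  \int[frozen_law n]_w \int[Q (w n)]_y (\1_A (step n (w, y)))%:E.
Proof.
move=> mA; rewrite -[A in LHS]setIT -integral_indic//.
apply: (@int_frozen_lawS n (fun w => (\1_A w)%:E)); first exact/measurable_EFinP.
by move=> w; rewrite lee_fin.
Qed.

Lemma freeze_frozen_law n (A : set paths) : measurable A ->
  frozen_law n (freeze n @^-1` A) = frozen_law n A.
Proof.
move=> mA; have mfA m : measurable (freeze m @^-1` A).
  exact: measurable_preimage (@measurable_freeze _ T m) mA.
case: n => [|n]; first by rewrite /= /giry_ret !diracE.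
rewrite (frozen_lawS n (mfA n.+1)) (frozen_lawS n mA).
apply: eq_integral => w _; apply: eq_integral => y _.
by rewrite !indicE; congr (_%:R%:E); rewrite -[in RHS](freeze_stepS n w y).
Qed.

Lemma frozen_law1 n : frozen_law n setT = 1.
Proof.
elim: n => [|n IH]; first by rewrite /= /giry_ret diracT.
rewrite frozen_lawS//.
rewrite -[RHS]IH -[RHS]mul1e -integral_cst//; apply: eq_integral => w _.
rewrite -[RHS](Q1 (w n)) -[RHS]mul1e -integral_cst//; apply: eq_integral => y _.
by rewrite indicT.
Qed.

(** Consistency of the finite-dimensional laws: step n leaves the coordinates up to n alone, and [Q]
    has total mass 1. *)
Lemma frozen_law_cylinderS n (A : set paths) : measurable A -> cylinder n A ->
  frozen_law n.+1 A = frozen_law n A.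
Proof.
move=> mA An; rewrite frozen_lawS// -[in RHS](setIT A) -integral_indic//.
apply: eq_integral => w _.
rewrite -[RHS]mule1 -(Q1 (w n)) -integral_cst//.
by apply: eq_integral => y _ /=; rewrite !indicE (cylinder_step _ _ (leqnn n)).
Qed.

Lemma frozen_law_cylinder n m (A : set paths) : (n <= m)%N -> measurable A ->
  cylinder n A -> frozen_law m A = frozen_law n A.
Proof.
move=> /subnK <- mA An; elim: (m - n)%N => // k IH.
by rewrite addSn frozen_law_cylinderS//; exact: cylinder_le (leq_addl _ _) An.
Qed.

(* Any level of the cylinder C gives the same value. *)
Definition cyl_content (C : set (cyl_paths T)) : \bar R :=
  frozen_law (xget 0%N [set n | cylinder n C]) C.

Lemma cyl_contentE n C : measurable C -> cylinder n C -> cyl_content C = frozen_law n C.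
Proof.
move=> mC Cn; rewrite /cyl_content; have := @xgetI _ 0%N [set n | cylinder n C] _ Cn.
set m := xget _ _ => /= Cm.
by case: (leqP m n) => [mn|/ltnW mn]; [rewrite [RHS](frozen_law_cylinder mn)|rewrite (frozen_law_cylinder mn)].
Qed.

(** The probability that the chain, given its coordinates up to n and run for m more steps, then
    frozen, lies in [C]. *)
Fixpoint cond_prob (m n : nat) (C : set paths) (w : paths) : \bar R :=
  if m is m'.+1 then giry_int (Q (w n)) (fun y => cond_prob m' n.+1 C (step n (w, y)))
  else (\1_C w)%:E.

Lemma cond_prob_ge0 m n C w : 0 <= cond_prob m n C w.
Proof.
elim: m n w => [|m IH] n w /=; first by rewrite lee_fin.
by apply: integral_ge0 => y _; exact: IH.
Qed.

Lemma measurable_cond_prob m n C : measurable C ->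
  measurable_fun setT (cond_prob m n C).
Proof.
move=> mC; elim: m n => [|m IH] n /=; first by apply/measurable_EFinP.
apply: (@measurable_giry_int_param _ _ _ _ _ _ (fun p => cond_prob m n.+1 C (step n p))).
- exact: mQn.
- exact: measurableT_comp (IH _) (@measurable_step _ T n).
- by move=> p; exact: cond_prob_ge0.
Qed.

Lemma measurable_cond_prob_step m n C w : measurable C ->
  measurable_fun setT (fun y => cond_prob m n C (step n.-1 (w, y))).
Proof.
move=> mC; apply: (measurable_fun_pair2 (f := fun p => cond_prob m n C (step n.-1 p))).
exact: measurableT_comp (measurable_cond_prob _ _ mC) (@measurable_step _ T _).
Qed.

Lemma cond_prob_le1 m n C w : measurable C -> cond_prob m n C w <= 1.
Proof.
move=> mC; elim: m n w => [|m IH] n w /=.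
  by rewrite lee_fin indicE; case: (_ \in _).
rewrite -(Q1 (w n)) -[leRHS]mul1e -integral_cst//.
apply: ge0_le_integral => //.
- by move=> y _; exact: cond_prob_ge0.
- exact: (@measurable_cond_prob_step m n.+1).
Qed.

Lemma int_cond_prob m n C : measurable C ->
  \int[frozen_law n]_w cond_prob m n C w = frozen_law (n + m) C.
Proof.
move=> mC; elim: m n => [|m IH] n /=.
  by rewrite addn0 integral_indic// setIT.
rewrite addnS -addSn -IH int_frozen_lawS//; first exact: measurable_cond_prob.
by move=> w; exact: cond_prob_ge0.
Qed.

(* Kolmogorov's argument: if the probabilities of decreasing cylinders did not
   tend to 0, one could choose states one at a time so that the conditional
   probabilities do not tend to 0 either; the path so chosen lies in all the
   cylinders. *)
Section continuity.
Variables (C : nat -> set paths) (N : nat -> nat).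
Hypotheses (mC : forall k, measurable (C k)) (CN : forall k, cylinder (N k) (C k)).
Hypothesis niC : forall j k, (j <= k)%N -> C k `<=` C j.

(** By truncated subtraction, [h k n] is the indicator of [C k] as soon as n >= N k, when membership
    is already decided. *)
Let h k n w := cond_prob (N k - n) n (C k) w.

Let hE k n w : (N k <= n)%N -> h k n w = (\1_(C k) w)%:E.
Proof. by rewrite /h -subn_eq0 => /eqP ->. Qed.

Let h_step k n w : h k n w = \int[Q (w n)]_y h k n.+1 (step n (w, y)).
Proof.
case: (ltnP n (N k)) => nN.
  by rewrite /h -(subnSK nN).
rewrite hE// -[LHS]mule1 -(Q1 (w n)) -integral_cst//.
by apply: eq_integral => y _; rewrite hE ?leqW//= !indicE (cylinder_step _ _ nN).
Qed.

Let h_ge0 k n w : 0 <= h k n w. Proof. exact: cond_prob_ge0. Qed.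
Let h_le1 k n w : h k n w <= 1. Proof. exact: cond_prob_le1. Qed.

Let mh k n w : measurable_fun setT (fun y => h k n.+1 (step n (w, y))).
Proof. exact: (@measurable_cond_prob_step _ n.+1). Qed.

(** Backward induction from a time beyond both levels, where both sides are indicators and the
    inclusion of the cylinders applies. *)
Let h_ni j k n w : (j <= k)%N -> h k n w <= h j n w.
Proof.
move=> jk; set M := maxn (N j) (N k).
have [m] : exists m, (M <= n + m)%N by exists M; rewrite leq_addl.
elim: m n w => [|m IH] n w Mn.
  rewrite addn0 in Mn; rewrite !hE ?(leq_trans _ Mn) ?leq_maxl ?leq_maxr// lee_fin.
  rewrite !indicE; case: (boolP (w \in C k)) => // /set_mem/(niC jk)/mem_set ->.
  by [].
rewrite !h_step; apply: ge0_le_integral => // y _.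
by apply: IH; rewrite addSnnS.
Qed.

Let good n w := ~ (h k n w @[k --> \oo] --> 0).

(** If [h k n.+1] tended to 0 for every choice of the next state, dominated convergence with bound 1
    would send its integral [h k n w] to 0 as well. *)
Let good_step n w : good n w -> exists y, good n.+1 (step n (w, y)).
Proof.
move=> gw; apply: contrapT => /forallNP ng; apply: gw.
rewrite (_ : (fun k => h k n w) = fun k => \int[Q (w n)]_y h k n.+1 (step n (w, y))); last first.
  by apply/funext => k; exact: h_step.
rewrite -(integral0 (Q (w n)) setT).
apply: (@dominated_cvg _ _ _ (Q (w n)) setT measurableT
  (fun k y => h k n.+1 (step n (w, y))) (cst 0) (cst 1)) => //.
- by move=> y _; have /contrapT := ng y.
- exact: (finite_measure_integrable_cst (Q (w n)) 1%R).
- by move=> k y _; rewrite gee0_abs.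
Qed.

Lemma frozen_law_cvg0 : \bigcap_k C k = set0 ->
  frozen_law (N k) (C k) @[k --> \oo] --> 0.
Proof.
move=> C0; apply: contrapT => ncv.
pose w0 : paths := fun=> x0.
have g0 : good 0 w0.
  apply: contra_not ncv; rewrite (_ : (fun k => h k 0 w0) = fun k => frozen_law (N k) (C k))//.
  apply/funext => k; rewrite /h subn0 -[in RHS](add0n (N k)) -int_cond_prob//=.
  by rewrite /giry_ret integral_dirac// ?diracT ?mul1e//; exact: measurable_cond_prob.
pose next n (s : {w | good n w}) : {w | good n.+1 w} :=
  let y := cid (good_step (projT2 s)) in exist _ (step n (projT1 s, projT1 y)) (projT2 y).
pose fix W n : {w | good n w} := if n is m.+1 then next m (W m) else exist _ w0 g0.
(* Coordinate n of stage n is kept by all later stages, so the diagonal agrees with stage n up to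
   time n. *)
pose v : paths := fun n => projT1 (W n) n.
have Wv n i : (i <= n)%N -> projT1 (W n) i = v i.
  elim: n => [|n IH]; first by rewrite leqn0 => /eqP ->.
  rewrite leq_eqVlt => /orP[/eqP -> //|]; rewrite ltnS => ik.
  by rewrite -IH//= /step ik.
have : (\bigcap_k C k) v.
  (* If [v] missed [C k], then [h k] would vanish at the stage [N k], hence by monotonicity so would
     [h j] for all j >= k, contradicting [good]. *)
  move=> k _; apply: (cylinderP (CN k) (Wv (N k))); apply: contrapT => nC.
  apply: (projT2 (W (N k))).
  apply: cvg_near_cst.
  exists k => // j /= kj; apply/eqP; rewrite eq_le h_ge0 andbT.
  by rewrite (le_trans (h_ni _ _ kj))// hE// indicE memNset.
by rewrite C0.
Qed.

End continuity.

Let cyl_content0 : cyl_content set0 = 0. Proof. by rewrite /cyl_content measure0. Qed.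

Let cyl_content_ge0 C : 0 <= cyl_content C. Proof. exact: measure_ge0. Qed.

(** Finite additivity reduces the claim to continuity at the empty set: the remainders [B n]
    decrease to it and are again cylinders. *)
Let cyl_content_sigma_additive : semi_sigma_additive cyl_content.
Proof.
move=> F mF tF [mU [M UM]]; set U := \bigcup_n F n in mU UM *.
have /choice[nF nFP] : forall i, exists n, cylinder n (F i) by move=> i; have [] := mF i.
have mFi i : measurable (F i : set paths) by have [] := mF i.
pose B n := U `\` \big[setU/set0]_(i < n) F i.
(* At level [L n] the sets [F i] with i < n, their total union and the remainder [B n] are all
   cylinders, so that the single measure [frozen_law (L n)] evaluates them. *)
pose L n := maxn M (\max_(i < n) nF i).
have LM n : cylinder (L n) U by exact: cylinder_le (leq_maxl _ _) UM.
have LF n i : (i < n)%N -> cylinder (L n) (F i).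
  move=> ni; apply: cylinder_le (nFP i); apply: leq_trans (leq_maxr _ _).
  exact: (@leq_bigmax _ (fun i : 'I_n => nF i) (Ordinal ni)).
have mB n : measurable (B n : set paths).
  by apply: measurableD => //; exact: bigsetU_measurable.
have LB n : cylinder (L n) (B n).
  rewrite /B setDE -[U]setCK -setCU; apply: cylinderC; apply: cylinderU.
    exact: cylinderC.
  by apply: (big_ind (cylinder (L n))) => [|A A'|i _];
    [exact: cylinder0|exact: cylinderU|exact: LF].
have EU n : \sum_(0 <= i < n) cyl_content (F i) + cyl_content (B n) = cyl_content U.
  rewrite (cyl_contentE _ (LB n))// (cyl_contentE _ (LM n))// big_mkord.
  rewrite (eq_bigr (fun i : 'I_n => frozen_law (L n) (F i))); last first.
    by move=> i _; rewrite (cyl_contentE _ (LF n i (ltn_ord i))).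
  rewrite -(measure_bigsetU (frozen_law (L n)) mFi tF) -measureU//; last 2 first.
  - exact: bigsetU_measurable.
  - by rewrite setDIK.
  congr (frozen_law (L n) _); rewrite setDUK// => w.
  by rewrite -bigcup_mkord => -[i _ Fi]; exists i.
have B0 : cyl_content (B n) @[n --> \oo] --> 0.
  rewrite (_ : (fun n => _) = (fun n => frozen_law (L n) (B n))); last first.
    by apply/funext => n; rewrite (cyl_contentE _ (LB n)).
  apply: frozen_law_cvg0 => //.
    move=> j k jk w [Uw nw]; split => //; apply: contra_not nw.
    rewrite -!bigcup_mkord => -[i /= ij Fi]; exists i => //=.
    exact: leq_trans jk.
  rewrite -subset0 => w BU; have [i _ Fi] := (BU 0%N I).1.
  by have [_] := BU i.+1 I; apply; rewrite -bigcup_mkord; exists i => /=.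
have finB n : cyl_content (B n) \is a fin_num by exact: fin_num_measure.
rewrite -[X in _ --> X]sube0.
rewrite (_ : (fun n => _) = (fun n => cyl_content U - cyl_content (B n))).
  apply: cvgeB => //; last exact: cvg_cst.
  by rewrite fin_num_adde_defl.
by apply/funext => n; rewrite -(EU n) addeK.
Qed.

HB.instance Definition _ := isMeasure.Build _ _ _ cyl_content
  cyl_content0 cyl_content_ge0 cyl_content_sigma_additive.

Definition markov_law (A : set paths) : \bar R := measure_extension cyl_content A.

Let markov_law0 : markov_law set0 = 0.
Proof. exact: measure0 (measure_extension cyl_content). Qed.

Let markov_law_ge0 A : 0 <= markov_law A.
Proof. exact: measure_ge0 (measure_extension cyl_content) _. Qed.

Let markov_law_sigma_additive : semi_sigma_additive markov_law.
Proof.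
move=> F mF tF mU.
apply: (measure_semi_sigma_additive (s := measure_extension cyl_content)) => //.
  by move=> n; exact: paths_sub_cylinders.
exact: paths_sub_cylinders.
Qed.

HB.instance Definition _ := isMeasure.Build _ paths R markov_law
  markov_law0 markov_law_ge0 markov_law_sigma_additive.

Lemma markov_lawE n C : measurable C -> cylinder n C -> markov_law C = frozen_law n C.
Proof.
move=> mC Cn; rewrite /markov_law /measure_extension measurable_mu_extE.
  exact: cyl_contentE.
by split => //; exists n.
Qed.

Let markov_law1 : markov_law setT = 1.
Proof. by rewrite (@markov_lawE 0)// ?frozen_law1// /cylinder preimage_setT. Qed.

HB.instance Definition _ := Measure_isProbability.Build _ _ _ markov_law markov_law1.

(** Preimages under [freeze n] are cylinders of level n, so [frozen_law n] is the image of
    [markov_law] under [freeze n]; the invariance of [g] then removes the freezing. *)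
Lemma int_markov_law n (g : paths -> \bar R) : measurable_fun [set: paths] g ->
  (forall w, 0 <= g w) -> (forall w, g (freeze n w) = g w) ->
  \int[markov_law]_w g w = \int[frozen_law n]_w g w.
Proof.
move=> mg g0 gn; have mfn := @measurable_freeze _ T n.
transitivity (\int[measure_function_pushforward__canonical__measure_function_Measure
  markov_law mfn]_w g w).
  rewrite (ge0_integral_pushforward (@measurable_freeze _ T n))//.
  by apply: eq_integral => w _ /=; rewrite gn.
apply: eq_measure_integral => A mA _.
rewrite -[LHS]/(markov_law (freeze n @^-1` A)).
rewrite (@markov_lawE n) ?freeze_frozen_law//.
  exact: measurable_preimage (@measurable_freeze _ T n) mA.
by apply/seteqP; split => w /=; rewrite freeze_freeze minnn.
Qed.

Lemma markov_law_init B : measurable B ->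
  markov_law ((fun w : paths => w 0%N) @^-1` B) = \d_x0 B.
Proof.
move=> mB; rewrite (@markov_lawE 0)//.
exact: measurable_preimage (@measurable_coord _ T 0) mB.
Qed.

(** The Markov property. The left side is evaluated at level n + 1 and the right side at level n;
    the two differ by one application of [frozen_lawS]. *)
Lemma markov_law_step n G B : measurable G -> cylinder n G -> measurable B ->
  markov_law (G `&` (fun w : paths => w n.+1) @^-1` B) =
  \int[markov_law]_(w in G) Q (w n) B.
Proof.
move=> mG Gn mB.
have mB' : measurable ((fun w : paths => w n.+1) @^-1` B).
  exact: measurable_preimage (@measurable_coord _ T n.+1) mB.
have mI : measurable (G `&` (fun w : paths => w n.+1) @^-1` B).
  exact: measurableI.
rewrite (@markov_lawE n.+1)//; last first.
  rewrite /cylinder preimage_setI (cylinder_le (leqnSn n) Gn); congr (_ `&` _).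
  by apply/seteqP; split => w /=; rewrite /freeze minnn.
have mQB : measurable_fun [set: paths] (fun w => Q (w n) B).
  exact: (measurableT_comp (measurable_giry_ev mB) (@mQn n)).
rewrite [RHS]integral_mkcond [RHS](@int_markov_law n); last 3 first.
- by apply/(measurable_restrictT _ mG); exact: measurable_funTS mQB.
- by move=> w; rewrite patchE; case: ifP.
- by move=> w; rewrite !patchE (cylinder_freeze _ Gn) /freeze minnn.
rewrite frozen_lawS//; apply: eq_integral => w _; rewrite patchE; case: ifPn => wG.
  rewrite -[RHS]/(Q (w n) B) -[B in RHS]setIT -integral_indic//.
  apply: eq_integral => y _; rewrite !indicE in_setI (cylinder_step _ _ (leqnn n) Gn) wG.
  congr ((nat_of_bool _)%:R%:E).
  by apply/idP/idP; rewrite !inE /= /step ltnn.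
apply: integral0_eq => y _.
by rewrite indicE in_setI (cylinder_step _ _ (leqnn n) Gn) (negbTE wG).
Qed.

End ionescu_tulcea.

(** * Finite sequences and marked point patterns *)

HB.instance Definition _ (T : choiceType) := isPointed.Build (seq T) [::].

Section seqs.
Context d (T : measurableType d).

Definition seqs : Type := seq T.

HB.instance Definition _ := Pointed.on seqs.

(** With absent entries read as [point], lengths and coordinates generate the sigma-algebra of the
    disjoint union of the powers of [T]. *)
Definition seqs_gen : set (set seqs) :=
  [set [set s : seq T | size s = n] | n in [set: nat]] `|`
  \bigcup_i preimage_set_system setT (fun s : seq T => nth point s i) measurable.

Definition seqs_display : measure_display. Proof. by constructor. Qed.

HB.instance Definition _ := @isMeasurable.Build seqs_display seqs <<s seqs_gen >>
  (@sigma_algebra0 _ setT seqs_gen) (@sigma_algebraC _ seqs_gen)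
  (@sigma_algebra_bigcup _ setT seqs_gen).

Lemma measurable_size n : measurable [set s : seqs | size s = n].
Proof. by apply: sub_sigma_algebra; left; exists n. Qed.

Lemma measurable_nth i : measurable_fun setT (fun s : seqs => nth point s i).
Proof. by move=> _ B mB; apply: sub_sigma_algebra; right; exists i => //; exists B. Qed.

Lemma measurable_seqsP d' (S : measurableType d') (F : S -> seqs) :
  (forall n, measurable [set s | size (F s) = n]) ->
  (forall i, measurable_fun setT (fun s => nth point (F s) i)) ->
  measurable_fun setT F.
Proof.
move=> mn mi; apply: (@measurability _ _ S seqs setT F _ erefl).
move=> _ [_ [[n _ <-]|[i _ [B mB <-]]] <-]; rewrite !setTI; first exact: mn.
exact: measurable_preimage (mi i) mB.
Qed.

Lemma measurable_fun_size (D : nat -> Prop) : measurable [set s : seqs | D (size s)].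
Proof.
rewrite (_ : [set _ | _] = \bigcup_(n in D) [set s : seqs | size s = n]).
  by apply: bigcup_measurable => n _; exact: measurable_size.
by apply/seteqP; split=> s /= => [Ds|[n Dn ->]//]; exists (size s).
Qed.

Lemma measurable_cons_seqs : measurable_fun setT (fun p : T * seqs => (p.1 :: p.2) : seqs).
Proof.
apply: measurable_seqsP => [n|[|i]] /=.
- case: n => [|n]; first by rewrite (_ : [set _ | _] = set0)//; apply/seteqP; split.
  rewrite (_ : [set _ | _] = snd @^-1` [set s : seqs | size s = n]).
    exact: measurable_preimage (@measurable_snd _ _ _ _) (measurable_size _).
  by apply/seteqP; split => p /=; [case|move=> ->].
- exact: measurable_fst.
- exact: (measurableT_comp (measurable_nth i) (@measurable_snd _ _ _ _)).
Qed.

Lemma measurable_by_size d' d2 (S : measurableType d') (S2 : measurableType d2)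
    (g : S -> seqs) (F : S -> S2) : measurable_fun setT g ->
  (forall n, measurable_fun [set s | size (g s) = n] F) -> measurable_fun setT F.
Proof.
move=> mg mF; have mn n : measurable [set s | size (g s) = n].
  exact: measurable_preimage mg (measurable_size n).
rewrite (_ : setT = \bigcup_n [set s | size (g s) = n]).
  exact/measurable_fun_bigcup.
by apply/seteqP; split => // s _; exists (size (g s)).
Qed.

Lemma measurable_map (f : T -> T) : measurable_fun setT f ->
  measurable_fun setT (fun s : seqs => map f s : seqs).
Proof.
move=> mf; apply: measurable_seqsP => [n|i].
  rewrite (_ : [set _ | _] = [set s : seqs | size s = n]); first exact: measurable_size.
  by apply/seteqP; split => s /=; rewrite size_map.
apply: (@measurable_by_size _ _ _ _ id) => // n.
case: (ltnP i n) => ni.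
  apply: (eq_measurable_fun (fun s : seqs => f (nth point s i))).
    by move=> s /set_mem /= sn; rewrite (nth_map point)// sn.
  by apply: measurable_funTS; exact: measurableT_comp mf (measurable_nth i).
apply: (eq_measurable_fun (cst point)) => //.
by move=> s /set_mem /= sn; rewrite nth_default// size_map sn.
Qed.

Lemma measurable_cat : measurable_fun setT (fun p : seqs * seqs => (p.1 ++ p.2) : seqs).
Proof.
have m1 := @measurable_fst _ _ seqs seqs.
have m2 := @measurable_snd _ _ seqs seqs.
apply: measurable_seqsP => [n|i].
  rewrite (_ : [set _ | _] = \bigcup_k (fst @^-1` [set s : seqs | size s = k] `&`
     snd @^-1` [set s : seqs | (k + size s)%N = n])).
    apply: bigcupT_measurable => k; apply: measurableI.
      exact: measurable_preimage m1 (measurable_size k).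
    exact: measurable_preimage m2 (measurable_fun_size (fun m => (k + m)%N = n)).
  apply/seteqP; split => p /=; first by move=> <-; exists (size p.1) => //=; rewrite size_cat.
  by move=> [k _ [/= <- <-]]; rewrite size_cat.
apply: (@measurable_by_size _ _ _ _ fst); [exact: m1|move=> n].
apply: (eq_measurable_fun (fun p : seqs * seqs => if (i < n)%N then nth point p.1 i else nth point p.2 (i - n))).
  by move=> s /set_mem /= sn; rewrite nth_cat sn.
apply: measurable_funTS; case: (i < n)%N.
  exact: measurableT_comp (measurable_nth i) m1.
exact: measurableT_comp (measurable_nth _) m2.
Qed.

Lemma measurable_behead : measurable_fun setT (fun s : seqs => behead s : seqs).
Proof.
apply: measurable_seqsP => [n|i].
  rewrite (_ : [set _ | _] = [set s : seqs | (size s).-1 = n]).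
    exact: (measurable_fun_size (fun m => m.-1 = n)).
  by apply/seteqP; split => s /=; rewrite size_behead.
apply: (eq_measurable_fun (fun s : seqs => nth point s i.+1)).
  by move=> s _; rewrite nth_behead.
exact: measurable_nth.
Qed.

Lemma measurable_sum_seqs (R : realType) (h : T -> R) : measurable_fun setT h ->
  measurable_fun setT (fun s : seqs => \sum_(z <- s) h z)%R.
Proof.
move=> mh; apply: (@measurable_by_size _ _ _ _ id) => // n.
apply: (eq_measurable_fun (fun s : seqs => \sum_(i < n) h (nth point s i))%R).
  by move=> s /set_mem /= <-; rewrite (big_nth point) big_mkord.
apply: measurable_funTS; apply: measurable_sum => i.
exact: measurableT_comp mh (measurable_nth i).
Qed.

Lemma measurable_exists_seqs d' (S : measurableType d') (A : set (T * S)) :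
  measurable A ->
  measurable [set p : seqs * S | exists2 z, z \in (p.1 : seq T) & A (z, p.2)].
Proof.
move=> mA.
rewrite (_ : [set _ | _] = \bigcup_n \bigcup_(i in [set i | (i < n)%N])
   (fst @^-1` [set s : seqs | size s = n] `&`
    (fun p : seqs * S => (nth point p.1 i, p.2)) @^-1` A)).
  apply: bigcupT_measurable => n; apply: bigcup_measurable => i _; apply: measurableI.
    exact: measurable_preimage (@measurable_fst _ _ _ _) (measurable_size n).
  apply: measurable_preimage mA; apply: measurable_fun_pair; last exact: measurable_snd.
  exact: measurableT_comp (measurable_nth i) (@measurable_fst _ _ _ _).
apply/seteqP; split => [[s y] /= [z zs Az]|[s y] /= [n _ [i /= ilt [/= sn Az]]]].
  exists (size s) => //; exists (index z s) => /=; first by rewrite index_mem.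
  by split => //=; rewrite nth_index.
by exists (nth point s i) => //; rewrite mem_nth// sn.
Qed.

End seqs.

(** * Rational boxes in the space of marked points *)

Section boxes.
Context {R : realType}.

Local Notation T := (measurableTypeR R * measurableTypeR R * measurableTypeR R)%type.

(* ((a1, b1), (a2, b2), (a3, b3)) stands for the box ]a1, b1[ * ]a2, b2[ * ]a3, b3[. *)
Definition corners : Type := ((rat * rat) * (rat * rat) * (rat * rat))%type.

HB.instance Definition _ := Countable.on corners.

Definition box (q : corners) : set (mpoint R) := [set z |
  [/\ ratr q.1.1.1 < z.1.1 < ratr q.1.1.2, ratr q.1.2.1 < z.1.2 < ratr q.1.2.2
    & ratr q.2.1 < z.2 < ratr q.2.2]%R].

Definition meet_corners (p q : corners) : corners :=
  (((Num.max p.1.1.1 q.1.1.1, Num.min p.1.1.2 q.1.1.2),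
    (Num.max p.1.2.1 q.1.2.1, Num.min p.1.2.2 q.1.2.2)),
   (Num.max p.2.1 q.2.1, Num.min p.2.2 q.2.2)).

Lemma ratr_max (x y : rat) : ratr (Num.max x y) = Num.max (ratr x) (ratr y) :> R.
Proof. by case: (leP x y) => xy; [rewrite max_r ?ler_rat|rewrite max_l// ltW// ltr_rat]. Qed.

Lemma ratr_min (x y : rat) : ratr (Num.min x y) = Num.min (ratr x) (ratr y) :> R.
Proof. by case: (leP x y) => xy; [rewrite min_l ?ler_rat|rewrite min_r// ltW// ltr_rat]. Qed.

Lemma box_meet p q : box (meet_corners p q) = box p `&` box q.
Proof.
apply/seteqP; split=> [z|z] /=; rewrite /box/= !ratr_max !ratr_min !gt_max !lt_min.
  by move=> [/andP[/andP[-> ->] /andP[-> ->]] /andP[/andP[-> ->] /andP[-> ->]]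
    /andP[/andP[-> ->] /andP[-> ->]]].
by move=> [[/andP[-> ->] /andP[-> ->] /andP[-> ->]]
  [/andP[-> ->] /andP[-> ->] /andP[-> ->]]].
Qed.

Lemma rat_between (x e : R) : (0 < e)%R ->
  exists p : rat * rat, [/\ ratr p.1 < x < ratr p.2, x - e < ratr p.1 & ratr p.2 < x + e]%R.
Proof.
move=> e0; have /rat_in_itvoo[a] : (x - e < x)%R by rewrite gtrBl.
have /rat_in_itvoo[b] : (x < x + e)%R by rewrite ltrDl.
rewrite !in_itv/= => /andP[xb be] /andP[ea ax]; exists (a, b) => /=.
by rewrite ax xb ea be.
Qed.

Lemma box_small (z : mpoint R) (e : R) : (0 < e)%R ->
  exists2 q, box q z & box q `<=` ball z e.
Proof.
move=> e0; have [a [az a1 a2]] := rat_between z.1.1 e0.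
have [b [bz b1 b2]] := rat_between z.1.2 e0.
have [c [cz c1 c2]] := rat_between z.2 e0.
exists ((a, b), c) => // y [/= /andP[y1 y2] /andP[y3 y4] /andP[y5 y6]].
split; first split; rewrite /ball/= ltr_distlC.
- by rewrite (lt_trans a1)// (lt_trans y2).
- by rewrite (lt_trans b1)// (lt_trans y4).
- by rewrite (lt_trans c1)// (lt_trans y6).
Qed.

Lemma countable_corners : countable [set: corners]. Proof. exact: countableP. Qed.

(** A half-space where one coordinate is below r is the union of the countably many boxes whose
    upper end in that coordinate is at most r. *)
Lemma measurable_mpoint d (S : measurableType d) (f : S -> T) :
  (forall q, measurable (f @^-1` box q)) -> measurable_fun setT f.
Proof.
move=> mf.
have H (g : T -> measurableTypeR R) (u : corners -> rat) :
    (forall r (z : T), (g z < r)%R -> exists2 q, box q z & ratr (u q) <= r)%R ->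
    (forall q z, box q z -> g z < ratr (u q))%R ->
    measurable_fun setT (g \o f).
  move=> H1 H2; apply: (@measurability _ _ S (measurableTypeR R) setT (g \o f) _
    (RGenInftyO.measurableE R)).
  move=> _ [_ [r ->] <-]; rewrite setTI.
  rewrite (_ : _ @^-1` _ = \bigcup_(q in [set q | ratr (u q) <= r]%R) (f @^-1` box q)).
    rewrite bigcup_mkcond; apply: (countable_bigcupT_measurable countable_corners) => q.
    by case: ifP.
  apply/seteqP; split => [s /=|s [q /= uq fs]]; rewrite in_itv/=.
    by move=> /H1[q fq uq]; exists q.
  exact: lt_le_trans (H2 _ _ fs) uq.
have small (x r : R) : (x < r)%R -> exists2 e : R, (0 < e)%R & (x + e <= r)%R.
  by move=> gr; exists (r - x)%R; rewrite ?subr_gt0// addrC subrK.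
have G1 : measurable_fun setT ((fun z : T => z.1.1) \o f).
  apply: (H _ (fun q => q.1.1.2)) => [r z|q z [/andP[]//]].
  move=> /small[e e0 er]; have [q qz qe] := box_small z e0.
  have [a [az a1 a2]] := rat_between z.1.1 e0.
  (* Only the side of the coordinate at hand has to end before r; the other two are those of any box
     around z. *)
  exists ((a, q.1.2), q.2); first by case: qz => _ ? ?; split.
  by rewrite (le_trans (ltW a2)).
have G2 : measurable_fun setT ((fun z : T => z.1.2) \o f).
  apply: (H _ (fun q => q.1.2.2)) => [r z|q z [_ /andP[]//]].
  move=> /small[e e0 er]; have [q qz qe] := box_small z e0.
  have [a [az a1 a2]] := rat_between z.1.2 e0.
  exists ((q.1.1, a), q.2); first by case: qz => ? _ ?; split.
  by rewrite (le_trans (ltW a2)).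
have G3 : measurable_fun setT ((fun z : T => z.2) \o f).
  apply: (H _ (fun q => q.2.2)) => [r z|q z [_ _ /andP[]//]].
  move=> /small[e e0 er]; have [q qz qe] := box_small z e0.
  have [a [az a1 a2]] := rat_between z.2 e0.
  exists (q.1, a); first by case: qz => ? ? _; split.
  by rewrite (le_trans (ltW a2)).
by apply/measurable_fun_pairP; split => //; apply/measurable_fun_pairP; split.
Qed.

Lemma measurable_box q : measurable (box q : set T).
Proof.
have m1 : measurable_fun setT (fun z : T => z.1.1) by exact: measurableT_comp.
have m2 : measurable_fun setT (fun z : T => z.1.2) by exact: measurableT_comp.
have m3 : measurable_fun setT (fun z : T => z.2) by exact: measurable_snd.
rewrite (_ : box q = ((fun z : T => z.1.1) @^-1` `]ratr q.1.1.1, ratr q.1.1.2[%classic) `&`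
  ((fun z : T => z.1.2) @^-1` `]ratr q.1.2.1, ratr q.1.2.2[%classic) `&`
  ((fun z : T => z.2) @^-1` `]ratr q.2.1, ratr q.2.2[%classic)).
  by apply: measurableI; [apply: measurableI|]; apply: measurable_preimage => //; exact: measurable_itv.
by apply/seteqP; split=> z; rewrite /box/= !in_itv/=; [move=> [-> -> ->]|move=> [[-> ->] ->]].
Qed.

Lemma measurable_eq_mpoint : measurable [set p : T * T | p.1 = p.2].
Proof.
have m1 := @measurable_fst _ _ T T; have m2 := @measurable_snd _ _ T T.
have mc1 : measurable_fun setT (fun z : T => z.1.1) by exact: measurableT_comp.
have mc2 : measurable_fun setT (fun z : T => z.1.2) by exact: measurableT_comp.
have mc3 : measurable_fun setT (fun z : T => z.2) by exact: measurable_snd.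
have meq (g : T -> measurableTypeR R) : measurable_fun setT g -> measurable [set p : T * T | g p.1 = g p.2].
  move=> mg; rewrite (_ : [set _ | _] = (fun p : T * T => g p.1 == g p.2) @^-1` [set true]).
    apply: measurable_preimage => //; apply: measurable_fun_eqr.
      exact: measurableT_comp mg m1.
    exact: measurableT_comp mg m2.
  by apply/seteqP; split => p /= /eqP.
rewrite (_ : [set p | _] = [set p | p.1.1.1 = p.2.1.1] `&` [set p | p.1.1.2 = p.2.1.2] `&`
   [set p | p.1.2 = p.2.2]).
  by apply: measurableI; [apply: measurableI|]; [exact: meq mc1|exact: meq mc2|exact: meq mc3].
by apply/seteqP; split => [[x y] /= -> //|[[[x1 x2] x3] [[y1 y2] y3]] /= [[-> ->] ->]].
Qed.

End boxes.

Lemma ptws_cvgP (U : Type) (V : topologicalType) (F : set_system {ptws U -> V})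
    (g : {ptws U -> V}) : Filter F ->
  F --> g <-> forall t, h t @[h --> F] --> g t.
Proof.
move=> FF; split=> [Fg t|Fg].
  have /cvg_sup/(_ t) Fgt := Fg.
  apply: cvg_trans (@initial_continuous _ _ (fun h : U -> V => h t) g).
  by move=> A /= ; apply: Fgt.
apply/cvg_sup => t A /=; rewrite (@nbhsE (initial_topology (fun h : U -> V => h t))) => -[B [[C oC <-] Cg] BA].
apply: (filterS BA); apply: (Fg t); exact: open_nbhs_nbhs.
Qed.

Lemma ptws_eval_continuous (U : Type) (V : topologicalType) (t : U) :
  continuous (fun h : {ptws U -> V} => h t).
Proof. by move=> h; exact: (ptws_cvgP h (nbhs_filter h)).1. Qed.

(** * The weak topology of patterns *)

Section pattern_topology.
Context {R : realType}.
Variables (W : set (R * R)) (K : R).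

Local Notation T := (measurableTypeR R * measurableTypeR R * measurableTypeR R)%type.
Local Notation X := (pattern W K).

Lemma pts_simple (x : X) : simple_marked W K (pts x).
Proof. exact/asboolP/ptsP. Qed.

Lemma pts_inj : injective (@pts R W K). Proof. exact: val_inj. Qed.

Lemma to_patternK (b : {fset mpoint R}) : simple_marked W K b ->
  pts (to_pattern W K b) = b.
Proof.
move=> bs; rewrite /to_pattern -[LHS]/(val _).
by rewrite insubdK// unfold_in; exact/asboolP.
Qed.

Lemma to_patternN (b : {fset mpoint R}) : ~ simple_marked W K b ->
  pts (to_pattern W K b) = fset0.
Proof.
move=> bs; rewrite /to_pattern -[LHS]/(val _) val_insubd; case: ifP => // /asboolP.
by [].
Qed.

Definition hit (q : corners) : set X := [set y | exists2 z, z \in pts y & box q z].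

(** Four times the product of the positive parts of x - a and b - x: continuous, and positive
    exactly on ]a, b[. *)
Let bump (x a b : R) : R := (((x - a) + `|x - a|) * ((b - x) + `|b - x|))%R.

Let bump_ge0 x a b : (0 <= bump x a b)%R.
Proof.
have H (y : R) : (0 <= y + `|y|)%R by rewrite -lerBlDl sub0r -normrN ler_norm.
exact: mulr_ge0.
Qed.

Let bump_gt0 x a b : (0 < bump x a b)%R = (a < x < b)%R.
Proof.
have H (y : R) : (y + `|y| == 0)%R = (y <= 0)%R.
  by rewrite addr_eq0 ler0_def -eqr_oppLR eq_sym.
by rewrite lt0r bump_ge0 andbT mulf_eq0 !H negb_or -!ltNge !subr_gt0.
Qed.

Let tent (q : corners) (z : mpoint R) : R :=
  (bump z.1.1 (ratr q.1.1.1) (ratr q.1.1.2) * bump z.1.2 (ratr q.1.2.1) (ratr q.1.2.2)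
   * bump z.2 (ratr q.2.1) (ratr q.2.2))%R.

Let tent_continuous q : continuous (tent q).
Proof.
move=> z.
have c1 : (fun z : mpoint R => z.1.1) @ z --> z.1.1 by apply: (cvg_comp _ _ cvg_fst cvg_fst).
have c2 : (fun z : mpoint R => z.1.2) @ z --> z.1.2 by apply: (cvg_comp _ _ cvg_fst cvg_snd).
have c3 : (fun z : mpoint R => z.2) @ z --> z.2 by apply: cvg_snd.
have cb (g : mpoint R -> R) a b : g @ z --> g z ->
    (fun z => bump (g z) a b) @ z --> bump (g z) a b.
  move=> cg; apply: cvgM; apply: cvgD; [|apply: cvg_norm| |apply: cvg_norm];
    by [apply: cvgB => //; exact: cvg_cst].
by apply: cvgM; [apply: cvgM|]; exact: cb.
Qed.

Lemma pattern_eval_continuous (f : test_fun W K) :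
  continuous (fun y : X => pattern_eval y f : R).
Proof.
move=> y; apply: (@continuous_comp X {ptws test_fun W K -> R} R (@pattern_eval R W K) (fun g => g f)).
  exact: initial_continuous.
exact: (@ptws_eval_continuous (test_fun W K) R f).
Qed.

(** The function [tent q] is continuous, nonnegative, and positive exactly on the box; its sum over
    a pattern is thus positive exactly when some point lies in the box. *)
Lemma open_hit q : open (hit q).
Proof.
have tc : {within W `*` `[0%R, K], continuous (tent q)}.
  apply: continuous_subspaceT => z; exact: tent_continuous.
rewrite (_ : hit q = (fun y : X => pattern_eval y (exist _ _ tc)) @^-1` [set r : R | (0 < r)%R]).
  by apply: open_comp; [move=> y _; exact: pattern_eval_continuous|exact: open_gt].
have t0 z : (0 <= tent q z)%R by apply: mulr_ge0 => //; apply: mulr_ge0.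
have tb z : (0 < tent q z)%R <-> box q z.
  have bn x a b : (bump x a b != 0)%R = (a < x < b)%R by rewrite -bump_gt0 lt0r bump_ge0 andbT.
  rewrite lt0r t0 andbT /tent mulf_eq0 (mulf_eq0 (bump _ _ _) (bump _ _ _)) !negb_or !bn /box/=.
  by split=> [/andP[/andP[-> ->] ->]|[-> -> ->]].
apply/seteqP; split => y; rewrite /pattern_eval/=.
  move=> [z zy qz]; rewrite (big_rem z)//= ltr_wpDr//; last exact/tb.
  by rewrite sumr_ge0.
rewrite lt0r => /andP[+ _]; rewrite psumr_eq0//= => /allPn[z zy] /negP tz.
by exists z => //; apply/tb; rewrite lt0r t0 andbT; apply/eqP => tz0; rewrite tz0 eqxx in tz.
Qed.

Lemma exists_pos_seq (A : eqType) (s : seq A) (P : A -> R -> Prop) :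
  (forall z d d', (d' <= d)%R -> P z d -> P z d') ->
  (forall z, z \in s -> exists2 d : R, (0 < d)%R & P z d) ->
  exists2 d : R, (0 < d)%R & forall z, z \in s -> P z d.
Proof.
move=> mP; elim: s => [|z s IH] H; first by exists 1%R.
have [|d d0 Hd] := IH; first by move=> u us; apply: H; rewrite inE us orbT.
have [d' d'0 Hd'] := H z (mem_head _ _).
exists (Num.min d d'); first by rewrite lt_min d0.
move=> u; rewrite inE => /orP[/eqP ->|us]; first by apply: mP Hd'; rewrite ge_min lexx orbT.
by apply: mP (Hd _ us); rewrite ge_min lexx.
Qed.

Definition separated (s : seq (mpoint R)) (e : R) : Prop :=
  forall z z' u, z \in s -> z' \in s -> ball z e u -> ball z' e u -> z = z'.

Lemma ball_eq (z z' : mpoint R) : (forall e : R, (0 < e)%R -> ball z e z') -> z = z'.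
Proof.
move=> zz'.
have H (x y : R) : (forall e : R, (0 < e)%R -> `|x - y| < e)%R -> x = y.
  move=> xy; apply/eqP; rewrite -subr_eq0 -normr_le0 leNgt; apply/negP => /xy.
  by rewrite ltxx.
case: z z' zz' => [[z1 z2] z3] [[u1 u2] u3] zz'.
by congr (_, _, _); apply: H => e /zz'[[]].
Qed.

Lemma exists_separated (s : seq (mpoint R)) : exists2 e : R, (0 < e)%R & separated s e.
Proof.
suff [e e0 H] : exists2 e : R, (0 < e)%R & forall z, z \in s ->
    (fun z e => forall z', z' \in s -> z <> z' -> forall u, ball z e u -> ~ ball z' e u) z e.
  exists e => // z z' u zs z's zu z'u; apply: contrapT => zz'.
  exact: (H z zs z' z's zz' u).
apply: exists_pos_seq => [z d d' dd' H z' z's zz' u zu z'u|z zs].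
  by apply: (H z' z's zz' u); [exact: le_ball zu|exact: le_ball z'u].
suff [e e0 H] : exists2 e : R, (0 < e)%R & forall z', z' \in s ->
    (fun z' e => z <> z' -> forall u, ball z e u -> ~ ball z' e u) z' e.
  by exists e.
apply: exists_pos_seq => [z' d d' dd' H zz' u zu z'u|z' zs'].
  by apply: (H zz' u); [exact: le_ball zu|exact: le_ball z'u].
have [zz'|zz'] := pselect (z = z'); first by exists 1%R.
have [e e0 ne] : exists2 e : R, (0 < e)%R & ~ ball z e z'.
  apply: contrapT => /forall2NP H; apply: zz'; apply: ball_eq => e e0.
  by have [//|/contrapT] := H e.
exists (e / 2)%R; first by rewrite divr_gt0.
by move=> _ u zu z'u; apply: ne; exact: ball_splitl zu z'u.
Qed.

Lemma box_family (s : seq (mpoint R)) (e : R) : (0 < e)%R ->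
  exists Q : mpoint R -> corners,
    (forall z, box (Q z) z) /\ (forall z, box (Q z) `<=` ball z e) /\
    (forall z z' (u : mpoint R), z \in s -> z' \in s -> box (Q z) u -> box (Q z') u -> z = z').
Proof.
move=> e0; have [e' e'0 sep] := exists_separated s.
have me0 : (0 < Num.min e e')%R by rewrite lt_min e0.
have /choice[Q QP] : forall z, exists q, box q z /\ box q `<=` ball z (Num.min e e').
  by move=> z; have [q ? ?] := box_small z me0; exists q.
exists Q; split; [|split].
- by move=> z; exact: (QP z).1.
- by move=> z u /(QP z).2; apply: le_ball; rewrite ge_min lexx.
- move=> z z' u zs z's zu z'u; apply: (sep z z' u) => //.
    by apply: le_ball ((QP z).2 _ zu); rewrite ge_min lexx orbT.
  by apply: le_ball ((QP z').2 _ z'u); rewrite ge_min lexx orbT.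
Qed.

(** The counterpart of [open_hit]: moving each point slightly without changing their number is a
    small change for the weak topology. Along the filter of such perturbations every test function
    has a sum converging to its sum over [x], by its continuity at the finitely many points of
    [x]. *)
Lemma open_pattern_near (U : set X) (x : X) : open U -> U x ->
  exists2 e : R, (0 < e)%R & forall y : X, size (pts y) = size (pts x) ->
    (forall z, z \in pts x -> exists2 z', z' \in pts y & ball z e z') -> U y.
Proof.
move=> [V oV <-] Vx.
pose N e := [set y : X | size (pts y) = size (pts x) /\
    (forall z, z \in pts x -> exists2 z', z' \in pts y & ball z e z')].
pose F := filter_from [set e : R | (0 < e)%R] N.
have FF : Filter F.
  apply: filter_from_filter; first by exists 1%R => /=.
  move=> i j /= i0 j0; exists (Num.min i j) => /=; first by rewrite lt_min i0.
  move=> y [sy H]; split; split=> // z /H[z' z'y zz']; exists z' => //.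
    by apply: le_ball zz'; rewrite ge_min lexx.
  by apply: le_ball zz'; rewrite ge_min lexx orbT.
suff : pattern_eval y @[y --> F] --> pattern_eval x.
  by move=> /(_ V); case=> [|e /= e0 NV]; [exact: open_nbhs_nbhs|exists e => // y sy H; exact: NV].
apply/ptws_cvgP => f; apply/cvgrPdist_lt => eta eta0.
have [e1 e10 sep] := exists_separated (pts x).
pose n := size (pts x).
(* Dividing by n + 1 rather than n covers the empty pattern and makes the final inequality
   strict. *)
have eta'0 : (0 < eta / n.+1%:R)%R by rewrite divr_gt0.
have [xW xK _] := pts_simple x.
have [e2 e20 osc] : exists2 e : R, (0 < e)%R & forall z, z \in (pts x : seq _) ->
    (fun z e => forall z', W z'.1 -> (0 <= z'.2 <= K)%R -> ball z e z' ->
      `|sval f z - sval f z'| < eta / n.+1%:R)%R z e.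
  apply: exists_pos_seq => [z d d' dd' H z' Wz' Kz' zz'|z zx].
    by apply: H => //; exact: le_ball zz'.
  have /subspace_continuousP/(_ z) := svalP f.
  have Az : (W `*` `[0%R, K]) z by split; [exact: xW|rewrite /= in_itv/= xK].
  move=> /(_ Az) /cvgrPdist_lt /(_ _ eta'0).
  rewrite near_withinE => /nbhs_ballP[d /= d0 H].
  exists d => // z' Wz' Kz' zz'; by apply: H.
exists (Num.min e1 e2) => /=; first by rewrite lt_min e10.
move=> y [sy H] /=.
(* A matching of the points of [x] with nearby points of [y]: separation makes it injective, and the
   equal numbers of points make it a bijection. *)
have /choice[g gP] : forall z, exists z', z \in pts x -> z' \in pts y /\ ball z (Num.min e1 e2) z'.
  move=> z; case: (boolP (z \in pts x)) => zx; last by exists z.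
  by have [z' ? ?] := H _ zx; exists z'.
have ginj : {in pts x &, injective g}.
  move=> z z' zx z'x gzz'; apply: (sep z z' (g z)) => //.
    by apply: le_ball (gP _ zx).2; rewrite ge_min lexx.
  by rewrite gzz'; apply: le_ball (gP _ z'x).2; rewrite ge_min lexx.
have ug : uniq (map g (pts x)) by rewrite map_inj_in_uniq.
have sg : {subset map g (pts x) <= pts y}.
  by move=> _ /mapP[z zx ->]; exact: (gP _ zx).1.
have [_ eg] : (size (map g (pts x)) = size (pts y)) * (map g (pts x) =i pts y).
  by apply: uniq_min_size => //; rewrite size_map sy.
have pg : perm_eq (pts y) (map g (pts x)).
  by apply: uniq_perm => // z; rewrite eg.
rewrite /pattern_eval (perm_big _ pg)/= big_map -sumrB.
apply: (le_lt_trans (ler_norm_sum _ _ _)).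
have [yW yK _] := pts_simple y.
apply: (@le_lt_trans _ _ (\sum_(z <- pts x) (eta / n.+1%:R))%R).
  rewrite big_seq [leRHS]big_seq; apply: ler_sum => z zx; apply: ltW.
  have [gy gb] := gP _ zx; apply: osc => //; [exact: yW|exact: yK|].
  by apply: le_ball gb; rewrite ge_min lexx orbT.
rewrite big_const_seq count_predT iter_addr_0 -/n -(mulr_natr (eta / _)).
by rewrite -mulrA gtr_pMr// mulrC ltr_pdivrMr// mul1r ltr_nat.
Qed.

End pattern_topology.

(** * A measurable enumeration of the points of a pattern *)

Section pattern_enum.
Context {R : realType}.
Variables (W : set (R * R)) (K : R).

Local Notation T := (measurableTypeR R * measurableTypeR R * measurableTypeR R)%type.
Local Notation X := (pattern W K).
Local Notation hit := (@hit R W K).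

Let q0 : corners := (((0%R, 0%R), (0%R, 0%R)), (0%R, 0%R)).

Definition disjoint_boxes (qs : seq corners) : Prop :=
  forall i j (z : mpoint R), (i < size qs)%N -> (j < size qs)%N ->
    box (nth q0 qs i) z -> box (nth q0 qs j) z -> i = j.

(** As the boxes are disjoint and as numerous as the points, each contains exactly one point and no
    point lies outside. *)
Definition boxed (qs : seq corners) : set X := [set y |
  [/\ disjoint_boxes qs, size (pts y) = size qs & forall q, q \in qs -> hit q y]].

Lemma exists_boxed (y : X) (e : R) : (0 < e)%R ->
  exists2 qs, boxed qs y & forall z, z \in pts y ->
    exists2 q, q \in qs & box q `<=` ball z e.
Proof.
move=> e0; have [Q [Q1 [Q2 Q3]]] := box_family (pts y) e0.
exists (map Q (pts y)); last by move=> z zy; exists (Q z) => //; exact: map_f.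
split; [|by rewrite size_map|]; last first.
  by move=> _ /mapP[z zy ->]; exists z.
move=> i j z; rewrite size_map => iy jy.
rewrite !(nth_map (point : mpoint R))// => zi zj.
apply/eqP; rewrite -(nth_uniq (point : mpoint R) iy jy (fset_uniq _)); apply/eqP.
by apply: (Q3 _ _ z); rewrite ?mem_nth.
Qed.

Lemma disjoint_boxes_size qs (y : X) : disjoint_boxes qs ->
  (forall q, q \in qs -> hit q y) -> (size qs <= size (pts y))%N.
Proof.
move=> dqs hqs.
have /choice[g gP] : forall i, exists z, (i < size qs)%N -> z \in pts y /\ box (nth q0 qs i) z.
  move=> i; case: (ltnP i (size qs)) => iq; last by exists point.
  by have [z zy zq] := hqs _ (mem_nth q0 iq); exists z.
rewrite -(size_iota 0 (size qs)) -(size_map g); apply: uniq_leq_size.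
  rewrite map_inj_in_uniq ?iota_uniq// => i j; rewrite !mem_iota/= !add0n => iq jq gij.
  by apply: (dqs i j (g i)) => //; [exact: (gP _ iq).2|rewrite gij; exact: (gP _ jq).2].
by move=> u /mapP[i iq ->]; apply: (gP i _).1; move: iq; rewrite mem_iota.
Qed.

Section hit_generated.
Context d (S : measurableType d) (F : S -> X).
Hypothesis mF : forall q, measurable (F @^-1` hit q).

Lemma measurable_hits (qs : seq corners) : measurable [set s | forall q, q \in qs -> hit q (F s)].
Proof.
elim: qs => [|q qs IH]; first by rewrite (_ : [set _ | _] = setT)//; apply/seteqP; split.
rewrite (_ : [set _ | _] = F @^-1` hit q `&` [set s | forall q, q \in qs -> hit q (F s)]).
  exact: measurableI.
apply/seteqP; split=> s /= => [H|[h1 h2] q']; last by rewrite inE => /predU1P[->|/h2].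
by split=> [|q' q'qs]; apply: H; rewrite inE ?eqxx// q'qs orbT.
Qed.

(** A pattern has at least n points exactly when it hits every box of some disjoint list of length
    n, and there are countably many such lists. *)
Let measurable_size_ge n : measurable [set s | (n <= size (pts (F s)))%N].
Proof.
rewrite (_ : [set _ | _] = \bigcup_(qs in [set qs | disjoint_boxes qs /\ size qs = n])
    [set s | forall q, q \in qs -> hit q (F s)]).
  rewrite bigcup_mkcond; apply: (countable_bigcupT_measurable (countableP _)) => qs.
  by case: ifP => _ //; exact: measurable_hits.
apply/seteqP; split=> s /=; last first.
  by move=> [qs [/= dqs <-]] hqs; exact: disjoint_boxes_size.
move=> ns; have [qs [dqs sqs hqs] _] := exists_boxed (F s) (@ltr01 R).
have nq : (n <= size qs)%N by rewrite -sqs.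
exists (take n qs).
  split; last by rewrite size_take_min; apply/minn_idPl.
  move=> i j z; rewrite size_takel// => ni nj; rewrite !nth_take//; apply: dqs.
    exact: leq_trans nq.
  exact: leq_trans nq.
by move=> q /mem_take; exact: hqs.
Qed.

Lemma measurable_boxed (qs : seq corners) : measurable (F @^-1` boxed qs).
Proof.
have [dqs|dqs] := pselect (disjoint_boxes qs); last first.
  by rewrite (_ : _ @^-1` _ = set0)//; apply/seteqP; split => s // -[].
rewrite (_ : _ @^-1` _ = [set s | (size qs <= size (pts (F s)))%N] `&`
  ~` [set s | ((size qs).+1 <= size (pts (F s)))%N] `&`
  [set s | forall q, q \in qs -> hit q (F s)]).
  apply: measurableI (measurable_hits qs); apply: measurableI => //.
  exact: measurableC.
apply/seteqP; split=> [s [/= _ -> h]|s /= [[h1 /negP]]]; first by rewrite ltnn.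
by rewrite -leqNgt => h2 h3; split=> //; apply/eqP; rewrite eqn_leq h1 h2.
Qed.

(** Every open set is the union of the sets [boxed qs] that it contains: small boxes isolating the
    points of a pattern only admit slight perturbations of it, which [open_pattern_near] controls.
    Hence the events [hit q] generate the Borel sets. *)
Lemma measurable_patternP : measurable_fun setT F.
Proof.
apply: (@measurability _ _ S X setT F _ erefl).
move=> _ [U oU <-]; rewrite setTI.
rewrite (_ : F @^-1` U = \bigcup_(qs in [set qs | boxed qs `<=` U]) F @^-1` boxed qs).
  rewrite bigcup_mkcond; apply: (countable_bigcupT_measurable (countableP _)) => qs.
  by case: ifP => _ //; exact: measurable_boxed.
apply/seteqP; split=> [s /= Us|s /= [qs /= qsU /qsU]//].
have [e e0 H] := open_pattern_near oU Us.
have [qs qsF qse] := exists_boxed (F s) e0; exists qs => // y [dqs sy hqs].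
case: (qsF) => [_ sF _]; apply: H; first by rewrite sy.
by move=> z /qse[q qqs qz]; have [u uy qu] := hqs _ qqs; exists u => //; exact: qz.
Qed.

End hit_generated.

Lemma measurable_hit q : measurable (hit q : set X).
Proof. by apply: sub_sigma_algebra; exact: open_hit. Qed.

Let point_in (q : corners) (y : X) : mpoint R := xget point [set z | z \in pts y /\ box q z].

Let point_inP q y : hit q y -> point_in q y \in pts y /\ box q (point_in q y).
Proof. by move=> [z zy qz]; apply: (@xgetI _ point [set z | z \in pts y /\ box q z] z). Qed.

(** One point chosen in each box gives as many distinct points as [y] has, so these are all of
    them. *)
Lemma boxed_uniq qs y q z z' : boxed qs y -> q \in qs -> z \in pts y -> z' \in pts y ->
  box q z -> box q z' -> z = z'.
Proof.
move=> [dqs sy hqs] qqs zy z'y qz qz'.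
pose s := map (point_in^~ y) qs.
have us : uniq s.
  apply/(uniqP point) => i j; rewrite !inE size_map => iq jq.
  rewrite !(nth_map q0)// => ij; apply: (dqs i j (point_in (nth q0 qs i) y)) => //.
    by apply: (point_inP (hqs _ _)).2; exact: mem_nth.
  by rewrite ij; apply: (point_inP (hqs _ _)).2; exact: mem_nth.
have ss : {subset s <= pts y} by move=> _ /mapP[p pq ->]; apply: (point_inP (hqs _ pq)).1.
have [_ es] : (size s = size (pts y)) * (s =i pts y).
  by apply: uniq_min_size => //; rewrite size_map sy.
have H u : u \in pts y -> box q u -> u = point_in q y.
  rewrite -es => /mapP[p pq ->] qu; congr point_in.
  have iq : (index q qs < size qs)%N by rewrite index_mem.
  have ip : (index p qs < size qs)%N by rewrite index_mem.
  rewrite -(nth_index q0 pq) -(nth_index q0 qqs); congr nth.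
  apply: (dqs _ _ (point_in p y)) => //; rewrite nth_index//.
  exact: (point_inP (hqs _ pq)).2.
by rewrite (H z)// (H z').
Qed.

Let decode (n : nat) : seq corners := odflt [::] (@choice.unpickle (seq corners) n).

(** Choosing the least code makes the isolating boxes a measurable function of the pattern: a code
    is decided by finitely many events [boxed]. *)
Let is_code (y : X) (n : nat) : Prop :=
  boxed (decode n) y /\ forall m, boxed (decode m) y -> (n <= m)%N.

Let code (y : X) : nat := xget 0%N [set n | is_code y n].

Let codeP y : is_code y (code y).
Proof.
rewrite /code; apply: (@xgetPex _ 0%N [set n | is_code y n]).
have [qs yqs _] := exists_boxed y (@ltr01 R).
have exn : exists n, `[< boxed (decode n) y >].
  by exists (choice.pickle qs); apply/asboolP; rewrite /decode choice.pickleK.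
exists (ex_minn exn); case: ex_minnP => n /asboolP yn nmin; split => // m ym.
by apply: nmin; exact/asboolP.
Qed.

Let measurable_code n : measurable [set y : X | code y = n].
Proof.
have mb m : measurable (boxed (decode m) : set X).
  exact: (@measurable_boxed _ X id measurable_hit).
rewrite (_ : [set _ | _] = boxed (decode n) `&`
   \bigcap_(m in [set m | (m < n)%N]) ~` boxed (decode m)).
  apply: measurableI => //; apply: bigcap_measurableType => m _.
  exact: measurableC.
apply/seteqP; split => y /=.
  move=> <-; split; first exact: (codeP y).1.
  by move=> m /= mc ym; move: mc; rewrite ltnNge (codeP y).2.
move=> [yn nmin]; apply/eqP; rewrite eqn_leq (codeP y).2//= leqNgt.
by apply/negP => /nmin; apply; exact: (codeP y).1.
Qed.

Definition enum_pattern (y : X) : seqs T := map (point_in^~ y) (decode (code y)).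

Let enum_size y : size (enum_pattern y) = size (pts y).
Proof. by have [[_ -> _] _] := codeP y; rewrite size_map. Qed.

Lemma perm_enum_pattern y : perm_eq (enum_pattern y) (pts y).
Proof.
have [[dqs sy hqs] _] := codeP y.
have us : uniq (enum_pattern y).
  apply/(uniqP point) => i j; rewrite !inE size_map => iq jq.
  rewrite !(nth_map q0)// => ij; apply: (dqs i j (point_in (nth q0 (decode (code y)) i) y)) => //.
    by apply: (point_inP (hqs _ _)).2; exact: mem_nth.
  by rewrite ij; apply: (point_inP (hqs _ _)).2; exact: mem_nth.
have ss : {subset enum_pattern y <= pts y}.
  by move=> _ /mapP[p pq ->]; apply: (point_inP (hqs _ pq)).1.
have [_ es] : (size (enum_pattern y) = size (pts y)) * (enum_pattern y =i pts y).
  by apply: uniq_min_size => //; rewrite enum_size.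
by apply: uniq_perm us (fset_uniq _) es.
Qed.

Lemma measurable_enum_pattern : measurable_fun setT enum_pattern.
Proof.
apply: measurable_seqsP => [k|i].
  rewrite (_ : [set _ | _] = \bigcup_(n in [set n | size (decode n) = k])
      [set y : X | code y = n]).
    by apply: bigcup_measurable => n _; exact: measurable_code.
  apply/seteqP; split=> y /= => [<-|[n /= <- <-]]; last by rewrite size_map.
  by exists (code y) => //=; rewrite size_map.
apply: measurable_mpoint => q.
(* When the code is n, the i-th point lies in [q] exactly when the pattern hits the intersection of
   [q] with the i-th box; beyond the length the entry is the default [point]. *)
rewrite (_ : _ @^-1` _ = \bigcup_n ([set y : X | code y = n] `&`
   (if (i < size (decode n))%N then hit (meet_corners (nth q0 (decode n) i) q)
    else [set y | box q (point : mpoint R)]))).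
  apply: bigcupT_measurable => n; apply: measurableI; first exact: measurable_code.
  case: ifP => _; first exact: measurable_hit.
  have [qp|qp] := pselect (box q (point : mpoint R)).
    by rewrite (_ : [set _ | _] = setT)//; apply/seteqP; split.
  by rewrite (_ : [set _ | _] = set0)//; apply/seteqP; split.
have E y : box q (nth point (enum_pattern y) i) <->
   (if (i < size (decode (code y)))%N then hit (meet_corners (nth q0 (decode (code y)) i) q)
    else [set y | box q (point : mpoint R)]) y.
  case: ltnP => ic; last by rewrite nth_default ?size_map.
  rewrite (nth_map q0)//; have [[dqs sy hqs] _] := codeP y.
  have qi := mem_nth q0 ic; have [py pq] := point_inP (hqs _ qi).
  split=> [qp|[z zy]]; first by exists (point_in (nth q0 (decode (code y)) i) y) => //; rewrite box_meet.
  by rewrite box_meet => -[zq zq']; have <- := boxed_uniq (codeP y).1 qi zy py zq pq.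
apply/seteqP; split => [y /= /E H|y /= [n _ [/= <- /E]]//].
by exists (code y).
Qed.

End pattern_enum.

Section eq_set_integral.
Import HBNNSimple.

(** The integral is a supremum over simple functions, hence depends on the values on measurable sets
    only. This lets the set functions of the statement be exchanged for measures inside an
    integral. *)
Lemma eq_set_integral d (T : measurableType d) (R : realType)
    (m1 m2 : set T -> \bar R) (f : T -> \bar R) :
  (forall A, measurable A -> m1 A = m2 A) -> \int[m1]_x f x = \int[m2]_x f x.
Proof.
move=> m12; rewrite /integral.
have E g : [set sintegral m1 h | h in [set h : {nnsfun T >-> R} | forall x, (h x)%:E <= g x]] =
  [set sintegral m2 h | h in [set h : {nnsfun T >-> R} | forall x, (h x)%:E <= g x]].
  have H (h : {nnsfun T >-> R}) : sintegral m1 h = sintegral m2 h.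
    by apply: eq_fsbigr => r _; rewrite m12.
  by apply/seteqP; split => _ [h hg <-]; exists h.
by rewrite !E.
Qed.

End eq_set_integral.

(** * Measurable operations on patterns *)

Section of_seq.
Context {R : realType}.
Variables (W : set (R * R)) (K : R).
Hypothesis mW : measurable (W : set (measurableTypeR R * measurableTypeR R)).

Local Notation T := (measurableTypeR R * measurableTypeR R * measurableTypeR R)%type.
Local Notation X := (pattern W K).

Definition of_seq (s : seqs T) : X := to_pattern W K [fset z in s]%fset.

Lemma measurable_exists_seq (A : set T) : measurable A ->
  measurable [set s : seqs T | exists2 z, z \in (s : seq T) & A z].
Proof.
move=> mA.
have /(measurable_preimage (f := fun s : seqs T => (s, s))) H :
  measurable [set p : seqs T * seqs T | exists2 z, z \in (p.1 : seq T) & A z].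
  apply: (@measurable_exists_seqs _ T _ (seqs T) [set p : T * seqs T | A p.1]).
  exact: measurable_preimage (@measurable_fst _ _ _ _) mA.
by apply: H; exact: measurable_fun_pair.
Qed.

Lemma measurable_exists2_seq (A : set (T * T)) : measurable A ->
  measurable [set s : seqs T | exists2 z, z \in (s : seq T) &
    exists2 z', z' \in (s : seq T) & A (z, z')].
Proof.
move=> mA.
have H1 : measurable [set p : seqs T * T | exists2 z, z \in (p.1 : seq T) & A (z, p.2)].
  exact: measurable_exists_seqs.
have H2 : measurable [set p : T * seqs T | exists2 z, z \in (p.2 : seq T) & A (z, p.1)].
  exact: measurable_preimage (@measurable_swap _ _ T (seqs T)) H1.
have H3 := measurable_exists_seqs H2.
have /(measurable_preimage (f := fun s : seqs T => (s, s))) := H3.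
move=> /(_ (measurable_fun_pair (@measurable_id _ _ setT) (@measurable_id _ _ setT))).
congr (measurable _); apply/seteqP; split => s /= [z zs [z' z's Azz']];
  by exists z' => //; exists z.
Qed.

Lemma measurable_loc_eq : measurable [set p : T * T | p.1.1 = p.2.1].
Proof.
have -> : [set p : T * T | p.1.1 = p.2.1] =
  (fun p : T * T => ((p.1.1, 0%R), (p.2.1, 0%R)) : T * T) @^-1` [set p : T * T | p.1 = p.2].
  by apply/seteqP; split => p /= => [->//|[->]].
apply: measurable_preimage measurable_eq_mpoint.
by apply: measurable_fun_pair; apply: measurable_fun_pair => //;
  [exact: (measurableT_comp (@measurable_fst _ _ _ _) (@measurable_fst _ _ _ _))|
   exact: (measurableT_comp (@measurable_fst _ _ _ _) (@measurable_snd _ _ _ _))].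
Qed.

Definition window : set T := [set z | W z.1 /\ (0 <= z.2 <= K)%R].

Lemma measurable_window : measurable window.
Proof.
rewrite (_ : window = W `*` `[0%R, K]%classic).
  by apply: measurableX => //; exact: measurable_itv.
by apply/seteqP; split => z /= []; rewrite /window/= in_itv.
Qed.

Lemma measurable_simple : measurable [set s : seqs T | simple_marked W K [fset z in s]%fset].
Proof.
rewrite (_ : [set _ | _] = ~` [set s : seqs T | exists2 z, z \in (s : seq T) & (~` window) z] `&`
  ~` [set s : seqs T | exists2 z, z \in (s : seq T) & exists2 z', z' \in (s : seq T) &
       ([set p : T * T | p.1.1 = p.2.1] `\` [set p : T * T | p.1 = p.2]) (z, z')]).
  apply: measurableI; apply: measurableC.
    by apply: measurable_exists_seq; apply: measurableC; exact: measurable_window.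
  apply: measurable_exists2_seq; apply: measurableD.
    exact: measurable_loc_eq.
  exact: measurable_eq_mpoint.
apply/seteqP; split => s /=.
  move=> [sW sK sU]; split.
    by move=> [z zs]; apply; split; [apply: sW|apply: sK]; rewrite inE.
  by move=> [z zs [z' z's [/= zz' /= nzz']]]; apply: nzz'; apply: sU => //; rewrite inE.
move=> [H1 H2]; split => [z|z|z z']; rewrite !inE => zs.
- by apply: contrapT => nz; apply: H1; exists z => // -[].
- by apply: contrapT => nz; apply: H1; exists z => // -[].
- move=> z's zz'; apply: contrapT => nzz'; apply: H2.
  by exists z => //; exists z'.
Qed.

Lemma measurable_of_seq : measurable_fun setT of_seq.
Proof.
apply: measurable_patternP => q.
rewrite (_ : _ @^-1` _ = [set s : seqs T | simple_marked W K [fset z in s]%fset] `&`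
  [set s : seqs T | exists2 z, z \in (s : seq T) & box q z]).
  apply: measurableI measurable_simple _.
  by apply: measurable_exists_seq; exact: measurable_box.
apply/seteqP; split => s /=.
  move=> [z]; have [ss|ns] := pselect (simple_marked W K [fset z in s]%fset); last first.
    by rewrite /of_seq to_patternN// inE.
  by rewrite /of_seq to_patternK// inE => zs qz; split => //; exists z.
by move=> [ss [z zs qz]]; exists z => //; rewrite /of_seq to_patternK// inE.
Qed.

Definition union_pattern (p : X * X) : X := to_pattern W K (pts p.1 `|` pts p.2)%fset.

Lemma union_patternE p :
  union_pattern p = of_seq (enum_pattern p.1 ++ enum_pattern p.2).
Proof.
congr to_pattern; apply/fsetP => z; rewrite !inE /= ?mem_cat.
by rewrite !(perm_mem (perm_enum_pattern _)).
Qed.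

(** On sequences the union is a concatenation, placed between the measurable maps [enum_pattern] and
    [of_seq]. *)
Lemma measurable_union_pattern : measurable_fun setT union_pattern.
Proof.
rewrite (_ : union_pattern = fun p => of_seq (enum_pattern p.1 ++ enum_pattern p.2)); last first.
  by apply/funext => p; exact: union_patternE.
have me := @measurable_enum_pattern R W K.
have mp : measurable_fun setT (fun p : X * X => (enum_pattern p.1, enum_pattern p.2)).
  apply: measurable_fun_pair.
    exact: (measurableT_comp me (@measurable_fst _ _ X X)).
  exact: (measurableT_comp me (@measurable_snd _ _ X X)).
exact: (measurableT_comp measurable_of_seq (measurableT_comp (@measurable_cat _ T) mp)).
Qed.

Lemma sum_enum (y : X) (V : nmodType) (h : mpoint R -> V) :
  (\sum_(z <- pts y) h z = \sum_(z <- (enum_pattern y : seq (mpoint R))) h z)%R.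
Proof. by rewrite (perm_big _ (perm_enum_pattern y)). Qed.

Lemma measurable_pattern_sum (h : T -> R) : measurable_fun setT h ->
  measurable_fun setT (fun y : X => \sum_(z <- pts y) h z)%R.
Proof.
move=> mh.
rewrite (_ : (fun y : X => _) = (fun y : X => \sum_(z <- (enum_pattern y : seq T)) h z)%R).
  exact: (measurableT_comp (measurable_sum_seqs mh) (@measurable_enum_pattern R W K)).
by apply/funext => y; exact: sum_enum.
Qed.

Lemma simple_french (d : R) (y : X) : simple_marked W K [fset z in pts y | (z.2 < d)%R]%fset.
Proof.
have [yW yK yU] := pts_simple y.
by split=> [z|z|z z']; rewrite !inE/= => /andP[zy _]; [exact: yW|exact: yK|
  move=> /andP[z'y _]; exact: yU].
Qed.

Lemma measurable_french (d : R) : measurable_fun setT (french_thinning d : X -> X).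
Proof.
apply: measurable_patternP => q.
have sub := @simple_french d.
rewrite (_ : _ @^-1` _ = @enum_pattern R W K @^-1` [set s : seqs T | exists2 z, z \in (s : seq T) &
    (box q `&` [set z | z.2 < d]%R) z]).
  apply: measurable_preimage (@measurable_enum_pattern R W K) _.
  apply: measurable_exists_seq; apply: measurableI; first exact: measurable_box.
  rewrite (_ : [set _ | _] = snd @^-1` `]-oo, d[%classic).
    by apply: measurable_preimage (@measurable_snd _ _ _ _) _; exact: measurable_itv.
  by apply/seteqP; split => z /=; rewrite in_itv.
apply/seteqP; split => y /= [z]; rewrite /french_thinning ?to_patternK//.
  by rewrite !inE/= => /andP[zy zd] qz; exists z; rewrite ?(perm_mem (perm_enum_pattern y)).
rewrite (perm_mem (perm_enum_pattern y)) => zy [qz zd]; exists z => //.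
by rewrite /french_thinning to_patternK// !inE/= zy.
Qed.

End of_seq.

(** * Births *)

Lemma integral_full d (T : measurableType d) (R : realType) (P : probability T R)
    (D : set T) (f : T -> \bar R) : measurable D -> P D = 1 ->
  measurable_fun setT f -> (forall x, 0 <= f x) -> \int[P]_(x in D) f x = \int[P]_x f x.
Proof.
move=> mD PD mf f0; rewrite [RHS](ge0_negligible_integral (measurableC mD) measurableT)//.
  by rewrite setTD setCK.
by move: (probability_setC P mD); rewrite PD subee// => ->.
Qed.

Lemma full_setC d (T : measurableType d) (R : realType) (m : {measure set T -> \bar R}) A :
  measurable A -> m setT = 1 -> m A = 1 -> m (~` A) = 0.
Proof.
move=> mA mT mA1.
have : 1 = 1 + m (~` A) := etrans (esym mT) (etrans (congr1 m (esym (setUCr A)))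
  (etrans (measureU m mA (measurableC mA) (setICr A)) (congr2 _ mA1 erefl))).
case: (m (~` A)) (measure_ge0 m (~` A)) => [r| |] //.
by rewrite -[LHS]adde0 => r0 [] /addrI <-.
Qed.

Lemma integral_cst1 d (T : measurableType d) (R : realType)
    (m : {measure set T -> \bar R}) (x : \bar R) : m setT = 1 -> \int[m]_(y in setT) x = x.
Proof. by move=> m1; rewrite integral_cst// m1 mule1. Qed.

Lemma eq_integral_off_null d (T : measurableType d) (R : realType)
    (m : {measure set T -> \bar R}) (B : set T) (f g : T -> \bar R) :
  measurable B -> m B = 0 ->
  measurable_fun setT f -> (forall x, 0 <= f x) ->
  measurable_fun setT g -> (forall x, 0 <= g x) ->
  (forall x, ~ B x -> f x = g x) -> \int[m]_x f x = \int[m]_x g x.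
Proof.
move=> mB B0 mf f0 mg g0 fg.
rewrite (ge0_negligible_integral mB measurableT mf)// [RHS](ge0_negligible_integral mB measurableT mg)//.
by apply: eq_integral => x /[!inE] -[_]; exact: fg.
Qed.

Lemma mnormalizeE d (T : measurableType d) (R : realType) (mu : {measure set T -> \bar R})
    (P : probability T R) A : mnormalize mu P A =
  if (mu setT == 0) || (mu setT == +oo) then P A else mu A * ((fine (mu setT))^-1)%:E.
Proof. by rewrite /mnormalize; case: ifP. Qed.

Lemma uniq_map_inj (A B : eqType) (f : A -> B) (s : seq A) :
  uniq (map f s) -> {in s &, injective f}.
Proof.
move=> us z z' zs z's fz.
have iz : (index z s < size (map f s))%N by rewrite size_map index_mem.
have iz' : (index z' s < size (map f s))%N by rewrite size_map index_mem.
have := nth_uniq (f z) iz iz' us.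
rewrite !(nth_map z) -?(size_map f)// !nth_index// fz eqxx => /esym/eqP zz'.
by rewrite -(nth_index z zs) zz' nth_index.
Qed.

Section birth.
Context {R : realType}.
Variables (W : set (R * R)) (K beta : R).
Hypothesis mW : measurable (W : set (measurableTypeR R * measurableTypeR R)).
Hypothesis W_fin : area W \is a fin_num.
Hypothesis beta_ge0 : (0 <= beta)%R.
Variable nu : probability (measurableTypeR R) R.
Hypothesis nuK : nu `[0%R, K]%classic = 1.

Local Notation T2 := (measurableTypeR R * measurableTypeR R)%type.
Local Notation T := (measurableTypeR R * measurableTypeR R * measurableTypeR R)%type.
Local Notation X := (pattern W K).
Local Notation a := (fine (area W)).
Local Notation b := (beta * fine (area W))%R.

(** When |W| = 0, [mnormalize] falls back on a Dirac mass. The identity [uniform_lawE] survives,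
    because its factor |W| is then 0. *)
Definition uniform_law : probability T2 R := mnormalize (mrestr (@area R) mW) (\d_(point : T2)).

Let a_ge0 : (0 <= a)%R.
Proof. by rewrite fine_ge0. Qed.

Let areaE : area W = a%:E. Proof. by rewrite fineK. Qed.

Let uniform_lawE A : measurable A -> A `<=` W -> area A = a%:E * uniform_law A.
Proof.
move=> mA AW.
have E1 : mrestr (@area R) mW setT = area W by rewrite /mrestr setTI.
have E2 : mrestr (@area R) mW A = area A by rewrite /mrestr setIidl.
have -> : uniform_law A = (if (area W == 0) || (area W == +oo) then \d_(point : T2) A
    else area A * (a^-1)%:E).
  have := mnormalizeE (mrestr (@area R) mW) (\d_(point : T2)) A.
  by rewrite /= E1 E2.
case: ifPn => [/orP[/eqP a0|/eqP aoo]|].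
- have -> : area A = 0 by exact: (subset_measure0 (mu := @area R) mA mW AW a0).
  by rewrite a0 mul0e.
- by move: W_fin; rewrite aoo.
- rewrite negb_or => /andP[a0 _].
  rewrite muleCA -EFinM divff ?mule1//.
  by apply: contra_neq a0 => a0; rewrite areaE a0.
Qed.

Lemma uniform_law_window : a != 0%R -> uniform_law W = 1.
Proof.
move=> a0; have := uniform_lawE mW (@subset_refl _ W).
have /fineK <- : uniform_law W \is a fin_num by exact: fin_num_measure.
by rewrite areaE -EFinM => -[/esym/eqP]; rewrite -subr_eq0 -{2}(mulr1 a) -mulrBr mulf_eq0 (negbTE a0) subr_eq0 /= => /eqP ->.
Qed.

Lemma int_area (f : T2 -> \bar R) : measurable_fun setT f -> (forall x, 0 <= f x) ->
  \int[area]_(x in W) f x = a%:E * \int[uniform_law]_x f x.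
Proof.
move=> mf f0; have [a0|a0] := eqVneq a 0%R.
  rewrite a0 mul0e null_set_integral//; first exact: measurable_funTS.
  exact: etrans areaE (congr1 EFin a0).
have uW := uniform_law_window a0.
rewrite -(integral_full mW uW mf f0).
transitivity (\int[mscale (NngNum a_ge0) uniform_law]_(x in W) f x).
  by apply: eq_measure_integral => A mA AW; exact: uniform_lawE.
by rewrite ge0_integral_mscale//; exact: measurable_funTS.
Qed.

Lemma int_marks (f : measurableTypeR R -> \bar R) : measurable_fun setT f -> (forall x, 0 <= f x) ->
  \int[nu]_(m in `[0%R, K]) f m = \int[nu]_m f m.
Proof. by move=> mf f0; rewrite integral_full//; exact: measurable_itv. Qed.

Definition point_law : giry T R := giry_prod (uniform_law : giry _ R, nu : giry _ R).

Lemma point_law1 : point_law setT = 1.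
Proof.
rewrite -setXTT -[LHS]/((uniform_law \x nu) _) product_measure1E//.
exact: etrans (congr2 _ (probability_setT uniform_law) (probability_setT nu)) (mule1 _).
Qed.

Fixpoint sample (n : nat) : giry (seqs T) R :=
  if n is m.+1 then giry_map (@measurable_cons_seqs _ T) (giry_prod (point_law, sample m))
  else giry_ret ([::] : seqs T).

Lemma int_sampleS n (f : seqs T -> \bar R) : measurable_fun setT f -> (forall s, 0 <= f s) ->
  \int[sample n.+1]_s f s = \int[point_law]_z \int[sample n]_s f (z :: s).
Proof.
move=> mf f0; rewrite -[LHS]/(giry_int _ _) /= giry_int_map// giry_int_prod1//.
- exact: (measurableT_comp mf (@measurable_cons_seqs _ T)).
- by move=> p; exact: f0.
Qed.

Lemma measurable_int_sample n (f : seqs T -> \bar R) : measurable_fun setT f ->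
  (forall s, 0 <= f s) -> measurable_fun setT (fun z : T => \int[sample n]_s f (z :: s)).
Proof.
move=> mf f0.
apply: (@measurable_giry_int_param _ _ _ _ _ (fun=> sample n) (fun p : T * seqs T => f (p.1 :: p.2))) => //.
exact: (measurableT_comp mf (@measurable_cons_seqs _ T)).
Qed.

Lemma sample1 n : sample n setT = 1.
Proof.
elim: n => [|n IH]; first by rewrite /= /giry_ret diracT.
rewrite -[LHS]/((point_law \x sample n) setT) -setXTT product_measure1E//.
exact: etrans (congr2 _ point_law1 IH) (mule1 _).
Qed.

(** Each integral over [W] yields a factor |W| when it becomes an expectation under [uniform_law],
    and the restriction of marks to [0, K] costs nothing since [nu] gives that interval full
    mass. *)
Lemma points_integralE n (f : seqs T -> \bar R) : measurable_fun setT f -> (forall s, 0 <= f s) ->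
  points_integral W K nu n f = (a ^+ n)%:E * \int[sample n]_s f s.
Proof.
elim: n f => [|n IH] f mf f0.
  by rewrite expr0 mul1e /= -[RHS]/(giry_int _ _) giry_int_ret.
rewrite /= int_sampleS//.
have mz z : measurable_fun setT (fun s : seqs T => f (z :: s)).
  have mcz := measurable_fun_pair2 z (@measurable_cons_seqs _ T).
  exact: (measurableT_comp mf mcz).
have mS := measurable_int_sample n mf f0.
have S0 z : 0 <= \int[sample n]_s f (z :: s) by apply: integral_ge0.
pose G x := \int[nu]_m \int[sample n]_s f ((x, m) :: s).
have G0 x : 0 <= G x by apply: integral_ge0.
have mG : measurable_fun setT G.
  exact: (@measurable_fun_fubini_tonelli_F _ _ T2 (measurableTypeR R) R nu
    (fun z : T => \int[sample n]_s f (z :: s)) mS S0).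
have an0 : 0 <= (a ^+ n)%:E by rewrite lee_fin exprn_ge0.
have E x : \int[nu]_(m in `[0%R, K]) points_integral W K nu n (fun s => f ((x, m) :: s)) =
    (a ^+ n)%:E * G x.
  have mSx : measurable_fun setT (fun m : measurableTypeR R => \int[sample n]_s f ((x, m) :: s)).
    have H := measurable_fun_pair2 (x : T2) mS; exact: H.
  rewrite /G -(int_marks mSx)// -ge0_integralZl//; last exact: measurable_funTS.
  by apply: eq_integral => m _; rewrite IH.
transitivity (\int[area]_(x in W) ((a ^+ n)%:E * G x)).
  by apply: eq_integral => x _; exact: E.
rewrite int_area; last 2 first.
- exact: measurable_funeM.
- by move=> x; rewrite mule_ge0.
rewrite ge0_integralZl// exprS EFinM -muleA; congr (_ * (_ * _)).
by rewrite -[RHS]/(giry_int _ _) giry_int_prod1.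
Qed.

Definition poisson_weight (n : nat) : R := expR (- b) * (b ^+ n / n`!%:R).

Let b_ge0 : (0 <= b)%R. Proof. exact: mulr_ge0. Qed.

Lemma poisson_weight_ge0 n : (0 <= poisson_weight n)%R.
Proof. by rewrite mulr_ge0 ?expR_ge0// divr_ge0// exprn_ge0. Qed.

Lemma poisson_weight_sum : \sum_(0 <= n <oo) (poisson_weight n)%:E = 1.
Proof.
rewrite /poisson_weight.
under eq_eseriesr do rewrite EFinM.
rewrite nneseriesZl//; last by move=> n _; rewrite lee_fin divr_ge0// exprn_ge0.
suff -> : \sum_(0 <= n <oo) (b ^+ n / n`!%:R)%:E = (expR b)%:E.
  by rewrite -EFinM -expRD addNr expR0.
apply/cvg_lim => //.
rewrite (_ : (fun n => _) = EFin \o series (exp_coeff b)).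
  by apply: cvg_EFin; [exact: nearW|exact: is_cvg_series_exp_coeff].
by apply/funext => n; rewrite /= /series/= sumEFin.
Qed.

(** The weights satisfy (n + 1) w(n + 1) = b w(n), and they sum to 1. *)
Lemma poisson_weight_mean : \sum_(0 <= n <oo) (poisson_weight n)%:E * n%:R%:E = b%:E.
Proof.
have w0 n : 0 <= (poisson_weight n)%:E * n%:R%:E by rewrite mule_ge0 ?lee_fin// poisson_weight_ge0.
rewrite nneseries_recl// mule0 add0e -nneseries_addn//.
rewrite -[RHS]mule1 -poisson_weight_sum -nneseriesZl; last first.
  by move=> n _; rewrite lee_fin poisson_weight_ge0.
apply: eq_eseriesr => n _; rewrite -!EFinM; congr EFin.
rewrite /poisson_weight addn1 factS natrM exprS invfM.
have m0 : (n.+1%:R != 0 :> R)%R by rewrite pnatr_eq0.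
have f0 : (n`!%:R != 0 :> R)%R by rewrite pnatr_eq0 -lt0n fact_gt0.
move: m0 f0; move: (n.+1%:R)%R (n`!%:R)%R (expR _) (b ^+ n)%R => m f e B m0 f0.
by field; rewrite ?m0 ?f0.
Qed.

(** The births as a random sequence, before points are gathered into a pattern: sums over sequences
    are additive without exception, so Campbell's formula is proved here. *)
Definition birth_seqs : set (seqs T) -> \bar R :=
  mseries (fun n => mscale (NngNum (poisson_weight_ge0 n)) (sample n)) 0.

HB.instance Definition _ := Measure.on birth_seqs.

Lemma int_birth_seqs (f : seqs T -> \bar R) : measurable_fun setT f -> (forall s, 0 <= f s) ->
  \int[birth_seqs]_s f s = \sum_(0 <= n <oo) (poisson_weight n)%:E * \int[sample n]_s f s.
Proof.
move=> mf f0; rewrite ge0_integral_measure_series//.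
by apply: eq_eseriesr => n _; rewrite ge0_integral_mscale.
Qed.

Lemma birth_seqsE (A : set (seqs T)) : measurable A ->
  birth_seqs A = \sum_(0 <= n <oo) (poisson_weight n)%:E * sample n A.
Proof. by []. Qed.

Lemma birth_seqs1 : birth_seqs setT = 1.
Proof.
rewrite birth_seqsE// -[RHS]poisson_weight_sum.
by apply: eq_eseriesr => n _; rewrite sample1 mule1.
Qed.

HB.instance Definition _ := Measure_isProbability.Build _ _ _ birth_seqs birth_seqs1.

Definition birth : giry X R := giry_map (measurable_of_seq mW) (birth_seqs : giry _ R).

Lemma birth1 : birth setT = 1.
Proof. exact: birth_seqs1. Qed.

Lemma birth_lawE (U : set X) : measurable U ->
  birth_law beta nu U = birth U.
Proof.
move=> mU; rewrite /birth_law -[RHS]/(birth_seqs _) birth_seqsE; last first.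
  exact: measurable_preimage (measurable_of_seq mW) mU.
apply: eq_eseriesr => n _.
have mf : measurable_fun setT (fun s : seqs T => \d_(of_seq W K s) U : \bar R).
  exact: (measurableT_comp (measurable_fun_dirac mU) (measurable_of_seq mW)).
rewrite (points_integralE _ mf)//.
rewrite muleA -EFinM /poisson_weight exprMn.
congr (_ * _).
  by congr EFin; rewrite -mulrA; congr (_ * _)%R; rewrite -!mulrA; congr (_ * _)%R; exact: mulrC.
under eq_integral do rewrite diracE.
rewrite -[in RHS](setIT (of_seq W K @^-1` U)) -integral_indic//.
exact: measurable_preimage (measurable_of_seq mW) mU.
Qed.

(* Almost surely a newborn sample avoids the locations already occupied, so that
   union with it adds up sums over points. *)
Definition good (s : seqs T) : Prop :=
  uniq (map fst (s : seq T)) /\ forall z, z \in (s : seq T) -> window W K z.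

Lemma good_perm (s s' : seqs T) : perm_eq (s : seq T) s' -> good s -> good s'.
Proof.
move=> ss' [us ws]; split; last by move=> z zs'; apply: ws; rewrite (perm_mem ss').
by rewrite -(perm_uniq (perm_map fst ss')).
Qed.

Lemma good_cat_l (t s : seqs T) : good (t ++ s) -> good t.
Proof.
move=> [u w]; split; first by move: u; rewrite map_cat cat_uniq => /and3P[].
by move=> z zt; apply: w; rewrite mem_cat zt.
Qed.

Lemma good_simple (s : seqs T) : good s -> simple_marked W K [fset z in s]%fset.
Proof.
move=> [us ws]; split => [z|z|z z'].
- by rewrite inE => zs; exact: (ws _ zs).1.
- by rewrite inE => zs; exact: (ws _ zs).2.
- rewrite !inE => zs z's; exact: uniq_map_inj us _ _ zs z's.
Qed.

Lemma good_enum (y : X) : good (enum_pattern y).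
Proof.
have [yW yK yU] := pts_simple y; have pe := perm_enum_pattern y.
split; last first.
  by move=> z; rewrite (perm_mem pe) => zy; split; [exact: yW|exact: yK].
rewrite map_inj_in_uniq ?(perm_uniq pe) ?fset_uniq// => z z'.
by rewrite !(perm_mem pe); exact: yU.
Qed.

Let m_loc (l : T2) : measurable [set z : T | z.1 = l].
Proof.
have mc : measurable_fun setT (fun z : T => (z, (l, 0%R) : T)).
  by apply: measurable_fun_pair.
rewrite (_ : [set _ | _] = (fun z : T => (z, (l, 0%R) : T)) @^-1` [set p : T * T | p.1.1 = p.2.1])//.
exact: measurable_preimage mc (@measurable_loc_eq R).
Qed.

Lemma area_set1 (l : T2) : area [set l] = 0.
Proof.
rewrite (_ : [set l] = [set l.1] `*` [set l.2]); last first.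
  by apply/seteqP; split => [z -> //|[z1 z2] [/= -> ->]]; rewrite -surjective_pairing.
rewrite -[LHS]/((@lebesgue_measure R \x @lebesgue_measure R) _).
rewrite product_measure1E//.
exact: etrans (congr2 _ (lebesgue_measure_set1 _) erefl) (mul0e _).
Qed.

Lemma point_law_loc (l : T2) : a != 0%R -> W l -> point_law [set z : T | z.1 = l] = 0.
Proof.
move=> a0 Wl; rewrite (_ : [set _ | _] = [set l] `*` setT); last first.
  by apply/seteqP; split => z /= => [->|[]].
have ml : measurable [set l : T2].
  rewrite (_ : [set l] = (fun x : T2 => (x, 0%R) : T) @^-1` [set z : T | z.1 = l]).
    by apply: measurable_preimage (m_loc l); exact: measurable_fun_pair.
  by apply/seteqP; split.
rewrite -[LHS]/((uniform_law \x nu) _) product_measure1E//.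
suff u0 : uniform_law [set l] = 0 by exact: etrans (congr2 _ u0 erefl) (mul0e _).
have lW : [set l] `<=` W by move=> _ ->.
have := uniform_lawE ml lW; rewrite area_set1.
by move=> /esym/eqP; rewrite mule_eq0 eqe (negbTE a0)/= => /eqP.
Qed.

Lemma point_law_window : a != 0%R -> point_law (~` window W K) = 0.
Proof.
move=> a0; have uW := uniform_law_window a0.
have mw := measurable_window K mW.
have w1 : point_law (window W K) = 1.
  rewrite (_ : window W K = W `*` `[0%R, K]%classic); last first.
    by apply/seteqP; split => z /= []; rewrite /window/= in_itv.
  rewrite -[LHS]/((uniform_law \x nu) _) product_measure1E//.
  exact: etrans (congr2 _ uW nuK) (mule1 _).
exact: full_setC mw point_law1 w1.
Qed.

Lemma good_rcons (t s : seqs T) z : good (t ++ z :: s) <-> good (rcons t z ++ s).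
Proof. by rewrite cat_rcons. Qed.

(** A new point is bad when it takes one of finitely many locations, each of area 0, or falls
    outside the window, which has full mass as |W| is not 0. *)
Lemma bad_point_null (t : seqs T) : a != 0%R -> good t ->
  exists B : set T, [/\ measurable B, point_law B = 0 & forall z, ~ B z -> good (rcons t z)].
Proof.
move=> a0 [ut wt].
have [B [mB B0 Bt]] : exists B : set T, [/\ measurable B, point_law B = 0 &
    forall z, ~ B z -> z.1 \notin map fst (t : seq T)].
  elim: (t : seq T) wt => [_|u t' IH wt]; first by exists set0; split => //; rewrite measure0.
  have [|B [mB B0 Bt]] := IH; first by move=> z zt; apply: wt; rewrite inE zt orbT.
  exists (B `|` [set z : T | z.1 = u.1]); split.
  - exact: measurableU.
  - apply: null_set_setU => //; apply: point_law_loc => //.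
    exact: (wt u (mem_head _ _)).1.
  - move=> z nBz /=; rewrite inE negb_or Bt ?andbT; last by move=> Bz; apply: nBz; left.
    by apply/eqP => zu; apply: nBz; right.
have mw := measurable_window K mW.
exists (B `|` ~` window W K); split.
- by apply: measurableU => //; exact: measurableC.
- by apply: null_set_setU => //; [exact: measurableC|exact: point_law_window].
- move=> z nBz; have nB : ~ B z by move=> Bz; apply: nBz; left.
  have wz : window W K z by apply: contrapT => nw; apply: nBz; right.
  split; first by rewrite map_rcons rcons_uniq ut Bt.
  by move=> u; rewrite mem_rcons inE => /predU1P[->|/wt].
Qed.

(** Induction on the number of points still to be drawn, with [t] general: each point drawn joins
    the occupied ones, and a null set of positions is discarded at each stage. *)
Lemma int_sample_good n (t : seqs T) (f g : seqs T -> \bar R) : a != 0%R -> good t ->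
  measurable_fun setT f -> (forall s, 0 <= f s) ->
  measurable_fun setT g -> (forall s, 0 <= g s) ->
  (forall s, good (t ++ s) -> f s = g s) ->
  \int[sample n]_s f s = \int[sample n]_s g s.
Proof.
move=> a0; elim: n t f g => [|n IH] t f g gt mf f0 mg g0 fg.
  rewrite -[LHS]/(giry_int _ _) -[RHS]/(giry_int _ _) /= !giry_int_ret//.
  by apply: fg; rewrite cats0.
rewrite (int_sampleS n mf f0) (int_sampleS n mg g0).
have [B [mB B0 Bt]] := bad_point_null a0 gt.
have mzf z : measurable_fun setT (fun s : seqs T => f (z :: s)).
  have mcz := measurable_fun_pair2 z (@measurable_cons_seqs _ T).
  exact: (measurableT_comp mf mcz).
have mzg z : measurable_fun setT (fun s : seqs T => g (z :: s)).
  have mcz := measurable_fun_pair2 z (@measurable_cons_seqs _ T).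
  exact: (measurableT_comp mg mcz).
apply: (eq_integral_off_null mB B0).
- exact: measurable_int_sample mf f0.
- by move=> z; apply: integral_ge0.
- exact: measurable_int_sample mg g0.
- by move=> z; apply: integral_ge0.
- move=> z nBz; apply: (IH (rcons t z)); [exact: Bt|exact: mzf|move=> s; exact: f0|
    exact: mzg|move=> s; exact: g0|].
  by move=> s gs; apply: fg; apply/good_rcons.
Qed.

Lemma int_birth_good (t : seqs T) (f g : seqs T -> \bar R) : good t ->
  measurable_fun setT f -> (forall s, 0 <= f s) ->
  measurable_fun setT g -> (forall s, 0 <= g s) ->
  (forall s, good (t ++ s) -> f s = g s) ->
  \int[birth_seqs]_s f s = \int[birth_seqs]_s g s.
Proof.
move=> gt mf f0 mg g0 fg; rewrite !int_birth_seqs//.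
apply: eq_eseriesr => n _; have [a0|a0] := eqVneq a 0%R; last first.
  by rewrite (@int_sample_good n t f g).
(* When |W| = 0, all the mass of the Poisson law is on n = 0, and the empty sample keeps [t]
   good. *)
case: n => [|n].
  rewrite -[in LHS]/(giry_int _ _) -[in RHS]/(giry_int _ _) /= !giry_int_ret//.
  by congr (_ * _); apply: fg; rewrite cats0.
by rewrite /poisson_weight a0 mulr0 expr0n /= mul0r mulr0 !mul0e.
Qed.

Section campbell.
Variable k : measurableTypeR R -> R.
Hypotheses (mk : measurable_fun setT k) (k0 : forall m, (0 <= k m)%R).
Hypothesis k_fin : \int[nu]_m (k m)%:E \is a fin_num.

Let mk2 : measurable_fun setT (fun z : T => k z.2).
Proof. exact: (measurableT_comp mk (@measurable_snd _ _ _ _)). Qed.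

Let sum_ge0 (s : seq T) : (0 <= \sum_(z <- s) k z.2)%R.
Proof. exact: sumr_ge0. Qed.

Let msum : measurable_fun setT (fun s : seqs T => (\sum_(z <- s) k z.2)%R%:E : \bar R).
Proof. by apply/measurable_EFinP; exact: measurable_sum_seqs. Qed.

Lemma int_point_law_mark : \int[point_law]_z (k z.2)%:E = \int[nu]_m (k m)%:E.
Proof.
rewrite -[LHS]/(giry_int _ _) giry_int_prod1//; last 2 first.
- exact/measurable_EFinP.
- by move=> z; rewrite lee_fin.
rewrite /giry_int/= integral_cst//.
exact: etrans (congr2 _ erefl (probability_setT uniform_law)) (mule1 _).
Qed.

Lemma int_sample_sum n :
  \int[sample n]_s (\sum_(z <- s) k z.2)%R%:E = n%:R%:E * \int[nu]_m (k m)%:E.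
Proof.
elim: n => [|n IH].
  by rewrite -[LHS]/(giry_int _ _) /= giry_int_ret// big_nil mul0e.
rewrite int_sampleS//.
transitivity (\int[point_law]_z ((k z.2)%:E + n%:R%:E * \int[nu]_m (k m)%:E)).
  apply: eq_integral => z _; rewrite -IH.
  transitivity (\int[sample n]_s ((k z.2)%:E + (\sum_(u <- s) k u.2)%R%:E)).
    by apply: eq_integral => s _; rewrite big_cons EFinD.
  rewrite ge0_integralD//; last 2 first.
  - by move=> s _; rewrite lee_fin.
  - by move=> s _; rewrite lee_fin.
  by rewrite (integral_cst1 _ (sample1 n)).
have c0 : 0 <= n%:R%:E * \int[nu]_m (k m)%:E.
  by rewrite mule_ge0 ?lee_fin//; apply: integral_ge0 => m _; rewrite lee_fin.
rewrite ge0_integralD//; last 2 first.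
- by move=> z _; rewrite lee_fin.
- exact/measurable_EFinP.
rewrite int_point_law_mark (integral_cst1 _ point_law1).
rewrite -natr1 EFinD ge0_muleDl ?lee_fin// mul1e addeC//.
Qed.

Lemma int_birth_sum :
  \int[birth_seqs]_s (\sum_(z <- s) k z.2)%R%:E = b%:E * \int[nu]_m (k m)%:E.
Proof.
rewrite int_birth_seqs//.
under eq_eseriesr do rewrite int_sample_sum muleA -(fineK k_fin) muleC.
rewrite nneseriesZl; last first.
  by move=> n _; rewrite mule_ge0 ?lee_fin// poisson_weight_ge0.
by rewrite poisson_weight_mean (fineK k_fin) muleC.
Qed.

(** Taking the points of [y] as the occupied ones, the union with a good sample is a simple pattern
    without merged points, so its sum splits into two. *)
Lemma int_birth_union (y : X) :
  \int[birth]_z (\sum_(u <- pts (union_pattern (y, z))) k u.2)%R%:E =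
  (\sum_(u <- pts y) k u.2)%R%:E + b%:E * \int[nu]_m (k m)%:E.
Proof.
have mF : measurable_fun setT (fun z : X => (\sum_(u <- pts (union_pattern (y, z))) k u.2)%R%:E).
  apply/measurable_EFinP.
  have mu := measurable_fun_pair2 y (measurable_union_pattern mW).
  exact: (measurableT_comp (measurable_pattern_sum mk2) mu).
rewrite -[LHS]/(giry_int _ _) giry_int_map//; last first.
  by move=> z; rewrite lee_fin sumr_ge0.
rewrite (sum_enum y (fun u => k u.2)).
transitivity (\int[birth_seqs]_s ((\sum_(u <- (enum_pattern y : seq T)) k u.2)%R%:E +
    (\sum_(u <- s) k u.2)%R%:E)).
  apply: (@int_birth_good (enum_pattern y)).
  - exact: good_enum.
  - exact: (measurableT_comp mF (measurable_of_seq mW)).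
  - by move=> s; rewrite lee_fin sumr_ge0.
  - exact: emeasurable_funD.
  - by move=> s; rewrite adde_ge0 ?lee_fin.
  move=> s gs; rewrite /= -EFinD -big_cat/=; congr EFin.
  have pe := perm_enum_pattern y.
  have gs' : good s by apply: (good_cat_l (s := enum_pattern y)); apply: good_perm gs; rewrite perm_catC.
  have us : uniq ((enum_pattern y : seq T) ++ s).
    exact: map_uniq gs.1.
  have -> : pts (union_pattern (y, of_seq W K s)) = [fset z in (enum_pattern y : seq T) ++ s]%fset.
    rewrite /union_pattern/= /of_seq (to_patternK (good_simple gs')).
    have E : (pts y `|` [fset z in (s : seq T)])%fset = [fset z in (enum_pattern y : seq T) ++ s]%fset.
      by apply/fsetP => z; rewrite !inE ?mem_cat /= ?mem_cat (perm_mem pe).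
    by rewrite E to_patternK//; exact: good_simple gs.
  apply: perm_big; apply: uniq_perm => //; first exact: fset_uniq.
  by move=> z; rewrite in_fset /=.
rewrite ge0_integralD//; last 2 first.
- by move=> s _; rewrite lee_fin.
- by move=> s _; rewrite lee_fin.
by rewrite (integral_cst1 _ birth_seqs1) int_birth_sum.
Qed.

End campbell.

End birth.

(** * Deaths and growth *)

Section thinning.
Context {R : realType} {T : choiceType}.
Variable pd : R.
Hypotheses (pd_ge0 : (0 <= pd)%R) (pd_le1 : (pd <= 1)%R).
Implicit Types (A b : {fset T}) (F : {fset T} -> \bar R).

Definition thin_weight A b : R := pd ^+ #|` (A `\` b)%fset | * (1 - pd) ^+ #|` b |.

Definition thin_sum A F : \bar R := \sum_(b <- fpowerset A) (thin_weight A b)%:E * F b.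

Lemma thin_weight_ge0 A b : (0 <= thin_weight A b)%R.
Proof. by rewrite mulr_ge0// exprn_ge0// subr_ge0. Qed.

Lemma eq_thin_sum A F G : (forall b, (b `<=` A)%fset -> F b = G b) ->
  thin_sum A F = thin_sum A G.
Proof.
move=> FG; rewrite /thin_sum !big_seq; apply: eq_bigr => b.
by rewrite fpowersetE => /FG ->.
Qed.

Lemma thin_sum0 F : thin_sum fset0 F = F fset0.
Proof.
by rewrite /thin_sum fpowerset0 big_seq_fset1 /thin_weight fset0D cardfs0 !expr0 mulr1 mul1e.
Qed.

Lemma thin_sumU1 z A F : z \notin A -> (forall b, 0 <= F b) ->
  thin_sum (z |` A)%fset F =
  (1 - pd)%:E * thin_sum A (fun b => F (z |` b)%fset) + pd%:E * thin_sum A F.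
Proof.
move=> zA F0.
have zb b : (b `<=` A)%fset -> z \notin b.
  by move=> bA; apply: contra zA; exact: fsubsetP bA z.
have pe : perm_eq (fpowerset (z |` A)%fset)
    ([seq (z |` b)%fset | b <- fpowerset A] ++ fpowerset A).
  apply: uniq_perm; first exact: fset_uniq.
    rewrite cat_uniq fset_uniq andbT map_inj_in_uniq ?fset_uniq/=; last first.
      move=> b b'; rewrite !fpowersetE => bA b'A /(congr1 (fun B => B `\ z)%fset).
      by rewrite !fsetU1K ?zb.
    apply/hasPn => b; rewrite fpowersetE => bA; apply/mapP => -[b' _ bE].
    by have := zb _ bA; rewrite bE fset1U1.
  move=> b; rewrite mem_cat !fpowersetE; apply/idP/orP.
    move=> bzA; have [bz|bz] := boolP (z \in b); [left|right].
      apply/mapP; exists (b `\ z)%fset; last by rewrite fsetD1K.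
      rewrite fpowersetE; apply/fsubsetP => u; rewrite !inE => /andP[uz ub].
      by move/fsubsetP: bzA => /(_ u ub); rewrite !inE (negbTE uz).
    apply/fsubsetP => u ub; move/fsubsetP: bzA => /(_ u ub).
    by rewrite !inE => /predU1P[uz|//]; rewrite uz (negbTE bz) in ub *.
  case=> [/mapP[b' + ->]|bA]; first by rewrite fpowersetE; exact: fsetUS.
  exact: fsubset_trans bA (fsubsetU1 _ _).
rewrite /thin_sum (perm_big _ pe) big_cat big_map /=.
rewrite !ge0_sume_distrr; last 2 first.
- by move=> b _; rewrite mule_ge0// lee_fin thin_weight_ge0.
- by move=> b _; rewrite mule_ge0// lee_fin thin_weight_ge0.
congr (_ + _); rewrite big_seq [RHS]big_seq; apply: eq_bigr => b;
    rewrite fpowersetE => bA; have nzb := zb b bA; rewrite muleA -EFinM; congr (_%:E * _).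
  rewrite /thin_weight.
  have -> : ((z |` A) `\` (z |` b) = A `\` b)%fset.
    apply/fsetP => u; rewrite !inE; have [->|//] := eqVneq u z.
    by rewrite (negbTE zA) andbF.
  by rewrite cardfsU1 nzb exprS mulrCA.
rewrite /thin_weight.
have -> : ((z |` A) `\` b = z |` (A `\` b))%fset.
  apply/fsetP => u; rewrite !inE; have [->|//] := eqVneq u z.
  by rewrite nzb.
by rewrite cardfsU1 inE (negbTE zA) andbF exprS mulrA.
Qed.

Lemma thin_sum_cst A (x : \bar R) : 0 <= x -> thin_sum A (fun=> x) = x.
Proof.
move=> x0; elim/finSet_rect: A => A IH.
have [->|[z zA]] := fset_0Vmem A; first exact: thin_sum0.
rewrite -(fsetD1K zA) thin_sumU1 ?fsetD11// IH ?fproperD1//.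
by rewrite -ge0_muleDl ?lee_fin ?subr_ge0// -EFinD subrK mul1e.
Qed.

Lemma thin_sumD A F G : (forall b, 0 <= F b) -> (forall b, 0 <= G b) ->
  thin_sum A (fun b => F b + G b) = thin_sum A F + thin_sum A G.
Proof.
move=> F0 G0; rewrite /thin_sum -big_split; apply: eq_bigr => b _.
by rewrite ge0_muleDr.
Qed.

Lemma thin_sum_mean A (k : T -> R) : (forall z, (0 <= k z)%R) ->
  thin_sum A (fun b => (\sum_(z <- b) k z)%R%:E) = ((1 - pd) * \sum_(z <- A) k z)%R%:E.
Proof.
move=> k0; elim/finSet_rect: A => A IH.
have s0 b : (0 <= \sum_(z <- b) k z)%R by exact: sumr_ge0.
have [->|[z zA]] := fset_0Vmem A; first by rewrite thin_sum0 !big_seq_fset0 mulr0.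
have zAz : z \notin (A `\ z)%fset by rewrite fsetD11.
rewrite -(fsetD1K zA) thin_sumU1//.
rewrite big_fsetU1//=.
have -> : thin_sum (A `\ z)%fset (fun b => (\sum_(u <- (z |` b)%fset) k u)%R%:E) =
    thin_sum (A `\ z)%fset (fun b => (k z)%:E + (\sum_(u <- b) k u)%R%:E).
  apply: eq_thin_sum => b bA; rewrite big_fsetU1//=.
  by apply: contra zAz; exact: fsubsetP bA z.
rewrite thin_sumD//; last by move=> _; rewrite lee_fin.
rewrite thin_sum_cst ?lee_fin// IH ?fproperD1//.
set S := (\sum_(u <- _) _)%R.
transitivity ((1 - pd) * (k z + (1 - pd) * S) + pd * ((1 - pd) * S))%R%:E; first by [].
by congr EFin; ring.
Qed.

End thinning.

Section growth.
Context {R : realType}.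
Variables (K lambda : R).

Lemma measurable_eq0 : measurable_fun setT (fun x : measurableTypeR R => x == 0%R).
Proof.
apply: (@measurable_fun_bool _ _ _ _ true).
rewrite setTI (_ : _ @^-1` _ = [set 0%R]); last by apply/seteqP; split => x /= /eqP.
exact: measurable_set1.
Qed.

Lemma measurable_inv : measurable_fun setT (fun x : measurableTypeR R => (x^-1)%R : R).
Proof.
have m0 := measurable_eq0.
rewrite (_ : (fun x => _) = (fun x : R => if x == 0%R then 0%R else (x^-1)%R)); last first.
  by apply/funext => x; case: eqP => // ->; rewrite invr0.
apply: measurable_fun_if => //.
rewrite setTI (_ : _ @^-1` _ = ~` [set 0%R]); last first.
  by apply/seteqP; split => x /=; [move=> /eqP|move/eqP/negbTE].
apply: open_continuous_measurable_fun; first by rewrite openC; exact: closed_eq.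
by move=> x; rewrite inE /= => /eqP; exact: inv_continuous.
Qed.

Lemma measurable_growth n : measurable_fun setT (growth K lambda n : measurableTypeR R -> R).
Proof.
have m0 := measurable_eq0.
apply: measurable_fun_ifT => //.
apply: measurable_funM => //; apply: (measurableT_comp measurable_inv).
apply: measurable_funD => //; apply: measurable_funM => //.
apply: measurable_funB => //; apply: measurable_funM => //.
exact: measurable_inv.
Qed.

Lemma growth_itv n m : (0 < K)%R -> (0 <= lambda)%R -> (0 <= m <= K)%R ->
  (0 <= growth K lambda n m <= K)%R.
Proof.
move=> K0 l0 /andP[m0 mK]; rewrite /growth; case: eqVneq => [_|mn0].
  by rewrite lexx ltW.
have {mn0}m0 : (0 < m)%R by rewrite lt_neqAle eq_sym mn0.
have d1 : (1 <= 1 + (K / m - 1) * expR (- (lambda * n%:R)))%R.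
  by rewrite lerDl mulr_ge0 ?expR_ge0// subr_ge0 ler_pdivlMr// mul1r.
have d0 := lt_le_trans ltr01 d1.
apply/andP; split; first by apply: divr_ge0; exact: ltW.
by rewrite ler_pdivrMr// ler_peMr// ltW.
Qed.

End growth.

(** * The law of the survivors *)

Section survivors.
Context {R : realType}.
Variables (W : set (R * R)) (K pd lambda : R).
Hypothesis mW : measurable (W : set (measurableTypeR R * measurableTypeR R)).
Hypotheses (K_gt0 : (0 < K)%R) (lambda_ge0 : (0 <= lambda)%R).
Hypotheses (pd_ge0 : (0 <= pd)%R) (pd_le1 : (pd <= 1)%R).

Local Notation T := (measurableTypeR R * measurableTypeR R * measurableTypeR R)%type.
Local Notation X := (pattern W K).

Definition grown (b : {fset mpoint R}) : X := to_pattern W K (grow K lambda b).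

Lemma grow_simple (a : X) b : (b `<=` pts a)%fset -> simple_marked W K (grow K lambda b).
Proof.
move=> /fsubsetP ba; have [aW aK aU] := pts_simple a.
split=> [z|z|z z'] /imfsetP[/= u ub ->] /=.
- by apply: aW; exact: ba.
- by apply: growth_itv => //; apply: aK; exact: ba.
- move=> /imfsetP[/= u' u'b ->] /= uu'.
  by rewrite (aU _ _ (ba _ ub) (ba _ u'b) uu').
Qed.

(** Growth keeps locations, which are distinct within a pattern; hence [grow] merges no points. *)
Lemma sum_grown (a : X) b (k : R -> R) : (b `<=` pts a)%fset ->
  (\sum_(z <- pts (grown b)) k z.2 = \sum_(z <- b) k (growth K lambda 1 z.2))%R.
Proof.
move=> ba; rewrite /grown to_patternK; last exact: grow_simple ba.
have [_ _ aU] := pts_simple a.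
rewrite /grow big_imfset//= => z z' zb z'b [zz' _].
by apply: aU => //; exact: fsubsetP ba _ _.
Qed.

(** Listing the power set presents [survivors_law] as a finite sum of scaled Dirac masses, which is
    a measure by construction. *)
Definition survivors (a : X) : set X -> \bar R :=
  msum (fun n => let b := nth fset0 (fpowerset (pts a)) n in
    mscale (NngNum (thin_weight_ge0 pd_ge0 pd_le1 (pts a) b)) \d_(grown b))
    (size (fpowerset (pts a))).

HB.instance Definition _ a := Measure.on (survivors a).

Lemma survivors_lawE a U : survivors_law pd lambda a U = survivors a U.
Proof.
rewrite /survivors_law (big_nth fset0) big_mkord.
by apply: eq_bigr => i _.
Qed.

Lemma int_survivors a (F : X -> \bar R) : measurable_fun setT F -> (forall x, 0 <= F x) ->
  \int[survivors a]_x F x = thin_sum pd (pts a) (F \o grown).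
Proof.
move=> mF F0; rewrite /survivors ge0_integral_measure_sum//.
rewrite /thin_sum [RHS](big_nth fset0) big_mkord; apply: eq_bigr => i _.
by rewrite ge0_integral_mscale// integral_dirac// diracT mul1e.
Qed.

Lemma survivors1 a : survivors a setT = 1.
Proof.
rewrite -survivors_lawE -[RHS](thin_sum_cst pd_ge0 pd_le1 (pts a) lee01).
by apply: eq_bigr => b _; rewrite diracT.
Qed.

HB.instance Definition _ a := Measure_isProbability.Build _ _ _ (survivors a) (survivors1 a).

(* [thin_sum] unfolded along an enumeration, so that measurability in the pattern can be read off. *)
Fixpoint thin_seq (F : seqs T -> \bar R) n (s acc : seqs T) : \bar R :=
  if n is n'.+1 then
    (1 - pd)%:E * thin_seq F n' (behead s) (nth point s 0 :: acc) +
    pd%:E * thin_seq F n' (behead s) acc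
  else F acc.

Lemma measurable_thin_seq F n : measurable_fun setT F ->
  measurable_fun setT (fun p : seqs T * seqs T => thin_seq F n p.1 p.2).
Proof.
move=> mF.
have m1 := @measurable_fst _ _ (seqs T) (seqs T).
have m2 := @measurable_snd _ _ (seqs T) (seqs T).
have mb := measurableT_comp (@measurable_behead _ T) m1.
have mh := measurableT_comp (measurable_nth (T := T) 0) m1.
have mc := measurableT_comp (@measurable_cons_seqs _ T) (measurable_fun_pair mh m2).
elim: n => [|n IH]; first exact: (measurableT_comp mF m2).
apply: emeasurable_funD; apply: measurable_funeM.
  exact: (measurableT_comp IH (measurable_fun_pair mb mc)).
exact: (measurableT_comp IH (measurable_fun_pair mb m2)).
Qed.

(** [acc] collects the points already known to survive, while [b] ranges over the survivors among
    the undecided points of [s]. *)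
Lemma thin_seqE (F : seqs T -> \bar R) (G : {fset T} -> \bar R) (s acc : seqs T) :
  (forall b, 0 <= G b) -> (forall s : seqs T, F s = G [fset z in (s : seq T)]%fset) ->
  uniq (s : seq T) ->
  thin_seq F (size s) s acc =
  thin_sum pd [fset z in (s : seq T)]%fset (fun b => G (b `|` [fset z in (acc : seq T)])%fset).
Proof.
move=> G0 FG; elim: s acc => [|z s IH] acc /=.
  by rewrite FG (_ : [fset z in [::]]%fset = fset0) ?thin_sum0 ?fset0U//; apply/fsetP => z; rewrite !inE.
move=> /andP[zs us]; rewrite !IH//.
rewrite (_ : [fset u in z :: s] = z |` [fset u in s])%fset; last first.
  by apply/fsetP => u; rewrite !inE.
rewrite thin_sumU1//; last by rewrite inE.
congr (_ * _ + _); apply: eq_thin_sum => b _; congr G.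
by apply/fsetP => u; rewrite !inE orbCA orbA.
Qed.

Lemma measurable_survivors : measurable_fun setT (survivors : X -> giry X R).
Proof.
apply: measurable_giry_codensity => // U mU.
pose g (z : T) : T := (z.1, growth K lambda 1 z.2).
have mg : measurable_fun setT g.
  apply: measurable_fun_pair => //.
  exact: (measurableT_comp (measurable_growth K lambda 1) (@measurable_snd _ _ _ _)).
pose F (s : seqs T) : \bar R := \d_(of_seq W K (map g s)) U.
have mF : measurable_fun setT F.
  apply: (measurableT_comp (measurable_fun_dirac mU)).
  exact: (measurableT_comp (measurable_of_seq mW) (measurable_map mg)).
pose G (b : {fset T}) : \bar R := \d_(grown b) U.
have FG (s : seqs T) : F s = G [fset z in (s : seq T)]%fset.
  apply: (congr1 (fun x => \d_x U)); congr to_pattern.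
  apply/fsetP => u; rewrite !inE; apply/mapP/imfsetP => /= -[z zs ->]; exists z => //.
    by rewrite !inE.
  by rewrite inE in zs.
have me := @measurable_enum_pattern R W K.
apply: (measurable_by_size me) => n.
apply: (eq_measurable_fun (fun a : X => thin_seq F n (enum_pattern a) [::])).
  move=> a /set_mem /= <-; have pe := perm_enum_pattern a.
  rewrite (@thin_seqE F G)//; last by rewrite (perm_uniq pe) fset_uniq.
  rewrite -survivors_lawE /survivors_law.
  rewrite (_ : [fset z in (enum_pattern a : seq T)]%fset = pts a); last first.
    by apply/fsetP => z; rewrite inE/= (perm_mem pe).
  apply: eq_bigr => b _; congr (_ * G _).
  by apply/fsetP => u; rewrite !inE orbF.
apply: measurable_funTS.
have mp : measurable_fun setT (fun a : X => (enum_pattern a, [::] : seqs T)).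
  exact: measurable_fun_pair.
exact: (measurableT_comp (measurable_thin_seq n mF) mp).
Qed.

End survivors.

Lemma int_dirac d (T : measurableType d) (R : realType) (m : {measure set T -> \bar R}) U :
  measurable U -> \int[m]_y \d_y U = m U.
Proof.
move=> mU; under eq_integral do rewrite diracE.
by rewrite integral_indic// setIT.
Qed.

(** * The transition kernel *)

Section next.
Context {R : realType}.
Variables (W : set (R * R)) (K pd beta lambda : R).
Hypothesis mW : measurable (W : set (measurableTypeR R * measurableTypeR R)).
Hypothesis W_fin : area W \is a fin_num.
Hypotheses (K_gt0 : (0 < K)%R) (lambda_ge0 : (0 <= lambda)%R) (beta_ge0 : (0 <= beta)%R).
Hypotheses (pd_ge0 : (0 <= pd)%R) (pd_le1 : (pd <= 1)%R).
Variable nu : probability (measurableTypeR R) R.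
Hypothesis nuK : nu `[0%R, K]%classic = 1.

Local Notation X := (pattern W K).
Local Notation surv a := (survivors lambda pd_ge0 pd_le1 a : giry X R).
Local Notation born := (birth K mW beta_ge0 nu).

Definition next (a : X) : giry X R :=
  giry_map (measurable_union_pattern mW) (giry_prod (surv a, born)).

Lemma measurable_next : measurable_fun setT next.
Proof.
have ms := measurable_survivors (W := W) (K := K) lambda mW pd_ge0 pd_le1.
have mp : measurable_fun setT (fun a => (surv a, born) : giry X R * giry X R).
  exact: measurable_fun_pair.
exact: (measurableT_comp (measurable_giry_map (measurable_union_pattern mW))
  (measurableT_comp (@measurable_giry_prod _ _ X X R) mp)).
Qed.

Lemma int_next a (F : X -> \bar R) : measurable_fun setT F -> (forall x, 0 <= F x) ->
  \int[next a]_y F y = \int[surv a]_y \int[born]_z F (union_pattern (y, z)).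
Proof.
move=> mF F0; rewrite -[LHS]/(giry_int _ _) giry_int_map// giry_int_prod1//.
- exact: (measurableT_comp mF (measurable_union_pattern mW)).
- by move=> p; exact: F0.
Qed.

Lemma next1 a : next a setT = 1.
Proof.
rewrite -[LHS]/((surv a \x born) setT) -setXTT product_measure1E//.
exact: etrans (congr2 _ (survivors1 lambda pd_ge0 pd_le1 a) (birth1 K mW beta_ge0 nu)) (mule1 _).
Qed.

Lemma next_lawE a U : measurable U -> next_law pd beta lambda nu a U = next a U.
Proof.
move=> mU; rewrite -(int_dirac _ mU) int_next//; last exact: measurable_fun_dirac.
transitivity (\int[surv a]_b \int[birth_law (W := W) (K := K) beta nu]_z
    \d_(union_pattern (b, z)) U).
  by apply: eq_set_integral => A _; exact: survivors_lawE.
by apply: eq_integral => b _; apply: eq_set_integral => A mA; exact: birth_lawE.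
Qed.

(** The mark function is arbitrary because two are needed: [capped_mark] for the Bellman equation
    and the constant 1 for the expected number of points. *)
Lemma next_mean a (k : measurableTypeR R -> R) : measurable_fun setT k ->
  (forall m, (0 <= k m)%R) -> \int[nu]_m (k m)%:E \is a fin_num ->
  \int[next a]_y (\sum_(z <- pts y) k z.2)%R%:E =
  ((1 - pd) * \sum_(z <- pts a) k (growth K lambda 1 z.2))%R%:E +
  (beta * fine (area W))%R%:E * \int[nu]_m (k m)%:E.
Proof.
move=> mk k0 kfin.
have mk2 : measurable_fun setT (fun z : measurableTypeR R * measurableTypeR R * measurableTypeR R => k z.2).
  exact: (measurableT_comp mk (@measurable_snd _ _ _ _)).
have mS : measurable_fun setT (fun y : X => (\sum_(z <- pts y) k z.2)%R%:E).
  by apply/measurable_EFinP; exact: (measurable_pattern_sum mk2).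
have s0 (y : X) : 0 <= (\sum_(z <- pts y) k z.2)%R%:E by rewrite lee_fin sumr_ge0.
rewrite int_next//.
have c0 : 0 <= (beta * fine (area W))%R%:E * \int[nu]_m (k m)%:E.
  rewrite mule_ge0 ?lee_fin ?mulr_ge0 ?fine_ge0//.
  by apply: integral_ge0 => m _; rewrite lee_fin.
transitivity (\int[surv a]_y ((\sum_(z <- pts y) k z.2)%R%:E +
    (beta * fine (area W))%R%:E * \int[nu]_m (k m)%:E)).
  by apply: eq_integral => y _; rewrite int_birth_union.
rewrite int_survivors//; last 2 first.
- exact: emeasurable_funD.
- by move=> y; rewrite adde_ge0.
set C := _ * _.
have g0 (z : mpoint R) : (0 <= k (growth K lambda 1 z.2))%R by exact: k0.
rewrite (@eq_thin_sum _ _ pd (pts a) _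
    (fun b => (\sum_(z <- b) k (growth K lambda 1 z.2))%R%:E + C)); last first.
  by move=> b ba; rewrite /= (sum_grown (lambda := lambda) K_gt0 lambda_ge0 k ba).
rewrite thin_sumD//; last by move=> b; rewrite lee_fin sumr_ge0.
by rewrite thin_sum_mean// thin_sum_cst.
Qed.

End next.

(** * The optimal mark and the threshold *)

Section constants.
Context {R : realType}.
Variables (K pd lambda alpha : R).
Hypotheses (K_gt0 : (0 < K)%R) (lambda_gt0 : (0 < lambda)%R).
Hypotheses (pd_ge0 : (0 <= pd)%R) (pd_le1 : (pd <= 1)%R).
Hypotheses (alpha_ge0 : (0 <= alpha)%R) (alpha_le1 : (alpha <= 1)%R).

Local Open Scope ring_scope.

Local Notation g := (growth K lambda).
Local Notation q := (alpha * (1 - pd))%R.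
Local Notation s := (best_mark K pd lambda alpha).
Local Notation d := (threshold K pd lambda alpha).

Let q_ge0 : 0 <= q. Proof. by rewrite mulr_ge0// subr_ge0. Qed.

Let q_le1 : q <= 1.
Proof. by rewrite mulr_ile1// ?subr_ge0// lerBlDr lerDl. Qed.

Let qn_ge0 n : 0 <= q ^+ n. Proof. exact: exprn_ge0. Qed.

Let qn_le1 n : q ^+ n <= 1. Proof. exact: exprn_ile1. Qed.

Let q_growth_le n m : 0 <= m <= K -> q ^+ n * g n m <= K.
Proof.
move=> /(growth_itv n K_gt0 (ltW lambda_gt0)) /andP[g0 gK].
by apply: le_trans gK; rewrite ler_piMl.
Qed.

Lemma best_markE m : m != 0 -> s m = sup [set q ^+ n * g n m | n in [set: nat]].
Proof.
move=> m0; rewrite /best_mark (negbTE m0); congr sup; apply/seteqP.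
by split => _ [n _ <-]; exists n => //; rewrite /growth (negbTE m0) exprMn; ring.
Qed.

Lemma best_mark0 : s 0 = 0. Proof. by rewrite /best_mark eqxx. Qed.

Lemma growth_at0 n : g n 0 = 0. Proof. by rewrite /growth eqxx. Qed.

Lemma growth0 m : g 0 m = m.
Proof.
rewrite /growth; have [->//|m0] := eqVneq m 0.
rewrite mulr0 oppr0 expR0 mulr1 addrC subrK invf_div mulrCA divff ?mulr1//.
by rewrite gt_eqF.
Qed.

Lemma growth_gt0 n m : 0 < m <= K -> 0 < g n m.
Proof.
move=> /andP[m0 mK]; rewrite /growth gt_eqF// divr_gt0//.
rewrite ltr_pwDl// mulr_ge0 ?expR_ge0// subr_ge0 ler_pdivlMr// mul1r//.
Qed.

(** In the variable K / m - 1, one step of growth is multiplication by exp(- lambda). *)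
Lemma growthS n m : 0 <= m <= K -> g n (g 1 m) = g n.+1 m.
Proof.
move=> /andP[]; rewrite le_eqVlt => /predU1P[<- _|m0 mK]; first by rewrite !growth_at0.
have g1 : 0 < g 1 m by apply: growth_gt0; rewrite m0.
rewrite {1}/growth gt_eqF//.
have -> : K / g 1 m - 1 = (K / m - 1) * expR (- lambda).
  rewrite /growth gt_eqF// mulr1 invf_div mulrCA divff ?gt_eqF// mulr1.
  by rewrite addrC addKr.
rewrite -mulrA -expRD /growth gt_eqF//.
by congr (K / (1 + _ * expR _)); rewrite -natr1; ring.
Qed.

Lemma best_mark_ge n m : 0 <= m <= K -> q ^+ n * g n m <= s m.
Proof.
move=> mK; have [m0|m0] := eqVneq m 0; first by rewrite m0 growth_at0 mulr0 best_mark0.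
rewrite best_markE//; apply: ub_le_sup; last by exists n.
by exists K => _ [k _ <-]; exact: q_growth_le.
Qed.

Lemma best_mark_le m B : (forall n, q ^+ n * g n m <= B) -> s m <= B.
Proof.
move=> mB; have [m0|m0] := eqVneq m 0.
  by have := mB 0%N; rewrite m0 growth_at0 mulr0 best_mark0.
rewrite best_markE//; apply: ge_sup; first by exists (q ^+ 0 * g 0 m); exists 0%N.
by move=> _ [n _ <-].
Qed.

Lemma best_mark_ge_id m : 0 <= m <= K -> m <= s m.
Proof. by move=> mK; have := best_mark_ge 0 mK; rewrite mul1r growth0. Qed.

Lemma best_mark_itv m : 0 <= m <= K -> 0 <= s m <= K.
Proof.
move=> mK; have /andP[m0 _] := mK; rewrite (le_trans m0 (best_mark_ge_id mK))/=.
by apply: best_mark_le => n; exact: q_growth_le.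
Qed.

(** Multiplied by q, term n of the supremum at [g 1 m] is term n + 1 of the supremum at [m]. *)
Lemma best_mark_growth m : 0 <= m <= K -> q * s (g 1 m) <= s m.
Proof.
move=> mK; have /andP[sm0 _] := best_mark_itv mK.
have [q0|q0] := eqVneq q 0; first by rewrite q0 mul0r.
have qp : 0 < q by rewrite lt_neqAle eq_sym q0.
rewrite mulrC -ler_pdivlMr//; apply: best_mark_le => n.
by rewrite ler_pdivlMr// mulrAC -exprSr growthS// best_mark_ge.
Qed.

Local Notation t n := (K / (1 - expR (- (n%:R * lambda))) *
  (alpha ^+ n * (1 - pd) ^+ n - expR (- (n%:R * lambda)))).

(** The origin of the threshold: with e = exp(- (n + 1) lambda), clearing denominators turns m <
    q^(n+1) g^(n+1)(m) into the linear inequality m (1 - e) < K (q^(n+1) - e). The index n + 1 keeps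
    1 - e positive. *)
Lemma lt_growth n m : 0 < m <= K -> (m < q ^+ n.+1 * g n.+1 m) = (m < t n.+1).
Proof.
move=> /andP[m0 mK]; rewrite -exprMn /growth gt_eqF// mulrC (mulrC lambda).
set e := expR _; have e0 : 0 < e by exact: expR_gt0.
have e1 : e < 1 by rewrite /e -expR0 ltr_expR oppr_lt0 mulr_gt0.
have -> : 1 + (K / m - 1) * e = (m + (K - m) * e) / m by field; rewrite gt_eqF.
have D0 : 0 < m + (K - m) * e by rewrite ltr_pwDl// mulr_ge0 ?subr_ge0// ltW.
rewrite invf_div !mulrA mulrAC ltr_pdivlMr// mulrAC [in RHS]mulrAC ltr_pdivlMr ?subr_gt0//.
rewrite (mulrC _ m) ltr_pM2l//.
by rewrite -subr_gt0 -[RHS]subr_gt0; congr (0 < _); ring.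
Qed.

Lemma threshold_ge n : t n <= d.
Proof.
apply: ub_le_sup; last by exists n.
(* [K] bounds all terms because q^n <= 1, and the term for n = 0 is K / 0 times 0. *)
exists K => _ [[|k] _ <-].
  by rewrite mul0r oppr0 expR0 subrr invr0 mulr0 mul0r ltW.
rewrite -exprMn; set e := expR _.
have e1 : e < 1 by rewrite /e -expR0 ltr_expR oppr_lt0 mulr_gt0.
rewrite mulrAC ler_pdivrMr ?subr_gt0// ler_pM2l//.
by rewrite lerD2r qn_le1.
Qed.

Lemma threshold_gt m : m < d -> exists n, m < t n.
Proof.
move=> md; have [||_ [n _ <-]] := @sup_gt _ [set t n | n in [set: nat]] m => //.
  by exists (t 0%N); exists 0%N.
by exists n.
Qed.

(** From [d] on, no positive waiting time beats immediate removal, which is the term n = 0. *)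
Lemma best_mark_above m : 0 <= m <= K -> d <= m -> s m = m.
Proof.
move=> mK dm; apply/le_anti; rewrite best_mark_ge_id// andbT; apply: best_mark_le => -[|n].
  by rewrite mul1r growth0.
have /andP[] := mK; rewrite le_eqVlt => /predU1P[<- _|m0 mK']; first by rewrite growth_at0 mulr0.
by rewrite leNgt lt_growth ?m0// -leNgt (le_trans (threshold_ge _)).
Qed.

(** Below [d] some term n >= 1 exceeds the term n = 0; the supremum is then over n >= 1, which is q
    times the supremum after one step of growth. *)
Lemma best_mark_below m : 0 <= m <= K -> m < d -> s m = q * s (g 1 m).
Proof.
move=> mK /threshold_gt[n mn]; apply/le_anti; rewrite best_mark_growth// andbT.
have gK := growth_itv 1 K_gt0 (ltW lambda_gt0) mK.
have S k : q ^+ k.+1 * g k.+1 m <= q * s (g 1 m).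
  by rewrite exprS -mulrA -growthS// ler_wpM2l// best_mark_ge.
apply: best_mark_le => -[|k]; last exact: S.
rewrite mul1r growth0; have /andP[] := mK; rewrite le_eqVlt => /predU1P[<- _|m0 mK'].
  by rewrite growth_at0 best_mark0 mulr0.
(* A witness n = 0 is excluded: its term is 0, and m > 0. *)
case: n mn => [|n].
  by rewrite mul0r oppr0 expR0 subrr invr0 mulr0 mul0r ltNge (ltW m0).
by rewrite -lt_growth ?m0// => /ltW/le_trans; apply; exact: S.
Qed.

(* Outside of [0, K] the set in [best_mark] may be unbounded, and its [sup] a junk value. *)
Definition capped_mark (m : R) : R := if 0 <= m <= K then s m else 0.

Lemma capped_markE m : 0 <= m <= K -> capped_mark m = s m.
Proof. by rewrite /capped_mark => ->. Qed.

Lemma capped_mark_itv m : 0 <= capped_mark m <= K.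
Proof.
rewrite /capped_mark; case: ifPn => [mK|_]; first exact: best_mark_itv.
by rewrite lexx ltW.
Qed.

Lemma measurable_capped_mark :
  measurable_fun setT (capped_mark : measurableTypeR R -> R).
Proof.
pose h n (m : measurableTypeR R) : R := if 0 <= m <= K then q ^+ n * g n m else 0.
have mh n : measurable_fun setT (h n).
  apply: measurable_fun_ifT => //; last first.
    by apply: measurable_funM => //; exact: measurable_growth.
  apply: (@measurable_fun_bool _ _ _ _ true).
  rewrite setTI (_ : _ @^-1` _ = `[0, K]%classic); last first.
    by apply/seteqP; split => x /=; rewrite in_itv.
  exact: measurable_itv.
have -> : capped_mark = (fun m => sups (h^~ m) 0).
  apply/funext => m; rewrite /capped_mark /sups /sdrop /h; case: ifPn => mK.
    apply/le_anti/andP; split.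
      apply: best_mark_le => n; apply: ub_le_sup; last by exists n.
      by exists K => _ [k _ <-]; exact: q_growth_le.
    apply: ge_sup; first by exists (q ^+ 0 * g 0 m); exists 0%N.
    by move=> _ [n _ <-]; exact: best_mark_ge.
  apply/esym; transitivity (sup [set 0 : R]); last exact: sup1.
  congr sup; by apply/seteqP; split => [_ [n _ <-]//|_ ->]; exists 0%N.
apply: measurable_fun_sups => // m _; exists K => _ [n _ <-].
by rewrite /h; case: ifPn => [mK|_]; [exact: q_growth_le|exact: ltW].
Qed.

End constants.

(** * The decision process *)

Section compact_window.
Context {R : realType}.
Local Notation T2 := (measurableTypeR R * measurableTypeR R)%type.
Local Notation T := (measurableTypeR R * measurableTypeR R * measurableTypeR R)%type.

(** Embedding the plane at mark 0 reuses the countable family of three-dimensional boxes. *)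
Lemma measurable_open_plane (O : set (R * R)) : open O -> measurable (O : set T2).
Proof.
move=> oO.
have mU : measurable (\bigcup_(q in [set q | box q `<=` [set z | O z.1]]) box q : set T).
  rewrite bigcup_mkcond; apply: (countable_bigcupT_measurable countable_corners) => q.
  by case: ifP => // _; exact: measurable_box.
have mf : measurable_fun setT (fun x : T2 => (x, 0%R) : T) by exact: measurable_fun_pair.
have := measurable_preimage mf mU; congr (measurable _).
apply/seteqP; split => x /=; first by move=> [q qO qx]; exact: qO qx.
move=> Ox; have /nbhs_ballP[e e0 xe] := open_nbhs_nbhs (conj oO Ox).
have [q qx qe] := box_small (x, 0%R) e0.
by exists q => // z /qe[/= xz _]; exact: xe.
Qed.

Variable W : set (R * R).
Hypothesis cW : compact W.

Lemma measurable_compact_plane : measurable (W : set T2).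
Proof.
rewrite -(setCK W); apply: measurableC; apply: measurable_open_plane.
rewrite openC; apply: compact_closed => //.
Qed.

Lemma area_compact : area W \is a fin_num.
Proof.
have [M [Mreal MW]] := compact_bounded cW.
have sub : W `<=` `[(- (M + 1))%R, (M + 1)%R] `*` `[(- (M + 1))%R, (M + 1)%R].
  move=> x /(MW (M + 1)%R); rewrite ltrDl ltr01 => /(_ isT) /=.
  rewrite /Num.norm/= ge_max => /andP[x1 x2].
  by rewrite !in_itv/= -!ler_norml.
rewrite ge0_fin_numE//; apply: (@le_lt_trans _ _ (area (`[(- (M + 1))%R, (M + 1)%R] `*` `[(- (M + 1))%R, (M + 1)%R]))).
  apply: le_measure; rewrite ?inE//; first exact: measurable_compact_plane.
  by apply: measurableX; exact: measurable_itv.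
rewrite -[X in X < _]/((@lebesgue_measure R \x @lebesgue_measure R) _).
rewrite product_measure1E//.
have fin : @lebesgue_measure R `[(- (M + 1))%R, (M + 1)%R]%classic < +oo.
  by rewrite lebesgue_measure_itv/=; case: ifPn => _; rewrite ltry.
by apply: lte_mul_pinfty => //; rewrite ge0_fin_numE.
Qed.

End compact_window.

(** * Measurability of trajectories, actions and rewards *)

Section trajectories.
Context {R : realType}.
Variables (W : set (R * R)) (K : R).
Hypothesis mW : measurable (W : set (measurableTypeR R * measurableTypeR R)).

Local Notation T := (measurableTypeR R * measurableTypeR R * measurableTypeR R)%type.
Local Notation X := (pattern W K).
Local Notation traj := (trajectory W K).

Lemma measurable_pair_at i : measurable_fun setT (fun w : traj => w i : X * X).
Proof.
by move=> _ B mB; apply: sub_sigma_algebra; exists i => //; exists B.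
Qed.

Lemma measurable_trajectoryP d (S : measurableType d) (F : S -> traj) :
  (forall i, measurable_fun setT (fun s => F s i)) -> measurable_fun setT F.
Proof.
move=> mF; apply: (@measurability _ _ _ _ setT F
  (\bigcup_i preimage_set_system setT (fun w : nat -> X * X => w i) measurable)) => //.
move=> _ [_ [i _ [B mB <-]] <-]; rewrite !setTI.
by have := mF i measurableT B mB; rewrite setTI.
Qed.

Lemma measurable_state i : measurable_fun setT (state i : traj -> X).
Proof. exact: (measurableT_comp (@measurable_fst _ _ X X) (measurable_pair_at i)). Qed.

Lemma measurable_action i : measurable_fun setT (action i : traj -> X).
Proof. exact: (measurableT_comp (@measurable_snd _ _ X X) (measurable_pair_at i)). Qed.

Lemma measurable_past i : measurable_fun setT (past i : traj -> history W K i).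
Proof.
apply: measurable_fun_pair; last exact: measurable_state.
apply/measurable_fun_tnthP => j.
rewrite (_ : _ \o _ = (fun w : traj => w j)); first exact: measurable_pair_at.
by apply/funext => w; rewrite /= tnth_mktuple.
Qed.

(** A small box around a point of [a] contains no point of [x] other than that point itself.
    Inclusion thereby becomes a countable conjunction, for measurability and for almost sure
    statements. *)
Lemma sub_hit (a x : X) : (pts a `<=` pts x)%fset <-> forall q, hit q a -> hit q x.
Proof.
split=> [/fsubsetP ax q [z za qz]|ax]; first by exists z => //; exact: ax.
apply/fsubsetP => z za.
have [Q [Qz [_ sep]]] := box_family (z :: pts x) (@ltr01 R).
have [|z' z'x qz'] := ax (Q z); first by exists z.
have -> // : z = z'.
by apply: (sep _ _ z') => //; rewrite inE ?eqxx// z'x orbT.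
Qed.

Lemma measurable_actions (x : X) : measurable (actions x).
Proof.
rewrite (_ : actions x = ~` \bigcup_(q in [set q | ~ hit q x]) hit q).
  apply: measurableC; rewrite bigcup_mkcond.
  apply: (countable_bigcupT_measurable countable_corners) => q.
  by case: ifP => // _; exact: measurable_hit.
apply/seteqP; split => a /=; first by move=> /sub_hit ax [q nq /ax].
by move=> na; apply/sub_hit => q qa; apply: contrapT => nqx; apply: na; exists q.
Qed.

Lemma reward_ge0 (c : R) (x a : X) : (0 <= c)%R -> (0 <= reward c x a)%R.
Proof.
move=> c0; apply: mulr_ge0 => //; rewrite big_seq; apply: sumr_ge0 => z.
by rewrite inE => /andP[_ zx]; have [_ /(_ z zx)/andP[]] := pts_simple x.
Qed.

Lemma sum_sub (x a : X) (k : mpoint R -> R) : (pts a `<=` pts x)%fset ->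
  (\sum_(z <- pts x) k z = \sum_(z <- (pts x `\` pts a)%fset) k z + \sum_(z <- pts a) k z)%R.
Proof.
move=> ax; rewrite (big_fsetID _ (mem (pts a))) /= addrC; congr (_ + _)%R.
  apply: eq_fbigl => z; rewrite !inE/= andbC//.
by apply: eq_fbigl => z; rewrite !inE/=; apply/andP/idP => [[]//|za]; split => //; exact: fsubsetP ax z za.
Qed.

(** Along an enumeration of the state, the removed points are those absent from the enumeration of
    the action; this test is measurable because the diagonal is. *)
Lemma measurable_reward (c : R) :
  measurable_fun setT (fun p : X * X => reward c p.1 p.2).
Proof.
apply: measurable_funM => //.
have me := @measurable_enum_pattern R W K.
have me1 : measurable_fun setT (fun p : X * X => enum_pattern p.1).
  exact: (measurableT_comp me (@measurable_fst _ _ X X)).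
have me2 : measurable_fun setT (fun p : X * X => enum_pattern p.2).
  exact: (measurableT_comp me (@measurable_snd _ _ X X)).
apply: (measurable_by_size me1) => n.
apply: (eq_measurable_fun (fun p : X * X =>
  \sum_(i < n) if nth point (enum_pattern p.1 : seq T) i \in (enum_pattern p.2 : seq T) then 0
    else (nth point (enum_pattern p.1 : seq T) i).2)%R).
  move=> p /set_mem /= <-; have pe := perm_enum_pattern p.1.
  rewrite -(big_mkord predT (fun i => if nth point (enum_pattern p.1 : seq T) i \in (enum_pattern p.2 : seq T) then 0
    else (nth point (enum_pattern p.1 : seq T) i).2))%R.
  rewrite -(big_nth point predT (fun z : T => if z \in (enum_pattern p.2 : seq T) then 0 else z.2))%R.
  rewrite (perm_big _ pe)/=.
  transitivity (\sum_(z <- [seq z <- pts p.1 | z \notin pts p.2]) z.2)%R.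
    rewrite big_filter [RHS]big_mkcond; apply: eq_bigr => z _.
    by rewrite (perm_mem (perm_enum_pattern p.2)); case: ifP.
  apply: perm_big; apply: uniq_perm; rewrite ?filter_uniq ?fset_uniq// => z.
  by rewrite mem_filter inE.
apply: measurable_funTS; apply: measurable_sum => i.
have mn1 := measurableT_comp (measurable_nth (T := T) i) me1.
apply: measurable_fun_ifT => //; last exact: (measurableT_comp (@measurable_snd _ _ _ _) mn1).
apply: (@measurable_fun_bool _ _ _ _ true); rewrite setTI.
have mp : measurable_fun setT (fun p : X * X => (enum_pattern p.2, nth point (enum_pattern p.1 : seq T) i)).
  exact: measurable_fun_pair.
have := measurable_preimage mp (measurable_exists_seqs (measurable_eq_mpoint (R := R))).
congr (measurable _); apply/seteqP; split => p /=; first by move=> [z zp <-].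
by move=> ?; exists (nth point (enum_pattern p.1 : seq T) i).
Qed.

Lemma measurable_discounted_reward (c alpha : R) : (0 <= c)%R -> (0 <= alpha)%R ->
  measurable_fun setT (fun w : traj =>
    \sum_(0 <= i <oo) (alpha ^+ i * reward c (state i w) (action i w))%:E).
Proof.
move=> c0 a0; apply: ge0_emeasurable_sum => [i w _ _|i _].
  by rewrite lee_fin mulr_ge0 ?exprn_ge0// reward_ge0.
apply/measurable_EFinP; apply: measurable_funM => //.
exact: (measurableT_comp (measurable_reward c) (measurable_pair_at i)).
Qed.

End trajectories.

(** * The Bellman equation *)

Section bellman.
Context {R : realType}.
Variables (W : set (R * R)) (K c pd beta lambda alpha : R).
Hypothesis mW : measurable (W : set (measurableTypeR R * measurableTypeR R)).
Hypothesis W_fin : area W \is a fin_num.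
Hypotheses (K_gt0 : (0 < K)%R) (c_ge0 : (0 <= c)%R).
Hypotheses (lambda_gt0 : (0 < lambda)%R) (beta_ge0 : (0 <= beta)%R).
Hypotheses (pd_ge0 : (0 <= pd)%R) (pd_le1 : (pd <= 1)%R).
Hypotheses (alpha_ge0 : (0 <= alpha)%R) (alpha_lt1 : (alpha < 1)%R).
Variable nu : probability (measurableTypeR R) R.
Hypothesis nuK : nu `[0%R, K]%classic = 1.

Local Notation T := (measurableTypeR R * measurableTypeR R * measurableTypeR R)%type.
Local Notation X := (pattern W K).
Local Notation N := (next (K := K) lambda mW beta_ge0 pd_ge0 pd_le1 nu).
Local Notation k := (capped_mark K pd lambda alpha).
Local Notation g := (growth K lambda 1).
Local Notation b := (beta * fine (area W))%R.
Local Notation mean_mark := (fine (\int[nu]_m (k m)%:E)).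

Let alpha_le1 : (alpha <= 1)%R. Proof. exact: ltW. Qed.

Let k_itv m : (0 <= k m <= K)%R.
Proof. exact: capped_mark_itv. Qed.

Let k_ge0 m : (0 <= k m)%R. Proof. by have /andP[] := k_itv m. Qed.

Let mk : measurable_fun setT (k : measurableTypeR R -> R).
Proof. exact: measurable_capped_mark. Qed.

Lemma mean_mark_fin : \int[nu]_m (k m)%:E \is a fin_num.
Proof.
rewrite ge0_fin_numE; last by apply: integral_ge0 => m _; rewrite lee_fin.
apply: (@le_lt_trans _ _ (\int[nu]_(m in setT) K%:E)).
  apply: ge0_le_integral => //; first by move=> m _; rewrite lee_fin.
  - exact/measurable_EFinP.
  - by move=> m _; rewrite lee_fin; have /andP[] := k_itv m.
by rewrite (integral_cst1 _ (probability_setT nu)) ltry.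
Qed.

Let mean_mark_ge0 : (0 <= mean_mark)%R.
Proof. by apply: fine_ge0; apply: integral_ge0 => m _; rewrite lee_fin. Qed.

Let b_ge0 : (0 <= b)%R. Proof. by rewrite mulr_ge0// fine_ge0. Qed.

(** The solution C of C = alpha (C + c b [mean_mark]): the births of the next step enter with one
    discount, followed by the same problem again. *)
Definition newborn_value : R := (c * b * (alpha / (1 - alpha)) * mean_mark)%R.

Definition best_value (y : X) : R := (newborn_value + c * \sum_(z <- pts y) k z.2)%R.

Lemma newborn_value_ge0 : (0 <= newborn_value)%R.
Proof.
apply: mulr_ge0 => //; apply: mulr_ge0; first exact: mulr_ge0.
by rewrite divr_ge0// subr_ge0.
Qed.

Lemma best_value_ge0 y : (0 <= best_value y)%R.
Proof. by rewrite addr_ge0 ?newborn_value_ge0// mulr_ge0// sumr_ge0. Qed.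

Lemma measurable_best_value : measurable_fun setT best_value.
Proof.
apply: measurable_funD => //; apply: measurable_funM => //.
apply: (measurable_pattern_sum (h := fun z : T => k z.2)).
exact: (measurableT_comp mk (@measurable_snd _ _ _ _)).
Qed.

(** A bound affine in the number of points, so that a bound on the expected number of points
    controls the discounted remainder. *)
Lemma best_value_card y :
  (best_value y <= newborn_value + c * K * \sum_(z <- pts y) 1)%R.
Proof.
rewrite lerD2l -mulrA ler_wpM2l// mulr_sumr.
by apply: ler_sum => z _; rewrite mulr1; have /andP[] := k_itv z.2.
Qed.

(** The mean contribution of the newborns and the discounted constant recombine into
    [newborn_value], by the equation that defines it. *)
Lemma int_next_value a : alpha%:E * \int[N a]_y (best_value y)%:E =
  (newborn_value + c * \sum_(z <- pts a) (alpha * (1 - pd) * k (g z.2)))%R%:E.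
Proof.
have mS : measurable_fun setT (fun y : X => (\sum_(z <- pts y) k z.2)%R%:E).
  apply/measurable_EFinP; apply: (measurable_pattern_sum (h := fun z : T => k z.2)).
  exact: (measurableT_comp mk (@measurable_snd _ _ _ _)).
transitivity (alpha%:E * \int[N a]_y (newborn_value%:E + c%:E * (\sum_(z <- pts y) k z.2)%R%:E)).
  by congr (_ * _); apply: eq_integral => y _; rewrite -EFinM -EFinD.
rewrite ge0_integralD//; last 3 first.
- by move=> y _; rewrite lee_fin newborn_value_ge0.
- by move=> y _; rewrite -EFinM lee_fin mulr_ge0// sumr_ge0.
- exact: measurable_funeM.
rewrite (integral_cst1 _ (next1 _ _ _ _ _ _ a)).
rewrite ge0_integralZl//; last by move=> y _; rewrite lee_fin sumr_ge0.
rewrite (next_mean mW W_fin K_gt0 (ltW lambda_gt0) beta_ge0 pd_ge0 pd_le1 nuK a mk k_ge0 mean_mark_fin).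
rewrite -(fineK mean_mark_fin) -!(EFinM, EFinD); congr EFin.
have a1 : (1 - alpha != 0)%R by rewrite subr_eq0 gt_eqF.
rewrite -mulr_sumr /newborn_value; move: (\sum_(z <- _) _)%R mean_mark (fine _) => S m A.
by field.
Qed.

(** The inequality holds point by point: a removed mark satisfies m <= s(m), a retained one q
    s(g(m)) <= s(m). *)
Lemma bellman_le (x a : X) : (pts a `<=` pts x)%fset ->
  (reward c x a)%:E + alpha%:E * \int[N a]_y (best_value y)%:E <= (best_value x)%:E.
Proof.
move=> ax; rewrite int_next_value -EFinD lee_fin /best_value addrCA lerD2l /reward -mulrDr.
rewrite ler_wpM2l// (sum_sub _ ax).
have [_ xK _] := pts_simple x.
apply: lerD; rewrite !big_seq; apply: ler_sum => z.
  by rewrite inE => /andP[_ /xK zK]; rewrite capped_markE// best_mark_ge_id.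
move=> /(fsubsetP ax) /xK zK; have gK := growth_itv 1 K_gt0 (ltW lambda_gt0) zK.
by rewrite !capped_markE// best_mark_growth.
Qed.

Lemma pts_french (d : R) (x : X) :
  pts (french_thinning d x) = [fset z in pts x | (z.2 < d)%R]%fset.
Proof. by rewrite /french_thinning to_patternK//; exact: simple_french. Qed.

Lemma french_sub (d : R) (x : X) : (pts (french_thinning d x) `<=` pts x)%fset.
Proof. by rewrite pts_french; apply/fsubsetP => z; rewrite !inE => /andP[]. Qed.

Lemma bellman_eq (x : X) : let a := french_thinning (threshold K pd lambda alpha) x in
  (reward c x a)%:E + alpha%:E * \int[N a]_y (best_value y)%:E = (best_value x)%:E.
Proof.
move=> a; have ax : (pts a `<=` pts x)%fset by exact: french_sub.
rewrite int_next_value -EFinD /best_value addrCA /reward -mulrDr (sum_sub _ ax).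
have [_ xK _] := pts_simple x.
congr ((_ + _ * (_ + _))%R%:E); rewrite [LHS]big_seq [RHS]big_seq; apply: eq_bigr => z.
  rewrite inE pts_french !inE => /andP[+ zx]; rewrite zx /= -leNgt => dz.
  have zK := xK _ zx.
  by rewrite capped_markE// (best_mark_above K_gt0 lambda_gt0 pd_ge0 pd_le1).
rewrite pts_french !inE => /andP[/xK zK zd]; have gK := growth_itv 1 K_gt0 (ltW lambda_gt0) zK.
by rewrite !capped_markE// [RHS]best_mark_below.
Qed.

End bellman.

(** * Values under an arbitrary trajectory law *)

Section law.
Context {R : realType}.
Variables (W : set (R * R)) (K c pd beta lambda alpha : R).
Hypothesis mW : measurable (W : set (measurableTypeR R * measurableTypeR R)).
Hypothesis W_fin : area W \is a fin_num.
Hypotheses (K_gt0 : (0 < K)%R) (c_ge0 : (0 <= c)%R).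
Hypotheses (lambda_gt0 : (0 < lambda)%R) (beta_ge0 : (0 <= beta)%R).
Hypotheses (pd_ge0 : (0 <= pd)%R) (pd_le1 : (pd <= 1)%R).
Hypotheses (alpha_ge0 : (0 <= alpha)%R) (alpha_lt1 : (alpha < 1)%R).
Variable nu : probability (measurableTypeR R) R.
Hypothesis nuK : nu `[0%R, K]%classic = 1.

Local Notation X := (pattern W K).
Local Notation traj := (trajectory W K).
Local Notation N := (next (K := K) lambda mW beta_ge0 pd_ge0 pd_le1 nu).

Variables (phi : policy W K) (x : X) (P : probability traj R).
Hypothesis PE : trajectory_law pd beta lambda nu phi x P.

Lemma int_state0 (F : X -> \bar R) : measurable_fun setT F -> (forall y, 0 <= F y) ->
  \int[P]_w F (state 0 w) = F x.
Proof.
move=> mF F0; have [P0 _ _] := PE.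
rewrite -(giry_int_ret x mF).
rewrite -[LHS](giry_int_map (measurable_state 0) (P : giry traj R) mF F0).
by apply: eq_set_integral => B mB; exact: P0.
Qed.

(** The transition clause, with the whole space as conditioning event, identifies the law of the
    next state with the mixture of the kernels [N (action i w)]. *)
Lemma int_stateS i (F : X -> \bar R) : measurable_fun setT F -> (forall y, 0 <= F y) ->
  \int[P]_w F (state i.+1 w) = \int[P]_w \int[N (action i w)]_y F y.
Proof.
move=> mF F0; have [_ _ P3] := PE.
have mN : measurable_fun setT (fun w : traj => N (action i w)).
  have mn := measurable_next lambda mW beta_ge0 pd_ge0 pd_le1 nu (K := K).
  exact: (measurableT_comp mn (@measurable_action R W K i)).
rewrite -[RHS](giry_int_bind (P : giry traj R) mN mF F0).
rewrite -[LHS](giry_int_map (measurable_state i.+1) (P : giry traj R) mF F0).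
apply: eq_set_integral => B mB.
transitivity (\int[P]_w N (action i w) B).
  have dT : [set w : traj | (setT : set (history W K i * X)) (past i w, action i w)] = setT.
    by apply/seteqP; split.
  have := P3 i setT B measurableT mB; rewrite dT.
  rewrite (_ : [set w | _] = state i.+1 @^-1` B); last by apply/seteqP; split => w /=; tauto.
  move=> P3B; apply: (etrans P3B).
  by apply: eq_integral => w _; exact: next_lawE.
rewrite -[RHS](int_dirac _ mB) -[RHS]/(giry_int _ _) giry_int_bind//; last exact: measurable_fun_dirac.
by apply: eq_integral => w _; rewrite -[RHS]/(\int[_]__ _) int_dirac.
Qed.

Lemma ae_decision i (D : set (history W K i)) (B : set X) :
  measurable D -> measurable B -> (forall h, D h -> decision phi i h B = 0) ->
  {ae P, forall w, D (past i w) -> ~ B (action i w)}.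
Proof.
move=> mD mB DB; have [_ P2 _] := PE.
exists [set w | D (past i w) /\ B (action i w)]; split.
- apply: measurableI.
    exact: measurable_preimage (@measurable_past R W K i) mD.
  exact: measurable_preimage (@measurable_action R W K i) mB.
- by rewrite P2//; apply: integral0_eq => w Dw; exact: DB.
- by move=> w /= /not_implyP[? /contrapT].
Qed.

Lemma ae_forall_corners (Q : corners -> traj -> Prop) :
  (forall q, {ae P, forall w, Q q w}) -> {ae P, forall w q, Q q w}.
Proof.
move=> HQ.
have : {ae P, forall w n, if choice.unpickle n is Some q then Q q w else True}.
  apply: ae_foralln => n; case: choice.unpickle => [q|]; first exact: HQ.
  exact: aeW.
by apply: filterS => w Hw q; have := Hw (choice.pickle q); rewrite choice.pickleK.
Qed.

Let measurable_history_hit i (f : X -> X) q : measurable_fun setT f ->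
  measurable [set h : history W K i | hit q (f h.2)].
Proof.
move=> mf; have mh : measurable (f @^-1` hit q) := measurable_preimage mf (measurable_hit q).
exact: measurable_preimage (@measurable_snd _ _ (i.-tuple (X * X)) X) mh.
Qed.

(** For each box, a state that misses it has almost surely an action that misses it, because the
    decision charges only subsets of the state; countably many boxes then decide the inclusion. *)
Lemma ae_actions i : {ae P, forall w, (pts (action i w) `<=` pts (state i w))%fset}.
Proof.
have : {ae P, forall w q, ~ hit q (state i w) -> ~ hit q (action i w)}.
  apply: ae_forall_corners => q.
  apply: (@ae_decision i [set h | ~ hit q h.2]); [|exact: measurable_hit|].
    by apply: measurableC; apply: (measurable_history_hit (f := id)).
  move=> h nq.
  have := full_setC (measurable_actions h.2) (prob_kernel (s := decision phi i) h) (decision_actions phi h).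
  apply: subset_measure0 => //; first exact: measurable_hit.
    by apply: measurableC; exact: measurable_actions.
  by move=> a qa /sub_hit /(_ _ qa).
apply: filterS => w Hw; apply/sub_hit => q; have := Hw q.
by move=> Hq qa; apply: contrapT => /Hq.
Qed.

(** Equality of patterns is split into two inclusions, each tested on the countably many boxes. *)
Lemma ae_deterministic i (f : X -> X) : measurable_fun setT f ->
  stationary_deterministic phi f -> {ae P, forall w, action i w = f (state i w)}.
Proof.
move=> mf phif.
have mh q : measurable [set h : history W K i | hit q (f h.2)] := @measurable_history_hit i f q mf.
have : {ae P, forall w q, ~ hit q (f (state i w)) -> ~ hit q (action i w)}.
  apply: ae_forall_corners => q.
  apply: (@ae_decision i [set h | ~ hit q (f h.2)]); [|exact: measurable_hit|].
    by apply: measurableC; exact: mh.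
  move=> h nq; rewrite phif; last exact: measurable_hit.
  by rewrite diracE memNset.
(* The double negation comes from applying [ae_decision] to the complement of [hit q]. *)
have : {ae P, forall w q, hit q (f (state i w)) -> ~ ~ hit q (action i w)}.
  apply: ae_forall_corners => q.
  apply: (@ae_decision i [set h | hit q (f h.2)] (~` hit q)); [exact: mh|apply: measurableC; exact: measurable_hit|].
  move=> h qh; rewrite phif; last by apply: measurableC; exact: measurable_hit.
  by rewrite diracE memNset//; exact.
apply: filterS2 => w H1 H2; apply: pts_inj; apply/eqP; rewrite eqEfsubset.
apply/andP; split; apply/sub_hit => q.
  by move=> qa; apply: contrapT => /H2.
by move=> /H1/contrapT.
Qed.

Local Notation V := (best_value c pd beta lambda alpha nu).

Definition expected_value i : \bar R := \int[P]_w (V (state i w))%:E.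

Definition expected_reward i : \bar R := \int[P]_w (reward c (state i w) (action i w))%:E.

Let V_ge0 (y : X) : (0 <= V y)%R. Proof. exact: best_value_ge0. Qed.

Let mV : measurable_fun setT (fun y : X => (V y)%:E).
Proof. by apply/measurable_EFinP; exact: measurable_best_value. Qed.

Let mN i : measurable_fun setT (fun w : traj => N (action i w)).
Proof.
have mn := measurable_next lambda mW beta_ge0 pd_ge0 pd_le1 nu (K := K).
exact: (measurableT_comp mn (@measurable_action R W K i)).
Qed.

Let int_value_ge0 a : 0 <= \int[N a]_y (V y)%:E.
Proof. by apply: integral_ge0 => y _; rewrite lee_fin. Qed.

Lemma measurable_reward_at i :
  measurable_fun setT (fun w : traj => (reward c (state i w) (action i w))%:E).
Proof.
apply/measurable_EFinP.
exact: (measurableT_comp (measurable_reward c) (@measurable_pair_at R W K i)).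
Qed.

Let reward_at_ge0 i (w : traj) : 0 <= (reward c (state i w) (action i w))%:E.
Proof. by rewrite lee_fin reward_ge0. Qed.

Lemma expected_stepE i : expected_reward i + alpha%:E * expected_value i.+1 =
  \int[P]_w ((reward c (state i w) (action i w))%:E +
    alpha%:E * \int[N (action i w)]_y (V y)%:E).
Proof.
have mI : measurable_fun setT (fun w : traj => \int[N (action i w)]_y (V y)%:E).
  have mg := @measurable_giry_int _ X R (fun y => (V y)%:E) mV (fun=> V_ge0 _).
  exact: (measurableT_comp mg (@mN i)).
rewrite /expected_value (int_stateS i mV)//.
rewrite -ge0_integralZl//.
rewrite -ge0_integralD//.
- exact: measurable_reward_at.
- by move=> w _; rewrite mule_ge0.
- exact: measurable_funeM.
Qed.

Let measurable_step_at i : measurable_fun setT (fun w : traj =>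
  (reward c (state i w) (action i w))%:E + alpha%:E * \int[N (action i w)]_y (V y)%:E).
Proof.
apply: emeasurable_funD; first exact: measurable_reward_at.
apply: measurable_funeM.
have mg := @measurable_giry_int _ X R (fun y => (V y)%:E) mV (fun=> V_ge0 _).
exact: (measurableT_comp mg (@mN i)).
Qed.

Let step_ge0 i (w : traj) :
  0 <= (reward c (state i w) (action i w))%:E + alpha%:E * \int[N (action i w)]_y (V y)%:E.
Proof. by rewrite adde_ge0// mule_ge0. Qed.

Let measurable_value_at i : measurable_fun setT (fun w : traj => (V (state i w))%:E).
Proof. exact: (measurableT_comp mV (@measurable_state R W K i)). Qed.

Lemma expected_step_le i :
  expected_reward i + alpha%:E * expected_value i.+1 <= expected_value i.
Proof.
rewrite expected_stepE; apply: ae_ge0_le_integral => //.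
  by move=> w _; rewrite lee_fin.
by apply: filterS (ae_actions i) => w aw _; exact: bellman_le.
Qed.

Lemma expected_step_eq i :
  stationary_deterministic phi (french_thinning (threshold K pd lambda alpha)) ->
  expected_reward i + alpha%:E * expected_value i.+1 = expected_value i.
Proof.
move=> phif; rewrite expected_stepE; apply: ge0_ae_eq_integral => //.
  by move=> w _; rewrite lee_fin.
have := ae_deterministic i (measurable_french (threshold K pd lambda alpha)) phif.
by apply: filterS => w aw _; rewrite aw; exact: bellman_eq.
Qed.

Lemma expected_value0 : expected_value 0 = (V x)%:E.
Proof. by rewrite /expected_value (int_state0 mV). Qed.

Let expected_reward_ge0 i : 0 <= expected_reward i.
Proof. by apply: integral_ge0. Qed.

Let expected_value_ge0 i : 0 <= expected_value i.
Proof. by apply: integral_ge0 => w _; rewrite lee_fin. Qed.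

Let powM n : (alpha ^+ n.+1)%:E = (alpha ^+ n)%:E * alpha%:E.
Proof. by rewrite exprSr EFinM. Qed.

Lemma partial_value_le n :
  \sum_(i < n) (alpha ^+ i)%:E * expected_reward i + (alpha ^+ n)%:E * expected_value n <= (V x)%:E.
Proof.
elim: n => [|n IH]; first by rewrite big_ord0 add0e mul1e expected_value0.
apply: le_trans IH; rewrite big_ord_recr/= -addeA leeD2l//.
rewrite powM -muleA -ge0_muleDr ?mule_ge0//.
by rewrite lee_wpmul2l ?lee_fin ?exprn_ge0// expected_step_le.
Qed.

Lemma partial_value_eq n :
  stationary_deterministic phi (french_thinning (threshold K pd lambda alpha)) ->
  \sum_(i < n) (alpha ^+ i)%:E * expected_reward i + (alpha ^+ n)%:E * expected_value n = (V x)%:E.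
Proof.
move=> phif; elim: n => [|n <-]; first by rewrite big_ord0 add0e mul1e expected_value0.
rewrite big_ord_recr/= -addeA powM -muleA -ge0_muleDr ?mule_ge0//.
by rewrite expected_step_eq.
Qed.

Lemma discounted_valueE :
  \int[P]_w \sum_(0 <= i <oo) (alpha ^+ i * reward (c) (state i w) (action i w))%:E =
  \sum_(0 <= i <oo) (alpha ^+ i)%:E * expected_reward i.
Proof.
rewrite integral_nneseries//.
- apply: eq_eseriesr => i _; rewrite /expected_reward -ge0_integralZl ?lee_fin ?exprn_ge0//.
  exact: measurable_reward_at.
- move=> i; apply/measurable_EFinP; apply: measurable_funM => //.
  by apply/measurable_EFinP; exact: measurable_reward_at.
- by move=> i w _; rewrite lee_fin mulr_ge0 ?exprn_ge0// reward_ge0.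
Qed.

Lemma discounted_value_le :
  \int[P]_w \sum_(0 <= i <oo) (alpha ^+ i * reward (c) (state i w) (action i w))%:E <= (V x)%:E.
Proof.
rewrite discounted_valueE; apply: lime_le.
  by apply: is_cvg_nneseries => n _ _; rewrite mule_ge0 ?lee_fin ?exprn_ge0.
apply: nearW => n; apply: le_trans (partial_value_le n).
by rewrite big_mkord leeDl// mule_ge0 ?lee_fin ?exprn_ge0.
Qed.

Local Notation M := (\sum_(z <- pts x) 1 + beta * fine (area W) / pd)%R.

(** The expected number of points obeys y' <= (1 - pd) y + b with b = beta |W|, whose fixed point is
    b / pd; adding the initial number of points gives a bound that also holds at time 0. *)
Lemma expected_card_le i : (0 < pd)%R ->
  \int[P]_w (\sum_(z <- pts (state i w)) 1)%R%:E <= M%:E.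
Proof.
move=> pd_gt0; have b0 : (0 <= beta * fine (area W))%R by rewrite mulr_ge0// fine_ge0.
have mcard : measurable_fun setT (fun y : X => (\sum_(z <- pts y) 1)%R%:E : \bar R).
  by apply/measurable_EFinP; exact: (measurable_pattern_sum (h := fun=> 1%R)).
have card0 (y : X) : 0 <= (\sum_(z <- pts y) 1)%R%:E :> \bar R by rewrite lee_fin sumr_ge0.
elim: i => [|i IH].
  by rewrite (int_state0 mcard card0) lee_fin lerDl divr_ge0.
have nu1 : \int[nu]_(m in setT) (1%R)%:E = 1 by exact: integral_cst1 (probability_setT nu).
have E a : \int[N a]_y (\sum_(z <- pts y) 1)%R%:E =
    ((1 - pd) * \sum_(z <- pts a) 1 + beta * fine (area W))%R%:E.
  rewrite (@next_mean _ _ _ _ _ _ mW W_fin K_gt0 (ltW lambda_gt0) beta_ge0 pd_ge0 pd_le1 nu nuK a (fun=> 1%R))//.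
    by rewrite nu1 mule1 -EFinD.
  by rewrite nu1.
rewrite (int_stateS i mcard card0).
under eq_integral do rewrite E.
apply: (@le_trans _ _ (\int[P]_w ((1 - pd)%:E * (\sum_(z <- pts (state i w)) 1)%R%:E + (beta * fine (area W))%R%:E))).
  apply: ae_ge0_le_integral => //.
  - by move=> w _; rewrite lee_fin addr_ge0// mulr_ge0 ?subr_ge0 ?sumr_ge0.
  - apply/measurable_EFinP; apply: measurable_funD => //; apply: measurable_funM => //.
    have mc : measurable_fun setT (fun y : X => (\sum_(z <- pts y) 1)%R : R).
      exact: (measurable_pattern_sum (h := fun=> 1%R)).
    exact: (measurableT_comp mc (@measurable_action R W K i)).
  - by move=> w _; rewrite -EFinM -EFinD lee_fin addr_ge0// mulr_ge0 ?subr_ge0 ?sumr_ge0.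
  - apply: emeasurable_funD => //; apply: measurable_funeM.
    exact: (measurableT_comp mcard (@measurable_state R W K i)).
  (* The kernel counts retained points, and almost surely these are at most the points of the
     state. *)
  apply: filterS (ae_actions i) => w aw _.
  rewrite -EFinM -EFinD lee_fin lerD2r ler_wpM2l ?subr_ge0//.
  by rewrite (sum_sub _ aw) lerDr sumr_ge0.
have mcs : measurable_fun setT (fun w : traj => (\sum_(z <- pts (state i w)) 1)%R%:E : \bar R).
  exact: (measurableT_comp mcard (@measurable_state R W K i)).
rewrite ge0_integralD//; last 2 first.
- by move=> w _; rewrite mule_ge0// lee_fin subr_ge0.
- exact: measurable_funeM.
rewrite ge0_integralZl// ?lee_fin ?subr_ge0// (integral_cst1 _ (probability_setT P)).
apply: (@le_trans _ _ ((1 - pd)%:E * M%:E + (beta * fine (area W))%R%:E)).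
  by rewrite leeD2r// lee_wpmul2l// lee_fin subr_ge0.
have : (0 <= \sum_(z <- pts x) 1 :> R)%R by exact: sumr_ge0.
rewrite -EFinM -EFinD lee_fin; move: (\sum_(z <- _) _)%R => S S0.
have -> : ((1 - pd) * (S + beta * fine (area W) / pd) + beta * fine (area W) =
  S + beta * fine (area W) / pd - pd * S)%R by field; rewrite gt_eqF.
by rewrite gerBl mulr_ge0.
Qed.

Lemma discounted_value_ge : (0 < pd)%R ->
  stationary_deterministic phi (french_thinning (threshold K pd lambda alpha)) ->
  (V x)%:E <= \int[P]_w \sum_(0 <= i <oo) (alpha ^+ i * reward (c) (state i w) (action i w))%:E.
Proof.
move=> pd_gt0 phif; rewrite discounted_valueE.
(* [B] combines the affine bound [best_value_card] with the uniform bound [M] on the expected number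
   of points, so that the remainder at time n is at most alpha^n B. *)
pose B := (newborn_value W K c pd beta lambda alpha nu + c * K * M)%R.
have nv0 : (0 <= newborn_value W K c pd beta lambda alpha nu)%R by exact: newborn_value_ge0.
have cK0 : (0 <= c * K)%R by rewrite mulr_ge0// ltW.
have EB n : expected_value n <= B%:E.
  have mcard : measurable_fun setT (fun y : X => (\sum_(z <- pts y) 1)%R%:E : \bar R).
    by apply/measurable_EFinP; exact: (measurable_pattern_sum (h := fun=> 1%R)).
  have mcs : measurable_fun setT (fun w : traj => (\sum_(z <- pts (state n w)) 1)%R%:E : \bar R).
    exact: (measurableT_comp mcard (@measurable_state R W K n)).
  have card0 (w : traj) : 0 <= (\sum_(z <- pts (state n w)) 1)%R%:E :> \bar R.
    by rewrite lee_fin sumr_ge0.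
  apply: (@le_trans _ _ (\int[P]_w ((newborn_value W K c pd beta lambda alpha nu)%:E +
      (c * K)%:E * (\sum_(z <- pts (state n w)) 1)%R%:E))).
    apply: ge0_le_integral => //.
    - by move=> w _; rewrite lee_fin.
    - by apply: emeasurable_funD => //; exact: measurable_funeM.
    - by move=> w _; rewrite -EFinM -EFinD lee_fin best_value_card.
  rewrite ge0_integralD//; last 2 first.
  - by move=> w _; rewrite mule_ge0.
  - exact: measurable_funeM.
  rewrite ge0_integralZl// (integral_cst1 _ (probability_setT P)) EFinD leeD2l// (EFinM (c * K)).
  by rewrite lee_wpmul2l// expected_card_le.
have B0 : (0 <= B)%R by have := le_trans (expected_value_ge0 0) (EB 0%N); rewrite lee_fin.
have H n : (V x)%:E <= \sum_(0 <= i <oo) (alpha ^+ i)%:E * expected_reward i + (alpha ^+ n * B)%:E.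
  rewrite -(partial_value_eq n phif); apply: leeD.
    rewrite -(big_mkord predT (fun i => (alpha ^+ i)%:E * expected_reward i)).
    by apply: nneseries_lim_ge => i _; rewrite mule_ge0 ?lee_fin ?exprn_ge0.
  by rewrite EFinM lee_wpmul2l ?lee_fin ?exprn_ge0.
apply/lee_addgt0Pr => e e0.
have alpha_norm_lt1 : (`|alpha| < 1)%R by rewrite ger0_norm.
have /cvgrPdist_le/(_ _ e0)[n _ /(_ n (leqnn n))] := cvg_geometric B alpha_norm_lt1.
rewrite sub0r normrN /geometric/= ger0_norm ?mulr_ge0 ?exprn_ge0// => Be.
by apply: le_trans (H n) _; rewrite leeD2l// lee_fin mulrC.
Qed.

End law.

(** * The French thinning policy and its trajectory law *)

Section french_policy.
Context {R : realType}.
Variables (W : set (R * R)) (K d : R).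

Local Notation X := (pattern W K).

Let measurable_french_at i :
  measurable_fun setT (fun h : history W K i => french_thinning d h.2 : X).
Proof.
exact: (measurableT_comp (measurable_french d) (@measurable_snd _ _ (i.-tuple (X * X)) X)).
Qed.

Let french_decision i : R.-pker (history W K i) ~> X := kdirac (@measurable_french_at i).

Let french_decision_actions i (h : history W K i) : french_decision i h (actions h.2) = 1.
Proof.
by rewrite /french_decision/= /kdirac/= diracE mem_set// /actions/=; exact: french_sub.
Qed.

Definition french_policy : policy W K := Policy french_decision_actions.

Lemma french_policyE : stationary_deterministic french_policy (french_thinning d).
Proof. by []. Qed.

Variables (pd beta lambda : R).
Hypothesis mW : measurable (W : set (measurableTypeR R * measurableTypeR R)).
Hypothesis W_fin : area W \is a fin_num.
Hypothesis beta_ge0 : (0 <= beta)%R.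
Hypotheses (pd_ge0 : (0 <= pd)%R) (pd_le1 : (pd <= 1)%R).
Variable nu : probability (measurableTypeR R) R.
Hypothesis nuK : nu `[0%R, K]%classic = 1.

Local Notation N := (next (K := K) lambda mW beta_ge0 pd_ge0 pd_le1 nu).
Local Notation f := (french_thinning d : X -> X).

Let measurable_step : measurable_fun setT (fun y : X => N (f y)).
Proof.
exact: (measurableT_comp (measurable_next lambda mW beta_ge0 pd_ge0 pd_le1 nu) (measurable_french d)).
Qed.

Let step1 (y : X) : N (f y) setT = 1. Proof. exact: next1. Qed.

(** The states alone form a homogeneous Markov chain with kernel [N (f y)]; inserting the actions
    [f (w i)] gives the trajectory. *)
Let run (w : paths X) : trajectory W K := fun i => (w i, f (w i)).

Let measurable_run : measurable_fun setT run.
Proof.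
apply: measurable_trajectoryP => i; apply: measurable_fun_pair; first exact: measurable_coord.
exact: (measurableT_comp (measurable_french d) (@measurable_coord _ X i)).
Qed.

Lemma french_trajectory_law x :
  exists P, trajectory_law pd beta lambda nu french_policy x P.
Proof.
pose run_m : {mfun paths X >-> trajectory W K} := mfun_Sub (mem_set measurable_run).
pose mu : probability (paths X) R := markov_law measurable_step step1 x.
pose P : probability (trajectory W K) R := distribution mu run_m.
have PE S : P S = mu (run @^-1` S) by [].
have int_P S (F : trajectory W K -> \bar R) : measurable S -> measurable_fun setT F ->
    (forall w, 0 <= F w) -> \int[P]_(w in S) F w = \int[mu]_(w in run @^-1` S) F (run w).
  move=> mS mF F0; apply: (ge0_integral_pushforward measurable_run mu mS) => //.
  exact: measurable_funTS.
exists P; split.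
- by move=> B mB; exact: (markov_law_init measurable_step step1 x mB).
- move=> i D B mD mB.
  have mS := measurable_preimage (@measurable_past R W K i) mD.
  have mfi : measurable_fun setT (fun w : trajectory W K => f (state i w)).
    exact: (measurableT_comp (measurable_french d) (@measurable_state R W K i)).
  (* The decision is a Dirac mass at [f (state i w)], so integrating it over the event gives the
     probability that the past lies in [D] and [f] of the state in [B]; along [run] this is the
     action. *)
  rewrite (_ : \int[P]_(w in _) _ = \int[P]_(w in past i @^-1` D) (\1_((fun w => f (state i w)) @^-1` B) w)%:E); last first.
    by apply: eq_integral => w _.
  rewrite integral_indic//; last exact: measurable_preimage mfi mB.
  by rewrite !PE; congr (mu _); apply/seteqP; split => w /= -[].
- move=> i D B mD mB.
  have mpa : measurable_fun setT (fun w : trajectory W K => (past i w, action i w)).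
    by apply: measurable_fun_pair; [exact: measurable_past|exact: measurable_action].
  have mS := measurable_preimage mpa mD.
  pose G : set (paths X) := run @^-1` ((fun w => (past i w, action i w)) @^-1` D).
  have mG : measurable G := measurable_preimage measurable_run mS.
  (* The past and the action at time i involve the states up to time i only, the action being a
     function of the present state. *)
  have cG : cylinder i G.
    rewrite /cylinder; apply: (congr1 (fun h => h @^-1` D)); apply/funext => w /=.
    have e j : (j <= i)%N -> run (freeze i w) j = run w j.
      by move=> ji; rewrite /run /freeze (minn_idPl ji).
    rewrite /past /state /action e//; congr ((_, _), _).
    by apply: eq_from_tnth => j; rewrite !tnth_mktuple e// ltnW.
  transitivity (\int[P]_(w in (fun w => (past i w, action i w)) @^-1` D) N (action i w) B); last first.
    by apply: eq_integral => w _; rewrite next_lawE.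
  rewrite int_P//.
    exact: (markov_law_step measurable_step step1 x mG cG mB).
  have mn := measurable_next lambda mW beta_ge0 pd_ge0 pd_le1 nu (K := K).
  have mna : measurable_fun setT (fun w : trajectory W K => N (action i w)).
    exact: (measurableT_comp mn (@measurable_action R W K i)).
  exact: (measurableT_comp (measurable_giry_ev mB) mna).
Qed.

End french_policy.

(** * The closed formula and its attainment *)

Lemma sum_powers (R : realType) (alpha : R) : (0 <= alpha)%R -> (alpha < 1)%R ->
  \sum_(1 <= k <oo) (alpha ^+ k)%:E = (alpha / (1 - alpha))%:E.
Proof.
move=> a0 a1; have an : (`|alpha| < 1)%R by rewrite ger0_norm.
have an0 k : 0 <= (alpha ^+ k)%:E by rewrite lee_fin exprn_ge0.
rewrite -(nneseries_addn 1 an0).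
apply/cvg_lim => //.
rewrite (_ : (fun n => _) = EFin \o series (geometric alpha alpha)).
  by apply: cvg_EFin; [exact: nearW|exact: cvg_geometric_series].
apply/funext => n; rewrite /= /series/= -sumEFin; apply: eq_bigr => i _.
by rewrite addn1 exprS.
Qed.

Theorem theorem1 (R : realType) (W : set (R * R))
    (K c pd beta lambda alpha : R) (nu : probability (measurableTypeR R) R)
    (W_compact : compact W) (K_gt0 : (0 < K)%R) (c_gt0 : (0 < c)%R)
    (pd_gt0 : (0 < pd)%R) (pd_lt1 : (pd < 1)%R)
    (beta_gt0 : (0 < beta)%R) (lambda_gt0 : (0 < lambda)%R)
    (nu_marks : nu `[0%R, K]%classic = 1)
    (alpha_ge0 : (0 <= alpha)%R) (alpha_lt1 : (alpha < 1)%R) :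
  (forall x : pattern W K,
    optimal_value pd beta lambda nu c alpha x =
      c%:E * beta%:E * area W * (\sum_(1 <= k <oo) (alpha ^+ k)%:E) *
        (\int[nu]_(m in `[0%R, K]) (best_mark K pd lambda alpha m)%:E) +
      (c * \sum_(z <- pts x) best_mark K pd lambda alpha z.2)%:E) /\
  (exists phi : policy W K,
    stationary_deterministic phi
      (french_thinning (threshold K pd lambda alpha)) /\
    forall x : pattern W K,
      value pd beta lambda nu c alpha phi x =
      optimal_value pd beta lambda nu c alpha x).
Proof.
have mW := measurable_compact_plane W_compact.
have W_fin := area_compact W_compact.
have c_ge0 := ltW c_gt0; have beta_ge0 := ltW beta_gt0.
have pd_ge0 := ltW pd_gt0; have pd_le1 := ltW pd_lt1.
pose V : pattern W K -> R := best_value c pd beta lambda alpha nu.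
have le_V phi x : value pd beta lambda nu c alpha phi x <= (V x)%:E.
  have [P|noP] := pselect (exists P, trajectory_law pd beta lambda nu phi x P).
    have := getPex P.
    exact: (discounted_value_le mW W_fin K_gt0 c_ge0 lambda_gt0 beta_ge0 pd_ge0 pd_le1
      alpha_ge0 alpha_lt1 nu_marks).
  rewrite /value /path_law getPN; last by move=> P HP; apply: noP; exists P.
  rewrite integral_dirac//; last exact: measurable_discounted_reward.
  rewrite diracT mul1e eseries0 ?lee_fin ?best_value_ge0// => i _ _.
  by rewrite /reward fsetDv big_seq_fset0 !mulr0.
pose phi := french_policy W K (threshold K pd lambda alpha).
have phif : stationary_deterministic phi (french_thinning (threshold K pd lambda alpha)).
  exact: french_policyE.
have phiV x : value pd beta lambda nu c alpha phi x = (V x)%:E.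
  apply/le_anti; rewrite le_V/=.
  have := getPex (french_trajectory_law (threshold K pd lambda alpha) lambda mW W_fin beta_ge0 pd_ge0 pd_le1 nu_marks x).
  move=> HP.
  exact: (discounted_value_ge mW W_fin K_gt0 c_ge0 lambda_gt0 beta_ge0 pd_ge0 pd_le1
      alpha_ge0 alpha_lt1 nu_marks HP pd_gt0 phif).
have optV x : optimal_value pd beta lambda nu c alpha x = (V x)%:E.
  apply/le_anti/andP; split.
    by apply: ge_ereal_sup => _ [psi _ <-].
  by rewrite -phiV; apply: ereal_sup_ubound; exists phi.
split; last by exists phi; split => // x; rewrite phiV optV.
move=> x; rewrite optV sum_powers// /V /best_value EFinD; congr (_ + _%:E); last first.
  congr (c * _)%R; rewrite big_seq [RHS]big_seq; apply: eq_bigr => z zx.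
  by have [_ /(_ z zx) zK _] := pts_simple x; rewrite capped_markE.
have k_fin := mean_mark_fin K_gt0 lambda_gt0 pd_ge0 pd_le1 alpha_ge0 alpha_lt1 nu.
(* Capping the marks is invisible to [nu], which gives [0, K] full mass, and on [0, K] the two
   functions agree. *)
have -> : \int[nu]_(m in `[0%R, K]) (best_mark K pd lambda alpha m)%:E =
    \int[nu]_m (capped_mark K pd lambda alpha m)%:E.
  have mk := measurable_capped_mark K_gt0 lambda_gt0 pd_ge0 pd_le1 alpha_ge0 (ltW alpha_lt1).
  rewrite -(int_marks nu_marks).
  - by apply: eq_integral => m; rewrite inE/= in_itv/= => mK; rewrite capped_markE.
  - exact/measurable_EFinP.
  - move=> m; rewrite lee_fin.
    by have /andP[] := capped_mark_itv K_gt0 lambda_gt0 pd_ge0 pd_le1 alpha_ge0 (ltW alpha_lt1) m.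
by rewrite /newborn_value !EFinM !fineK// !muleA.
Qed.
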